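(* Let $g\in \operatorname{span}\{h_n: n\in\mathbb{N}_0\}$, $g\neq 0$, let $1\leq p<\infty$ and $\eta>0$. Moreover, let (a) $P$ be a star-shaped polygon in $\mathbb{R}^2$ such that $0\in\ker(P)$ and no line passing through an edge of the polygon meets the origin; (b) $z_1,\dots,z_n\in\mathbb{R}^2$, $n\geq 3$, be such that $\arg(z_1),\dots,\arg(z_n),\arg(z_1)$ is strictly increasing or strictly decreasing modulo $2\pi$. Then the following sets are Gabor sampling trajectories for $M^p(\mathbb{R})$ (with window $g$): (i) the set of concentric circles $\mathcal{O}_\eta:=\{(x,y)\in\mathbb{R}^2:\ x^2+y^2=\eta^2k^2,\ k\in\mathbb{N}\}$; (ii) the collection of star-shaped polygons $\mathcal{P}_\eta:=\{(x,y)\in\mathbb{R}^2:\ (x,y)\in\eta kP,\ k\in\mathbb{N}\}$; (iii) $\mathcal{S}_\eta(z_1,\dots,z_n)$, the path generated by the sequence of vectors $\{\eta z_1,\eta z_2,\dots,\eta z_n,2\eta z_1,2\eta z_2,\dots,2\eta z_n,3\eta z_1,3\eta z_2,\dots\}$.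
   Context: $\mathbb{N}=\{1,2,\dots\}$, $\mathbb{N}_0=\mathbb{N}\cup\{0\}$. The Hermite functions are $h_n(t)=\frac{2^{1/4}}{\sqrt{n!}}\left(\frac{-1}{2\sqrt{\pi}}\right)^n e^{\pi t^2}\frac{d^n}{dt^n}\left(e^{-2\pi t^2}\right)$, $n\in\mathbb{N}_0$; $h_0$ is the normalized Gaussian, and span means finite linear combinations with complex coefficients. For $z=(x,\xi)\in\mathbb{R}^2$ put $\pi(z)g(t)=e^{2\pi i\xi t}g(t-x)$. The short-time Fourier transform of $f$ with window $g$ is $V_gf(z)=\langle f,\pi(z)g\rangle=\int_{\mathbb{R}}f(t)\overline{g(t-x)}e^{-2\pi i\xi t}\,dt$, where for distributions $f$ the bracket is the duality pairing (antilinear in the second argument). The modulation space is $M^p(\mathbb{R})=\{f\in\mathcal{S}'(\mathbb{R}): V_{h_0}f\in L^p(\mathbb{R}^2)\}$ with norm $\|f\|_{M^p}=\|V_{h_0}f\|_{L^p(\mathbb{R}^2)}$. $\mathcal{H}^1$ is the 1-dimensional Hausdorff measure on $\mathbb{R}^2$, normalized to equal Lebesgue measure on lines. A trajectory is the image of a curve $\gamma:\mathbb{R}\to\mathbb{R}^2$ whose restriction to each finite interval is rectifiable; a trajectory set is a countable collection (union) of trajectories. A trajectory set $\Gamma\subset\mathbb{R}^2$ is a Gabor sampling trajectory for $M^p(\mathbb{R})$ (with window $g$) if there are constants $A,B>0$ with $A\|f\|_{M^p}^p\leq\int_\Gamma|V_gf(z)|^p\,d\mathcal{H}^1(z)\leq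 B\|f\|_{M^p}^p$ for all $f\in M^p(\mathbb{R})$. A polygon $P$ is here understood as the closed simple polygonal curve (the union of its edges); $\ker(P)$ is the set of points $q$ of the closed region bounded by $P$ such that for every point $w$ of this region the segment from $q$ to $w$ lies in the region; $P$ is star-shaped if $\ker(P)\neq\emptyset$. $\arg(z)$ is the argument (polar angle) of $z\in\mathbb{R}^2\cong\mathbb{C}$. The path generated by a sequence of vectors is the polygonal path joining consecutive vectors of the sequence by line segments.
   Formalization: In (b), each consecutive turn of arg(z_1),…,arg(z_n),arg(z_1) is required to be strictly less than π in size; with a gap of π or more (e.g. arguments 10°, 20°, 30°) the path stays in a half-plane and is not a sampling trajectory. *)

(* Defs.v *)
From HB Require Import structures.
From mathcomp Require Import all_boot all_order all_algebra.
From mathcomp Require Import all_classical all_reals all_analysis.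
From mathcomp Require Import complex.

Set Implicit Arguments.
Unset Strict Implicit.
Unset Printing Implicit Defensive.
Import Order.TTheory GRing.Theory Num.Theory.
Import numFieldNormedType.Exports.
Import ComplexField.Normc.

Local Open Scope classical_set_scope.
Local Open Scope ring_scope.

(* The product norm on R * R is the sup norm, whereas diameters, lengths and
   polar coordinates are Euclidean. *)
Definition edist {R : realType} (z w : R * R) : R :=
  Num.sqrt ((z.1 - w.1) ^+ 2 + (z.2 - w.2) ^+ 2).

Definition enorm {R : realType} (z : R * R) : R := edist z 0.

Section hausdorff_measure.
Context {R : realType}.
Implicit Types (A : set (R * R)) (F : (set (R * R))^nat) (d : R).
Local Open Scope ereal_scope.

(* The maximum with 0 makes the diameter of the empty set 0. *)
Definition ediam A : \bar R :=
  maxe 0 (ereal_sup [set (edist zw.1 zw.2)%:E | zw in A `*` A]).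

Definition hausdorff_cover d A : set ((set (R * R))^nat) :=
  [set F | A `<=` \bigcup_k F k /\ forall k, ediam (F k) <= d%:E].

Definition hausdorff1_pre d A : \bar R :=
  ereal_inf [set \sum_(k <oo) ediam (F k) | F in hausdorff_cover d A].

(* In dimension one the sum of diameters needs no normalizing constant: the
   measure of a segment is its length. *)
Definition hausdorff1 A : \bar R :=
  ereal_sup [set hausdorff1_pre d A | d in [set d | (0 < d)%R]].

Lemma ediam_ge0 A : 0 <= ediam A.
Proof. by rewrite /ediam le_max lexx. Qed.

Lemma ediam_set0 : ediam set0 = 0.
Proof. by rewrite /ediam set0X image_set0 ereal_sup0 maxeNy. Qed.

Lemma hausdorff1_pre_ge0 d A : 0 <= hausdorff1_pre d A.
Proof.
apply: le_ereal_inf_tmp => _ [F _ <-].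
by apply: nneseries_ge0 => *; exact: ediam_ge0.
Qed.

Lemma le_hausdorff1_pre d A B : A `<=` B ->
  hausdorff1_pre d A <= hausdorff1_pre d B.
Proof.
move=> AB; apply/ereal_inf_le_tmp => x [F [BF Fd] <-].
by exists F => //; split => //; exact: subset_trans AB BF.
Qed.

Lemma hausdorff1_pre0 d : (0 < d)%R -> hausdorff1_pre d set0 = 0.
Proof.
move=> d0; apply/eqP; rewrite eq_le hausdorff1_pre_ge0 andbT.
apply: ereal_inf_lbound; exists (fun=> set0).
  by split => // k; rewrite ediam_set0 lee_fin ltW.
by apply: eseries0 => k _ _; exact: ediam_set0.
Qed.

Lemma hausdorff1_pre_sigma_subadditive d : sigma_subadditive (hausdorff1_pre d).
Proof.
move=> A; have [[i ioo]|] := pselect (exists i, hausdorff1_pre d (A i) = +oo).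
  rewrite (eseries_pinfty _ _ ioo) ?leey// => n _.
  by rewrite -ltNye (lt_le_trans _ (hausdorff1_pre_ge0 _ _)).
rewrite -forallNE => Aoo.
suff add2e (e : {posnum R}) : hausdorff1_pre d (\bigcup_n A n) <=
    \sum_(i <oo) hausdorff1_pre d (A i) + e%:num%:E.
  by apply/lee_addgt0Pr => _/posnumP[].
rewrite (le_trans _ (epsilon_trick _ _ _))//; last first.
  by move=> n; exact: hausdorff1_pre_ge0.
pose P n (B : (set (R * R))^nat) := hausdorff_cover d (A n) B /\
  \sum_(k <oo) ediam (B k) <=
  hausdorff1_pre d (A n) + (e%:num / (2 ^ n.+1)%:R)%:E.
have [G PG] : {G : ((set (R * R))^nat)^nat & forall n, P n (G n)}.
  apply: (@choice _ _ P) => n; rewrite /P /hausdorff1_pre.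
  set S := (X in ereal_inf X); move infS : (ereal_inf S) => iS.
  case: iS infS => [r Sr|Soo|Soo].
  - have en1 : (0 < e%:num / (2 ^ n.+1)%:R)%R by [].
    have /(lb_ereal_inf_adherent en1) : ereal_inf S \is a fin_num by rewrite Sr.
    move=> [x [B BA muBx] xS].
    by exists B; split => //; rewrite muBx -Sr; exact/ltW.
  - by have := Aoo n; rewrite /hausdorff1_pre Soo.
  - suff : lbound S 0 by move/le_ereal_inf_tmp; rewrite Soo.
    by move=> /= _ [B _ <-]; apply: nneseries_ge0 => *; exact: ediam_ge0.
have G_ge0 x : 0 <= (ediam \o uncurry G) x by exact: ediam_ge0.
apply: (@le_trans _ _ (\esum_(i in setT) (ediam \o uncurry G) i)).
  apply: ereal_inf_lbound => /=.
  have /card_esym/ppcard_eqP[f] := card_nat2.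
  exists (uncurry G \o f).
    split=> [t [i _ Ait]|k /=].
      have [[/(_ t Ait)[j _ Gijt] _] _] := PG i.
      by exists (f^-1%FUN (i, j)) => //=; rewrite invK ?inE.
    by case: (f k) => i j /=; have [[_ +] _] := PG i; exact.
  rewrite -(esum_pred_image (ediam \o uncurry G) _ xpredT) ?[fun=> _]set_true//.
  by rewrite image_eq.
rewrite (_ : esum _ _ = \sum_(i <oo) \sum_(j <oo ) ediam (G i j)); last first.
  pose J : nat -> set (nat * nat) := fun i => [set (i, j) | j in setT].
  rewrite (_ : setT = \bigcup_k J k); last first.
    by rewrite predeqE => -[a b]; split => // _; exists a => //; exists b.
  rewrite esum_bigcupT /=; last 2 first.
    - apply/trivIsetP => i j _ _ ij.
      rewrite predeqE => -[n m] /=; split => //= -[] [_] _ [<-{n} _].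
      by move=> [m' _] [] /esym/eqP; rewrite (negbTE ij).
    - by move=> *; exact: ediam_ge0.
  rewrite -(image_id [set: nat]) -fun_true esum_pred_image//; last first.
    by move=> n _; apply: esum_ge0 => *; exact: ediam_ge0.
  apply: eq_eseriesr => /= j _.
  rewrite -(esum_pred_image (ediam \o uncurry G) (pair j) predT)//=; last 2 first.
    - by move=> *; exact: ediam_ge0.
    - by move=> ? ? _ _; exact: (@can_inj _ _ _ snd).
  by congr esum; rewrite predeqE => -[a b]; split; move=> [i _ <-]; exists i.
apply: lee_lim.
- apply: is_cvg_nneseries => n *.
  by apply: nneseries_ge0 => m *; exact: (G_ge0 (n, m)).
- by apply: is_cvg_nneseries => n *; apply: adde_ge0 => //;
    exact: hausdorff1_pre_ge0.
- by near=> n; apply: lee_sum => i _; exact: (PG i).2.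
Unshelve. all: by end_near. Qed.

Lemma hausdorff1_0 : hausdorff1 set0 = 0.
Proof.
apply/eqP; rewrite eq_le; apply/andP; split.
  by apply: ge_ereal_sup => _ [d d0 <-]; rewrite hausdorff1_pre0.
by apply: ereal_sup_ubound; exists 1%R => //=; rewrite hausdorff1_pre0.
Qed.

Lemma hausdorff1_ge0 A : 0 <= hausdorff1 A.
Proof.
apply: (le_trans (hausdorff1_pre_ge0 1 A)).
by apply: ereal_sup_ubound; exists 1%R => /=.
Qed.

Lemma le_hausdorff1 : {homo hausdorff1 : A B / A `<=` B >-> A <= B}.
Proof.
move=> A B AB; apply: ge_ereal_sup => _ [d d0 <-].
apply: (le_trans (le_hausdorff1_pre d AB)).
by apply: ereal_sup_ubound; exists d.
Qed.

Lemma hausdorff1_sigma_subadditive : sigma_subadditive hausdorff1.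
Proof.
move=> F; apply: ge_ereal_sup => _ [d d0 <-].
apply: (le_trans (hausdorff1_pre_sigma_subadditive d F)).
apply: lee_nneseries => [k _ _|k _]; first exact: hausdorff1_pre_ge0.
by apply: ereal_sup_ubound; exists d.
Qed.

HB.instance Definition _ := isOuterMeasure.Build R (R * R)%type hausdorff1
  hausdorff1_0 hausdorff1_ge0 le_hausdorff1 hausdorff1_sigma_subadditive.

(* The plane with the sigma-algebra of Caratheodory measurable sets of
   hausdorff1, as opposed to the product sigma-algebra of R * R. *)
Definition hausdorff_plane : Type := (R * R)%type.

HB.instance Definition _ := Pointed.copy hausdorff_plane (R * R)%type.
HB.instance Definition _ := @isMeasurable.Build
  (caratheodory_display hausdorff1) hausdorff_plane
  hausdorff1.-caratheodory (caratheodory_measurable_set0 hausdorff1)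
  (@caratheodory_measurable_setC _ _ hausdorff1)
  (@caratheodory_measurable_bigcup _ _ hausdorff1).

Definition hausdorff_measure1 : set hausdorff_plane -> \bar R := hausdorff1.

HB.instance Definition _ := isMeasure.Build _ hausdorff_plane R
  hausdorff_measure1
  (@caratheodory_measure0 _ _ hausdorff1)
  (@caratheodory_measure_ge0 _ _ hausdorff1)
  (@caratheodory_measure_sigma_additive _ _ hausdorff1).

End hausdorff_measure.

Section gabor.
Context {R : realType}.
Implicit Types (g phi psi : R -> R[i]) (f : (R -> R[i]) -> R[i]) (p : R)
  (z w : R * R) (Gamma : set (R * R)).

Definition hermite (n : nat) (t : R) : R :=
  2 `^ (4^-1) / Num.sqrt (n`!%:R) * (- 1 / (2 * Num.sqrt pi)) ^+ n *
  expR (pi * t ^+ 2) *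
  derive1n n (fun s : R => expR (- 2 * pi * s ^+ 2)) t.

Definition gaussian (t : R) : R[i] := (hermite 0 t)%:C%C.

Definition hermite_span : set (R -> R[i]) :=
  [set g | exists (N : nat) (c : 'I_N -> R[i]),
    g = fun t => \sum_(n < N) c n * (hermite n t)%:C%C].

Definition tf_shift z g : R -> R[i] :=
  fun t => (cos (2 * pi * z.2 * t) +i* sin (2 * pi * z.2 * t))%C * g (t - z.1).

Definition cderiv (k : nat) phi : R -> R[i] := fun t =>
  (derive1n k (fun s => complex.Re (phi s)) t +i*
   derive1n k (fun s => complex.Im (phi s)) t)%C.

Definition smooth (h : R -> R) : Prop :=
  forall k t, derivable (derive1n k h) t 1.

(* The Schwartz seminorm p_{m,k}(phi) = sup_t |t^m phi^(k)(t)| is <= C. *)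
Definition seminorm_le (m k : nat) phi (C : R) : Prop :=
  forall t, `|t| ^+ m * normc (cderiv k phi t) <= C.

Definition schwartz : set (R -> R[i]) :=
  [set phi | [/\ smooth (fun t => complex.Re (phi t)),
                 smooth (fun t => complex.Im (phi t)) &
                 forall m k, exists C, seminorm_le m k phi C]].

(* S'(R): functionals that are linear on the Schwartz space and continuous for
   the topology of the seminorms p_{m,k}.  Values outside the Schwartz space
   are irrelevant. *)
Definition tempered : set ((R -> R[i]) -> R[i]) :=
  [set f |
    (forall (a : R[i]) phi psi, schwartz phi -> schwartz psi ->
       f (fun t => a * phi t + psi t) = a * f phi + f psi) /\
    (forall phi, schwartz phi -> forall e : R, 0 < e ->
       exists (N : nat) (d : R), 0 < d /\
         forall psi, schwartz psi ->
           (forall m k, (m <= N)%N -> (k <= N)%N ->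
              seminorm_le m k (fun t => psi t - phi t) d) ->
           normc (f psi - f phi) < e)].

(* A function F is identified with the linear functional
   phi |-> \int F(t) phi(t) dt, so that the pairing that is antilinear in its
   second argument is <f, phi> = f (conj phi). *)
Definition pairing f phi : R[i] := f (fun t => (phi t)^*%C).

Definition stft g f z : R[i] := pairing f (tf_shift z g).

Definition lebesgue2 := ((@lebesgue_measure R) \x (@lebesgue_measure R))%E.

Definition modulation_norm p f : \bar R :=
  'N[lebesgue2]_(p%:E)[(fun z => (normc (stft gaussian f z))%:E)]%E.

Definition modulation_space p : set ((R -> R[i]) -> R[i]) :=
  [set f | [/\ tempered f,
    measurable_fun setT (fun z : R * R => complex.Re (stft gaussian f z)),
    measurable_fun setT (fun z : R * R => complex.Im (stft gaussian f z)) &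
    (modulation_norm p f < +oo)%E]].

Definition rectifiable (gamma : R -> R * R) (a b : R) : Prop :=
  exists L : R, forall s : seq R, itv_partition a b s ->
    \sum_(q <- zip (a :: s) s) edist (gamma q.1) (gamma q.2) <= L.

Definition trajectory : set (set (R * R)) :=
  [set T | exists gamma : R -> R * R,
    [/\ continuous gamma,
        forall a b, a <= b -> rectifiable gamma a b &
        T = range gamma]].

Definition trajectory_set : set (set (R * R)) :=
  [set Gamma | exists (I : set nat) (T : nat -> set (R * R)),
    (forall i, I i -> trajectory (T i)) /\ Gamma = \bigcup_(i in I) T i].

Definition sampling_energy g p f Gamma : \bar R :=
  (\int[hausdorff_measure1]_(z in Gamma) (normc (stft g f z) `^ p)%:E)%E.

Definition gabor_sampling_trajectory g p : set (set (R * R)) :=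
  [set Gamma | trajectory_set Gamma /\
    exists A B : R, [/\ 0 < A, 0 < B &
      forall f, modulation_space p f ->
        (A%:E * modulation_norm p f `^ p <= sampling_energy g p f Gamma)%E /\
        (sampling_energy g p f Gamma <= B%:E * modulation_norm p f `^ p)%E]].

End gabor.

Section planar_sets.
Context {R : realType}.
Implicit Types (z w q : R * R) (s : seq (R * R)) (A : set (R * R)).

Definition affine_comb z w (t : R) : R * R := (1 - t) *: z + t *: w.

Definition segment z w : set (R * R) :=
  [set affine_comb z w t | t in [set t | 0 <= t <= 1]].

(* The entry of s at index i modulo its length. *)
Definition cyc s (i : nat) : R * R := nth 0 s (i %% size s).

Definition polygon s : set (R * R) :=
  \bigcup_(i in `I_(size s)) segment (cyc s i) (cyc s i.+1).

(* The closed polygonal line through the vertices s is simple: its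
   parametrization by half-open edges is injective. *)
Definition simple_polygon s : Prop :=
  (3 <= size s)%N /\
  forall i j (t u : R), (i < size s)%N -> (j < size s)%N ->
    0 <= t < 1 -> 0 <= u < 1 ->
    affine_comb (cyc s i) (cyc s i.+1) t =
      affine_comb (cyc s j) (cyc s j.+1) u ->
    i = j /\ t = u.

(* A together with the bounded connected components of its complement. *)
Definition bounded_region A : set (R * R) :=
  A `|` [set w | ~ A w /\ bounded_set (connected_component (~` A) w)].

Definition star_kernel A : set (R * R) :=
  [set q | bounded_region A q /\
    forall w, bounded_region A w -> segment q w `<=` bounded_region A].

Definition star_shaped A : Prop := star_kernel A !=set0.

Definition edge_lines_avoid_origin s : Prop :=
  forall i (t : R), (i < size s)%N -> affine_comb (cyc s i) (cyc s i.+1) t <> 0.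

Definition is_arg z (theta : R) : Prop :=
  z <> 0 /\ z = (enorm z * cos theta, enorm z * sin theta).

(* The arguments of s_0, ..., s_(n-1), s_0 are strictly increasing (resp.
   decreasing) modulo 2 pi when each one is reached from the previous one by a
   positive (resp. negative) turn, where turns are taken modulo 2 pi in
   ]- pi, pi[; a half turn, being both pi and - pi modulo 2 pi, is neither.
   Larger gaps must be excluded: the spiral would otherwise miss a sector. *)
Definition arg_increasing s : Prop :=
  exists theta : nat -> R,
    (forall i, (i <= size s)%N -> is_arg (cyc s i) (theta i)) /\
    (forall i, (i < size s)%N -> 0 < theta i.+1 - theta i < pi).

Definition arg_decreasing s : Prop :=
  exists theta : nat -> R,
    (forall i, (i <= size s)%N -> is_arg (cyc s i) (theta i)) /\
    (forall i, (i < size s)%N -> 0 < theta i - theta i.+1 < pi).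

Definition concentric_circles (eta : R) : set (R * R) :=
  [set z | exists k : nat, (0 < k)%N /\
    z.1 ^+ 2 + z.2 ^+ 2 = eta ^+ 2 * k%:R ^+ 2].

Definition concentric_dilates (eta : R) A : set (R * R) :=
  [set z | exists k : nat, (0 < k)%N /\
    exists2 w, A w & z = (eta * k%:R) *: w].

(* Entry j = m n + i, with i < n = size s, is (m + 1) eta s_i. *)
Definition spiral_vertex (eta : R) s (j : nat) : R * R :=
  ((j %/ size s).+1%:R * eta) *: cyc s j.

Definition spiral_path (eta : R) s : set (R * R) :=
  \bigcup_j segment (spiral_vertex eta s j) (spiral_vertex eta s j.+1).

End planar_sets.

(* Main.v *)
(* For g = q(t) exp(-pi t^2) the short-time Fourier transform of f is, up to a
   Gaussian factor and a phase, a polyanalytic function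
   sum_(j <= N) F_j(zeta) x^j of zeta = x - i xi with entire F_j, where F_N is a
   multiple of the Bargmann transform of f.  On a line or a circle, x is an
   affine, resp. rational, function of zeta, so there V_g f coincides with a
   holomorphic function, which polynomial interpolation at D points controls up
   to a factor 2^-D of its supremum on a larger disc.  Doing this on N + 1 arcs
   near w with separated values of x recovers F_N, hence
     |V_(h_0) f(w)| <= C_D max |V_g f(w + t_ki)| + C_0 2^-D sup_(B(w,r)) |V_(h_0) f|
   with N + 1 and D points that are free to move in sets of positive length.
   Averaging over these points, summing p-th powers over the unit squares and
   absorbing the last term for D large, which is possible because V_(h_0) f has
   polynomial growth, gives the lower sampling bound.
   The upper bound is the submean property and the local finiteness of length.
   Polygons and spirals are treated together: both consist of segments
   joining two adjacent rays of a fan, and a sparse choice of the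
   segments crossing a given sector makes their distances to w separated. *)
From Pilot Require Import Defs.
From HB Require Import structures.
From mathcomp Require Import all_boot all_order all_algebra all_solvable all_field.
From mathcomp Require Import all_classical all_reals all_analysis measurable_realfun.
From mathcomp Require Import complex ring lra zify.
Set Implicit Arguments.
Unset Strict Implicit.
Unset Printing Implicit Defensive.
Import Order.TTheory GRing.Theory Num.Theory.
Import numFieldNormedType.Exports.
Import ComplexField.Normc.
Import Pilot.Defs.
Local Open Scope classical_set_scope.
Local Open Scope ring_scope.

(** * Interpolation of polyanalytic polynomials *)

(** [f] is only a continuous functional, so no entire function is ever formed. On each disc the
    Bargmann transform and its first derivatives are approximated within an arbitrary [e] by one
    polynomial [P], because the remainders of the exponential series, damped by the Gaussian window,
    tend to 0 in every Schwartz seminorm. All complex analysis then concerns polynomials measured by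
    their coefficients, and [e] tends to 0 at the end of each local estimate. Two requirements shape
    the estimates. The constants must not depend on [w]: everything is recentred at [w], and the
    equations of the arcs are normalized so that their coefficients stay bounded as [w] tends to
    infinity. And C_0 must be known before the number of points is chosen: it depends on the radii
    and on the shape of the arcs, whereas the separation of the points, which shrinks as they
    multiply, enters C_D. The absorption runs over growing finite boxes, where every quantity is
    finite for any tempered [f]. *)

Section normc_lemmas.
Context {R : rcfType}.
Implicit Types (x y z : R[i]) (r : R).

Lemma normc_ge0 z : 0 <= normc z.
Proof. by case: z => a b /=; exact: sqrtr_ge0. Qed.

Lemma normcX z n : normc (z ^+ n) = normc z ^+ n.
Proof.
by elim: n => [|n IH]; rewrite ?expr0 ?normc1 // !exprS normcM IH.
Qed.

Lemma normcB_sym x y : normc (x - y) = normc (y - x).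
Proof. by rewrite -normcN opprB. Qed.

Lemma le_normcB x y : normc (x - y) <= normc x + normc y.
Proof. by rewrite -(normcN y); exact: le_normcD. Qed.

Lemma le_normc_sum (I : Type) (s : seq I) (P : pred I) (F : I -> R[i]) :
  normc (\sum_(i <- s | P i) F i) <= \sum_(i <- s | P i) normc (F i).
Proof.
elim/big_rec2: _ => [|i a b _ ab]; first by rewrite normc0.
by rewrite (le_trans (le_normcD _ _))// lerD2l.
Qed.

Lemma normc_real r : normc r%:C%C = `|r|.
Proof. by rewrite /= expr0n addr0 sqrtr_sqr. Qed.

Lemma normc_nat n : normc (n%:R : R[i]) = n%:R.
Proof. by rewrite -(rmorph_nat (real_complex R)) normc_real normr_nat. Qed.

Lemma normc_conj z : normc z^*%C = normc z.
Proof. by case: z => a b /=; rewrite sqrrN. Qed.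

Lemma normc_sqr z : normc z ^+ 2 = complex.Re z ^+ 2 + complex.Im z ^+ 2.
Proof. by case: z => a b /=; rewrite sqr_sqrtr // addr_ge0 ?sqr_ge0. Qed.

Lemma normc_eq0 z : (normc z == 0) = (z == 0).
Proof. by apply/eqP/eqP => [/eq0_normc //|->]; rewrite normc0. Qed.

Lemma normc_gt0 z : (0 < normc z) = (z != 0).
Proof. by rewrite lt_neqAle normc_ge0 andbT eq_sym normc_eq0. Qed.

Lemma le_normc_ReIm z : normc z <= `|complex.Re z| + `|complex.Im z|.
Proof.
rewrite -ler_sqr ?nnegrE ?normc_ge0 ?addr_ge0 // normc_sqr.
have := mulr_ge0 (normr_ge0 (complex.Re z)) (normr_ge0 (complex.Im z)).
rewrite -(real_normK (num_real (complex.Re z))).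
by rewrite -(real_normK (num_real (complex.Im z))) => H; nra.
Qed.

Lemma le_Re_normc z : `|complex.Re z| <= normc z.
Proof.
rewrite -ler_sqr ?nnegrE ?normc_ge0 // normc_sqr real_normK ?num_real //.
by rewrite lerDl sqr_ge0.
Qed.

Lemma le_Im_normc z : `|complex.Im z| <= normc z.
Proof.
rewrite -ler_sqr ?nnegrE ?normc_ge0 // normc_sqr real_normK ?num_real //.
by rewrite lerDr sqr_ge0.
Qed.

End normc_lemmas.

Section weighted_norm.
Context {R : rcfType}.
Implicit Types (P Q : {poly R[i]}) (t z : R[i]) (r m : R).

(* The sum of |a_n| r^n over the coefficients a_n of P: a submultiplicative
   norm dominating the sup norm on the disc of radius r. *)
Definition wnorm r P : R := horner_rec [seq normc a | a <- polyseq P] r.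

Lemma wnorm0 r : wnorm r 0 = 0.
Proof. by rewrite /wnorm polyseq0. Qed.

Lemma wnorm_cons r P c : wnorm r (P * 'X + c%:P) = normc c + r * wnorm r P.
Proof.
rewrite /wnorm -cons_poly_def polyseq_cons; case: ifP => [_ /=|/negbT].
  by rewrite addrC mulrC.
rewrite /nilp => /negPn /eqP/size0nil ->; rewrite /= mulr0 addr0.
rewrite polyseqC; have [->|_] := eqVneq c 0; first by rewrite normc0.
by rewrite /= mul0r add0r.
Qed.

Lemma wnormC r c : wnorm r c%:P = normc c.
Proof. by have := wnorm_cons r 0 c; rewrite mul0r add0r wnorm0 mulr0 addr0. Qed.

Lemma wnorm_ge0 r P : 0 <= r -> 0 <= wnorm r P.
Proof.
move=> r0; elim/poly_ind: P => [|P c IH]; first by rewrite wnorm0.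
by rewrite wnorm_cons addr_ge0 ?normc_ge0 ?mulr_ge0.
Qed.

Lemma wnorm_mulX r P : wnorm r (P * 'X) = r * wnorm r P.
Proof. by have := wnorm_cons r P 0; rewrite polyC0 addr0 normc0 add0r. Qed.

Lemma wnormX r : wnorm r 'X = r.
Proof. by have := wnorm_mulX r 1%:P; rewrite mul1r wnormC normc1 mulr1. Qed.

Lemma le_wnormD r P Q : 0 <= r -> wnorm r (P + Q) <= wnorm r P + wnorm r Q.
Proof.
move=> r0; elim/poly_ind: P Q => [|P c IH] Q; first by rewrite wnorm0 !add0r.
elim/poly_ind: Q => [|Q d _]; first by rewrite wnorm0 !addr0.
have -> : P * 'X + c%:P + (Q * 'X + d%:P) = (P + Q) * 'X + (c + d)%:P.
  by rewrite polyCD; ring.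
rewrite !wnorm_cons; have := IH Q; have := le_normcD c d; nra.
Qed.

Lemma wnormZ r c P : wnorm r (c%:P * P) = normc c * wnorm r P.
Proof.
elim/poly_ind: P => [|P d IH]; first by rewrite mulr0 wnorm0 mulr0.
have -> : c%:P * (P * 'X + d%:P) = c%:P * P * 'X + (c * d)%:P.
  by rewrite polyCM; ring.
by rewrite !wnorm_cons IH normcM; ring.
Qed.

Lemma wnormN r P : wnorm r (- P) = wnorm r P.
Proof.
by rewrite -mulN1r -polyC1 -polyCN wnormZ normcN normc1 mul1r.
Qed.

Lemma le_wnormB r P Q : 0 <= r -> wnorm r (P - Q) <= wnorm r P + wnorm r Q.
Proof. by move=> r0; rewrite -(wnormN r Q); exact: le_wnormD. Qed.

Lemma le_wnormM r P Q : 0 <= r -> wnorm r (P * Q) <= wnorm r P * wnorm r Q.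
Proof.
move=> r0; elim/poly_ind: P => [|P c IH]; first by rewrite mul0r wnorm0 mul0r.
rewrite mulrDl -mulrA ['X * Q]mulrC mulrA wnorm_cons.
rewrite (le_trans (le_wnormD _ _ r0))// wnorm_mulX wnormZ.
have := ler_wpM2l r0 IH; nra.
Qed.

Lemma le_wnormX r P n : 0 <= r -> wnorm r (P ^+ n) <= wnorm r P ^+ n.
Proof.
move=> r0; elim: n => [|n IH]; first by rewrite !expr0 wnormC normc1.
rewrite !exprS (le_trans (le_wnormM _ _ r0))// ler_wpM2l// wnorm_ge0//.
Qed.

Lemma le_wnorm_sum (I : Type) r (s : seq I) (p : pred I) (F : I -> {poly R[i]}) :
  0 <= r -> wnorm r (\sum_(i <- s | p i) F i) <= \sum_(i <- s | p i) wnorm r (F i).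
Proof.
move=> r0; elim/big_rec2: _ => [|i a b _ ab]; first by rewrite wnorm0.
by rewrite (le_trans (le_wnormD _ _ r0))// lerD2l.
Qed.

Lemma le_wnorm r r' P : 0 <= r -> r <= r' -> wnorm r P <= wnorm r' P.
Proof.
move=> r0 rr'; elim/poly_ind: P => [|P c IH]; first by rewrite !wnorm0.
by rewrite !wnorm_cons lerD2l ler_pM// wnorm_ge0.
Qed.

Lemma le_horner_wnorm r P z : normc z <= r -> normc P.[z] <= wnorm r P.
Proof.
move=> zr; have r0 : 0 <= r := le_trans (normc_ge0 _) zr.
elim/poly_ind: P => [|P c IH]; first by rewrite horner0 normc0 wnorm0.
rewrite hornerMXaddC wnorm_cons (le_trans (le_normcD _ _))// addrC lerD2l.
by rewrite normcM mulrC ler_pM// normc_ge0.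
Qed.

Lemma wnormE r P n : (size P <= n)%N ->
  wnorm r P = \sum_(i < n) normc P`_i * r ^+ i.
Proof.
elim: n P => [|n IH] P; first by rewrite leqn0 size_poly_eq0 => /eqP ->; rewrite wnorm0 big_ord0.
elim/poly_ind: P => [_|P c _ sP].
  by rewrite wnorm0 big1// => i _; rewrite coef0 normc0 mul0r.
have {}sP : (size P <= n)%N.
  by move: sP; rewrite size_MXaddC; case: ifP => [/andP[/eqP -> _]|_]; rewrite ?size_poly0.
rewrite wnorm_cons (IH _ sP) big_ord_recl expr0 mulr1 mulr_sumr.
congr (_ + _); first by rewrite coefD coefMX coefC eqxx/= add0r.
apply: eq_bigr => i _; rewrite coefD coefMX coefC/= addr0 exprS; ring.
Qed.

(** Doubling the radius multiplies the term of degree [i] by [2 ^ i], which exceeds the factor [i]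
    of the derivative. Each derivative costs one doubling, hence the radii [2 ^+ N * r] below. *)
Lemma wnorm_deriv r P : 0 < r -> wnorm r P^`() <= wnorm (2 * r) P / r.
Proof.
move=> r0; rewrite ler_pdivlMr// mulrC.
elim/poly_ind: P => [|P c IH]; first by rewrite deriv0 !wnorm0 mulr0.
rewrite derivD derivM derivX derivC mulr1 addr0 wnorm_cons.
have H1 : wnorm r (P^`() * 'X + P) <= wnorm r P^`() * r + wnorm r P.
  by rewrite (le_trans (le_wnormD _ _ (ltW r0)))// wnorm_mulX mulrC.
have H2 : wnorm r P <= wnorm (2 * r) P by apply: le_wnorm; lra.
have := normc_ge0 c; nra.
Qed.

Lemma wnorm_derivn r P n : 0 < r ->
  wnorm r P^`(n) <= wnorm (2 ^+ n * r) P / r ^+ n.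
Proof.
move=> r0; elim: n r r0 => [|n IH] r r0.
  by rewrite derivn0 !expr0 mul1r divr1.
rewrite derivnS (le_trans (wnorm_deriv _ r0))//.
rewrite [r ^+ _]exprSr invfM mulrA ler_pM2r ?invr_gt0//.
rewrite (le_trans (IH _ _)) ?mulr_gt0// mulrA -exprSr.
have r20 : 0 < 2 * r by rewrite mulr_gt0.
apply: ler_wpM2l.
  by apply: wnorm_ge0; rewrite mulr_ge0 ?exprn_ge0 ?(ltW r0).
rewrite lef_pV2 ?posrE ?exprn_gt0//.
by apply: lerXn2r; rewrite ?nnegrE ?ltW//; lra.
Qed.

(** Multiplication by ['X] multiplies the norm by exactly [r], and subtracting [t%:P * P] takes away
    at most [normc t] times it. Read backwards, this bounds the quotient in a division by
    ['X - t%:P]. *)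
Lemma wnorm_mulXsubC r P t : 0 <= r ->
  (r - normc t) * wnorm r P <= wnorm r (P * ('X - t%:P)).
Proof.
move=> r0; have := wnorm_mulX r P.
have -> : P * 'X = P * ('X - t%:P) + t%:P * P by ring.
move=> H; have := le_wnormD (P * ('X - t%:P)) (t%:P * P) r0.
rewrite H wnormZ; lra.
Qed.

Lemma poly_div_XsubC P t : exists2 Q, Q * ('X - t%:P) = P - P.[t]%:P &
  forall z, P.[z] = P.[t] + Q.[z] * (z - t).
Proof.
have /factor_theorem[Q HQ] : root (P - P.[t]%:P) t.
  by rewrite rootE !hornerE subrr.
exists Q => // z; have := congr1 (fun S : {poly _} => S.[z]) HQ.
by rewrite !hornerE => <-; rewrite addrC subrK.
Qed.

Definition separated m (ts : seq R[i]) :=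
  pairwise (fun a b => m <= normc (a - b)) ts.

(** Newton interpolation, one node at a time: in [P = P.[t] + Q * ('X - t)] the quotient [Q] is
    again small at the other nodes, at a loss of [2 / d]. Since [rho - normc t >= 8 * r] for
    [rho >= 9 * r], division gives [wnorm rho Q <= wnorm rho P / (4 * r)]; with
    [normc (z - t) <= 2 * r] each node gains a factor 1/2. *)
Lemma polynomial_interpolation (r d : R) (n : nat) : 0 < r -> 0 < d ->
  exists2 K : R, 0 <= K & forall P ts m rho z, 0 <= m -> 9 * r <= rho ->
    size ts = n -> separated d ts ->
    (forall t, t \in ts -> normc t <= r /\ normc P.[t] <= m) -> normc z <= r ->
    normc P.[z] <= K * m + wnorm rho P / 2 ^+ n.
Proof.
move=> r0 d0; elim: n => [|n [K K0 IH]].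
  exists 0 => // P ts m rho z m0 Rr _ _ _ zr; rewrite mul0r add0r expr0 divr1.
  by apply: le_horner_wnorm; lra.
exists (1 + 4 * r * K / d); first by have := ltW r0; have := ltW d0; move=> *; rewrite addr_ge0 ?divr_ge0 ?mulr_ge0.
move=> P [//|t ts] m rho z m0 Rr [sts] /=/andP[/allP sept septs] Ht zr.
have rho0 : 0 < rho by lra.
have [tr Ptm] := Ht _ (mem_head _ _).
have [Q QE PQ] := poly_div_XsubC P t.
have Qts s : s \in ts -> normc s <= r /\ normc Q.[s] <= 2 * m / d.
  move=> sts'; have [sr Psm] := Ht s (mem_behead (s := t :: ts) sts').
  split => //; have := sept _ sts'; rewrite normcB_sym => dst.
  have : normc (Q.[s] * (s - t)) <= 2 * m.
    have -> : Q.[s] * (s - t) = P.[s] - P.[t] by rewrite (PQ s) [P.[t] + _]addrC addrK.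
    by rewrite (le_trans (le_normcB _ _))//; lra.
  rewrite normcM ler_pdivlMr// => H; rewrite (le_trans _ H)//.
  by rewrite ler_wpM2l// normc_ge0.
have m1 : 0 <= 2 * m / d by rewrite divr_ge0 ?mulr_ge0// ltW.
have := IH Q ts _ rho z m1 Rr sts septs Qts zr.
have wQ : wnorm rho Q <= wnorm rho P / (4 * r).
  have := wnorm_mulXsubC Q t (ltW rho0).
  rewrite QE.
  have := le_wnormB P P.[t]%:P (ltW rho0); rewrite wnormC.
  have : normc P.[t] <= wnorm rho P by apply: le_horner_wnorm; lra.
  have wQ0 := wnorm_ge0 Q (ltW rho0).
  by rewrite ler_pdivlMr ?mulr_gt0// => *; nra.
move=> HQ.
rewrite (PQ z) (le_trans (le_normcD _ _))// normcM.
have zt : normc (z - t) <= 2 * r by rewrite (le_trans (le_normcB _ _))//; lra.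
have : normc Q.[z] * normc (z - t) <=
    (K * (2 * m / d) + wnorm rho P / (4 * r) / 2 ^+ n) * (2 * r).
  apply: ler_pM; rewrite ?normc_ge0//; apply: (le_trans HQ); rewrite lerD2l.
  by apply: ler_wpM2r; rewrite // invr_ge0 exprn_ge0.
have -> : (K * (2 * m / d) + wnorm rho P / (4 * r) / 2 ^+ n) * (2 * r) =
    4 * r * K / d * m + wnorm rho P / 2 ^+ n.+1.
  have p2 : (2 : R) ^+ n != 0 by rewrite expf_neq0// pnatr_eq0.
  rewrite exprS; field; rewrite p2/= (gt_eqF r0)/=.
  by rewrite (gt_eqF d0).
by lra.
Qed.

(** The top coefficient survives division by ['X - t%:P], while the degree bound drops by one and
    the bound at the remaining nodes grows by [2 / d]. *)
Lemma coef_le_separated (d : R) (n : nat) P ts m : 0 < d -> 0 <= m ->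
  (size P <= n.+1)%N -> size ts = n.+1 -> separated d ts ->
  (forall t, t \in ts -> normc P.[t] <= m) -> normc P`_n <= (2 / d) ^+ n * m.
Proof.
move=> d0; elim: n P ts m => [|n IH] P [//|t ts] m m0 sP [sts] /andP[/allP st sep] Ht.
  rewrite expr0 mul1r; have := Ht t (mem_head _ _).
  by rewrite (size1_polyC sP) hornerC coefC.
have [Q QE PQ] := poly_div_XsubC P t.
have sQ : (size Q <= n.+1)%N.
  have [->|Q0] := eqVneq Q 0; first by rewrite size_poly0.
  have : (size (Q * ('X - t%:P))%R <= n.+2)%N.
    rewrite QE (leq_trans (size_polyD _ _))// geq_max sP size_polyN.
    by rewrite (leq_trans (size_polyC_leq1 _)).
  by rewrite size_mul ?polyXsubC_eq0// size_XsubC addn2 /=.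
have -> : P`_n.+1 = Q`_n.
  have -> : P = Q * ('X - t%:P) + P.[t]%:P by rewrite QE subrK.
  rewrite coefD coefC/= addr0 mulrBr coefB coefMX coefMC/=.
  by rewrite (nth_default 0 sQ) mul0r subr0.
have := IH Q ts (2 * m / d) _ sQ sts sep; rewrite exprSr.
rewrite -[_ * (2 / d) * m]mulrA (_ : 2 / d * m = 2 * m / d); last by ring.
apply; first by rewrite divr_ge0 ?mulr_ge0// ltW.
move=> s sts'; have := st _ sts'; rewrite normcB_sym => dst.
rewrite ler_pdivlMr//.
have : normc (Q.[s] * (s - t)) <= 2 * m.
  have -> : Q.[s] * (s - t) = P.[s] - P.[t] by rewrite (PQ s) [P.[t] + _]addrC addrK.
  rewrite (le_trans (le_normcB _ _))//.
  have := Ht s (mem_behead (s := t :: ts) sts'); have := Ht t (mem_head _ _); lra.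
by rewrite normcM; apply: le_trans; rewrite ler_wpM2l// normc_ge0.
Qed.

(** ['X^n - 1] splits over the algebraically closed [R[i]] and is separable in characteristic 0, so
    there are [n] distinct roots of unity, one of which is primitive. *)
Lemma exists_prim_root n : (n > 0)%N -> exists z : R[i], n.-primitive_root z.
Proof.
pose p : {poly R[i]} := 'X^n - 1; have [r Dp] := closed_field_poly_normal p.
move=> n_gt0; rewrite (monicP _) ?monicXnsubC // scale1r in Dp.
have rn1: all n.-unity_root r by apply/allP=> z; rewrite -root_prod_XsubC -Dp.
have sz_r: (n < (size r).+1)%N.
  by rewrite -(size_prod_XsubC r id) -Dp size_XnsubC.
have [|z] := hasP (has_prim_root n_gt0 rn1 _ sz_r); last by exists z.
by rewrite -separable_prod_XsubC -Dp separable_Xn_sub_1 // pnatr_eq0 -lt0n.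
Qed.

(* Averaging over the n-th roots of unity is exact in degree below n. *)
Lemma cauchy_estimate r m P k : 0 <= r ->
  (forall z, normc z = r -> normc P.[z] <= m) -> normc P`_k * r ^+ k <= m.
Proof.
move=> r0 Pm.
have m0 : 0 <= m by rewrite (le_trans (normc_ge0 P.[r%:C%C]))// Pm// normc_real ger0_norm.
have [sPk|kP] := leqP (size P) k; first by rewrite nth_default// normc0 mul0r.
set n := size P in kP; have n0 : (0 < n)%N by exact: leq_ltn_trans kP.
have [w pw] := exists_prim_root n0.
have nw : normc w = 1.
  apply: (@pexpIrn _ n) => //; rewrite ?nnegrE ?normc_ge0//.
  by rewrite expr1n -normcX (prim_expr_order pw) normc1.
have w0 : w != 0 by rewrite -normc_gt0 nw.
have key : P`_k * r%:C%C ^+ k * n%:R =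
    \sum_(j < n) P.[r%:C%C * w ^+ j] * w ^- (j * k).
  under eq_bigr => j _ do rewrite horner_coef mulr_suml.
  rewrite exchange_big /= (bigD1 (Ordinal kP))//= [X in _ + X]big1 ?addr0.
    rewrite [RHS](eq_bigr (fun=> P`_k * r%:C%C ^+ k)).
      by rewrite sumr_const card_ord mulr_natr.
    move=> j _; rewrite exprMn -exprM mulrA mulfK// expf_neq0//.
  move=> i /negP ik.
  have : w ^+ i / w ^+ k != 1.
    apply/eqP => /(congr1 (fun x => x * w ^+ k)); rewrite mulfVK ?expf_neq0// mul1r.
    by move/eqP; rewrite (eq_prim_root_expr pw) !modn_small.
  rewrite -subr_eq0 => v1.
  transitivity (P`_i * r%:C%C ^+ i * \sum_(j < n) (w ^+ i / w ^+ k) ^+ j).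
    rewrite mulr_sumr; apply: eq_bigr => j _.
    by rewrite !exprMn exprVn -!exprM mulnC [(j * k)%N]mulnC !mulrA.
  suff -> : \sum_(j < n) (w ^+ i / w ^+ k) ^+ j = 0 by rewrite mulr0.
  apply: (mulfI v1); rewrite mulr0 -subrX1.
  rewrite exprMn exprVn -!exprM ![(_ * n)%N]mulnC !exprM (prim_expr_order pw).
  by rewrite !expr1n invr1 mulr1 subrr.
have : normc (P`_k * r%:C%C ^+ k * n%:R) <= \sum_(j < n) m.
  rewrite key (le_trans (le_normc_sum _ _ _))// ler_sum// => j _.
  rewrite normcM normcV normcX nw expr1n invr1 mulr1 Pm//.
  by rewrite normcM normcX nw expr1n mulr1 normc_real ger0_norm.
rewrite sumr_const card_ord !normcM normcX normc_real (ger0_norm r0) normc_nat.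
by rewrite -[m *+ n]mulr_natr ler_pM2r// ltr0n.
Qed.

(** Cauchy's estimate at the doubled radius bounds the term of degree [i] by [m / 2 ^+ i]; the
    geometric series supplies the factor 2. *)
Lemma wnorm_le_sup r m P : 0 < r ->
  (forall z, normc z <= 2 * r -> normc P.[z] <= m) -> wnorm r P <= 2 * m.
Proof.
move=> r0 Pm; have m0 : 0 <= m.
  by rewrite (le_trans (normc_ge0 P.[0]))// Pm// normc0 mulr_ge0// ltW.
rewrite (wnormE r (leqnn _)).
apply: (@le_trans _ _ (\sum_(i < size P) m / 2 ^+ i)).
  apply: ler_sum => i _; rewrite ler_pdivlMr ?exprn_gt0// -mulrA -exprMn.
  apply: cauchy_estimate; first by rewrite mulr_ge0 ?ltW.
  by move=> z zr; apply: Pm; rewrite zr mulrC.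
rewrite -mulr_sumr mulrC ler_wpM2r//.
suff -> : \sum_(i < size P) (2 ^+ i : R)^-1 = 2 - 2 / 2 ^+ size P.
  by rewrite gerBl divr_ge0// exprn_ge0.
elim: (size P) => [|n IH]; first by rewrite big_ord0 expr0 divr1 subrr.
rewrite big_ord_recr /= IH exprS; field.
by rewrite expf_neq0// pnatr_eq0.
Qed.

End weighted_norm.

(** * Tempered distributions and the Bargmann transform *)

Section real_lemmas.
Context {R : realType}.

Lemma nonneg_derive_ge0 (h h' : R -> R) : (forall s : R, is_derive s 1 h (h' s)) ->
  (forall s, 0 <= s -> 0 <= h' s) -> 0 <= h 0 ->
  forall s, 0 <= s -> 0 <= h s.
Proof.
move=> dh h'0 h0 s s0; apply: le_trans h0 _.
apply: (@ger0_derive1_ndecr _ h 0 s) => //.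
- by move=> x; rewrite in_itv/= => /andP[/ltW x0 _]; rewrite derive1E derive_val h'0.
- by apply: derivable_within_continuous.
Qed.

Lemma integrate_exp_bound (h h' : R -> R) (M c : R) :
  (forall s : R, is_derive s 1 h (h' s)) -> h 0 = 0 -> 0 <= M ->
  (forall s, `|h' s| <= M * c * expR (c * `|s|)) ->
  forall s, `|h s| <= M * expR (c * `|s|).
Proof.
move=> dh0 h00 M0 h'b0.
have half (k k' : R -> R) : (forall s : R, is_derive s 1 k (k' s)) -> k 0 = 0 ->
    (forall s, `|k' s| <= M * c * expR (c * `|s|)) ->
    forall s : R, 0 <= s -> k s <= M * expR (c * s).
  move=> dh h0 h'b s s0; rewrite -subr_ge0.
  have d (t : R) : is_derive t 1 (fun s => M * expR (c * s) - k s)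
      (M * (expR (c * t) * c) - k' t).
    have d1 : is_derive t 1 (fun s => c * s) c.
      by have := is_deriveZ c (is_derive_id t 1); rewrite [c *: 1]mulr1.
    have d2 := is_derive1_comp (is_derive_expR (c * t)) d1.
    exact: is_deriveB (is_deriveZ M d2) (dh t).
  apply: (nonneg_derive_ge0 d _ _ s0).
  - move=> t t0; rewrite subr_ge0; have := h'b t; rewrite ler_norml (ger0_norm t0).
    by move=> /andP[_ /le_trans]; apply; rewrite le_eqVlt; apply/orP; left; apply/eqP; ring.
  - by rewrite mulr0 expR0 h0 mulr1 subr0.
have pos (k k' : R -> R) : (forall s : R, is_derive s 1 k (k' s)) -> k 0 = 0 ->
    (forall s, `|k' s| <= M * c * expR (c * `|s|)) ->
    forall s : R, 0 <= s -> `|k s| <= M * expR (c * s).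
  move=> dk k0 k'b s s0; rewrite ler_norml (half k k')// andbT lerNl.
  apply: (half (- k) (fun t => - k' t)) => //.
  - by rewrite fctE k0 oppr0.
  - by move=> t; rewrite normrN.
move=> s; have [s0|s0] := leP 0 s; first by rewrite (ger0_norm s0) (pos h h').
have := pos (h \o -%R) (fun t => h' (- t) * -1) _ _ _ (- s).
rewrite /= opprK (ltr0_norm s0); apply; rewrite ?oppr0//.
- by move=> t; rewrite mulrN1 normrN -(normrN t).
- by rewrite oppr_ge0 ltW.
Qed.

Lemma exprn_le_expR (x : R) n : 0 <= x -> x ^+ n <= expR (n%:R * x).
Proof.
move=> x0; rewrite expRM_natl; apply: lerXn2r; rewrite ?nnegrE ?expR_ge0//.
by have := expR_ge1Dx x; lra.
Qed.

Lemma gaussian_dominates (c b s : R) : 1 <= b ->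
  expR (c * `|s| - (b + 1) * s ^+ 2) <= expR (c ^+ 2) * expR (- s ^+ 2).
Proof.
move=> b1; rewrite -expRD ler_expR -(real_normK (num_real s)).
have := sqr_ge0 (c - `|s|); have := sqr_ge0 `|s|; nra.
Qed.

End real_lemmas.

(** * The complex exponential and the remainders of its series *)

Section complex_exponential.
Context {R : realType}.
Implicit Types (a z : R[i]) (phi psi : R -> R[i]) (t u : R).

Definition cexp z : R[i] :=
  ((expR (complex.Re z))%:C * (cos (complex.Im z) +i* sin (complex.Im z)))%C.

Lemma cexpD a z : cexp (a + z) = cexp a * cexp z.
Proof.
case: a z => [x y] [x' y']; rewrite /cexp /= expRD cosD sinD.
by apply/eqP; rewrite eq_complex /=; apply/andP; split; apply/eqP; ring.
Qed.

Lemma cexp0 : cexp 0 = 1.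
Proof.
rewrite /cexp /= expR0 cos0 sin0.
by apply/eqP; rewrite eq_complex /=; apply/andP; split; apply/eqP; ring.
Qed.

Lemma normc_cexp z : normc (cexp z) = expR (complex.Re z).
Proof.
rewrite /cexp normcM normc_real (ger0_norm (expR_ge0 _)) /=.
by rewrite cos2Dsin2 sqrtr1 mulr1.
Qed.

Lemma conj_cexp z : (cexp z)^*%C = cexp z^*%C.
Proof.
case: z => x y; rewrite /cexp /= cosN sinN.
by apply/eqP; rewrite eq_complex /=; apply/andP; split; apply/eqP; ring.
Qed.

Definition is_cderiv phi psi := forall t,
  is_derive t 1 (fun s => complex.Re (phi s)) (complex.Re (psi t)) /\
  is_derive t 1 (fun s => complex.Im (phi s)) (complex.Im (psi t)).

Lemma is_cderiv_eq phi psi psi' : is_cderiv phi psi -> psi = psi' ->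
  is_cderiv phi psi'.
Proof. by move=> ? <-. Qed.

Lemma is_cderivD phi psi phi' psi' : is_cderiv phi phi' -> is_cderiv psi psi' ->
  is_cderiv (fun t => phi t + psi t) (fun t => phi' t + psi' t).
Proof.
move=> h1 h2 t; have [d1 d2] := h1 t; have [d3 d4] := h2 t.
split.
- rewrite [X in is_derive _ _ X](_ : _ =
    (fun s => complex.Re (phi s)) + (fun s => complex.Re (psi s))).
    rewrite [X in is_derive _ _ _ X](_ : _ = complex.Re (phi' t) + complex.Re (psi' t)).
      exact: is_deriveD.
    by case: (phi' t) (psi' t) => [? ?] [].
  by apply/funext => s; rewrite fctE; case: (phi s) (psi s) => [? ?] [].
- rewrite [X in is_derive _ _ X](_ : _ =
    (fun s => complex.Im (phi s)) + (fun s => complex.Im (psi s))).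
    rewrite [X in is_derive _ _ _ X](_ : _ = complex.Im (phi' t) + complex.Im (psi' t)).
      exact: is_deriveD.
    by case: (phi' t) (psi' t) => [? ?] [].
  by apply/funext => s; rewrite fctE; case: (phi s) (psi s) => [? ?] [].
Qed.

Lemma is_cderivM phi psi phi' psi' : is_cderiv phi phi' -> is_cderiv psi psi' ->
  is_cderiv (fun t => phi t * psi t) (fun t => phi' t * psi t + phi t * psi' t).
Proof.
move=> h1 h2 t; have [d1 d2] := h1 t; have [d3 d4] := h2 t.
pose a s := complex.Re (phi s); pose b s := complex.Im (phi s).
pose c s := complex.Re (psi s); pose d s := complex.Im (psi s).
split.
- rewrite [X in is_derive _ _ X](_ : _ = a * c - b * d).
    apply: is_derive_eq; rewrite /a /b /c /d.
    by case: (phi t) (psi t) (phi' t) (psi' t) => [? ?] [? ?] [? ?] [? ?];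
      rewrite /GRing.scale/=; ring.
  by apply/funext => s; rewrite !fctE /a/b/c/d; case: (phi s) (psi s) => [? ?] [].
- rewrite [X in is_derive _ _ X](_ : _ = a * d + b * c).
    apply: is_derive_eq; rewrite /a /b /c /d.
    by case: (phi t) (psi t) (phi' t) (psi' t) => [? ?] [? ?] [? ?] [? ?];
      rewrite /GRing.scale/=; ring.
  by apply/funext => s; rewrite !fctE /a/b/c/d; case: (phi s) (psi s) => [? ?] [].
Qed.

Lemma is_cderiv_cst a : is_cderiv (fun=> a) (fun=> 0).
Proof. by move=> t; split; exact: is_derive_cst. Qed.

Lemma is_cderivZ a phi phi' : is_cderiv phi phi' ->
  is_cderiv (fun t => a * phi t) (fun t => a * phi' t).
Proof.
move=> h; apply: is_cderiv_eq (is_cderivM (is_cderiv_cst a) h) _.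
by apply/funext => t; rewrite mul0r add0r.
Qed.

Lemma is_cderiv_shift u : is_cderiv (fun t => (t - u)%:C%C) (fun=> 1).
Proof.
move=> t; split => /=; last exact: is_derive_cst.
rewrite [X in is_derive _ _ X](_ : _ = id - cst u)//.
by apply: is_derive_eq; rewrite subr0.
Qed.

Lemma is_cderivX phi phi' n : is_cderiv phi phi' ->
  is_cderiv (fun t => phi t ^+ n) (fun t => n%:R * phi t ^+ n.-1 * phi' t).
Proof.
move=> h; elim: n => [|n IH].
  apply: is_cderiv_eq (is_cderiv_cst 1) _.
  by apply/funext => t; rewrite !mul0r.
rewrite (_ : (fun t => _) = fun t => phi t * phi t ^+ n); last first.
  by apply/funext => t; rewrite exprS.
apply: is_cderiv_eq (is_cderivM h IH) _; apply/funext => t.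
case: n {IH} => [|n] /=; first by rewrite expr0; ring.
by rewrite !exprS -!natr1; ring.
Qed.

Lemma is_cderiv_cexp phi phi' : is_cderiv phi phi' ->
  is_cderiv (fun t => cexp (phi t)) (fun t => phi' t * cexp (phi t)).
Proof.
move=> h t; have [d1 d2] := h t.
pose a s := complex.Re (phi s); pose b s := complex.Im (phi s).
have e1 := is_derive1_comp (is_derive_expR (a t)) d1.
have e2 := is_derive1_comp (is_derive_cos (b t)) d2.
have e3 := is_derive1_comp (is_derive_sin (b t)) d2.
split.
- rewrite [X in is_derive _ _ X](_ : _ = (expR \o a) * (cos \o b)).
    apply: is_derive_eq; rewrite /cexp /a /b ![(_ \o _) _]/=.
    by case: (phi t) (phi' t) => [? ?] [? ?]; rewrite /GRing.scale/=; ring.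
  apply/funext => s; rewrite !fctE /a /b /cexp.
  by case: (phi s) => [? ?] /=; ring.
- rewrite [X in is_derive _ _ X](_ : _ = (expR \o a) * (sin \o b)).
    apply: is_derive_eq; rewrite /cexp /a /b ![(_ \o _) _]/=.
    by case: (phi t) (phi' t) => [? ?] [? ?]; rewrite /GRing.scale/=; ring.
  apply/funext => s; rewrite !fctE /a /b /cexp.
  by case: (phi s) => [? ?] /=; ring.
Qed.

Definition expr_tail n z : R[i] := cexp z - \sum_(k < n) z ^+ k / k`!%:R.

Lemma expr_tail0 z : expr_tail 0 z = cexp z.
Proof. by rewrite /expr_tail big_ord0 subr0. Qed.

Lemma expr_tailS n z : expr_tail n.+1 z = expr_tail n z - z ^+ n / n`!%:R.
Proof. by rewrite /expr_tail big_ord_recr /= opprD addrA. Qed.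

Lemma fact_neq0 n : n`!%:R != 0 :> R[i].
Proof. by rewrite pnatr_eq0 -lt0n fact_gt0. Qed.

Lemma is_cderiv_expr_tail phi phi' n : is_cderiv phi phi' ->
  is_cderiv (fun t => expr_tail n (phi t))
            (fun t => phi' t * expr_tail n.-1 (phi t)).
Proof.
move=> h; elim: n => [|n IH].
  rewrite (_ : (fun t => _) = fun t => cexp (phi t)); last first.
    by apply/funext => t; rewrite expr_tail0.
  apply: is_cderiv_eq (is_cderiv_cexp h) _.
  by apply/funext => t; rewrite expr_tail0.
rewrite (_ : (fun t => expr_tail n.+1 _) =
    fun t => expr_tail n (phi t) + (- n`!%:R^-1) * phi t ^+ n); last first.
  by apply/funext => t; rewrite expr_tailS mulNr mulrC.
apply: is_cderiv_eq (is_cderivD IH (is_cderivZ _ (is_cderivX n h))) _.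
apply/funext => t; case: n {IH} => [|n] /=; first by ring.
have : n.+1%:R != 0 :> R[i] by rewrite pnatr_eq0.
rewrite expr_tailS factS natrM; move: n.+1%:R => c c0; field.
by rewrite fact_neq0 c0.
Qed.

Lemma expr_tail_at0 n : expr_tail n.+1 0 = 0.
Proof.
elim: n => [|n IH]; first by rewrite expr_tailS expr_tail0 cexp0 expr0 divr1 subrr.
by rewrite expr_tailS IH expr0n /= mul0r subr0.
Qed.

(** Up to the factor [a], each remainder is a primitive of the previous one. Integrating an
    exponential of rate [4 * T] against the factor [T] gains 1/4, and bounding real and imaginary
    parts separately loses 2: a net gain of 1/2 per order. *)
Lemma normc_expr_tail (T : R) a n t : normc a <= T ->
  normc (expr_tail n (a * t%:C%C)) <= expR (4 * T * `|t|) / 2 ^+ n.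
Proof.
move=> aT; have T0 : 0 <= T := le_trans (normc_ge0 a) aT.
elim: n t => [|n IH] t.
  rewrite expr_tail0 expr0 divr1 normc_cexp ler_expR.
  apply: (le_trans (ler_norm _)); apply: (le_trans (le_Re_normc _)).
  rewrite normcM normc_real; have := normr_ge0 t; have := normc_ge0 a; nra.
have d : is_cderiv (fun t => expr_tail n.+1 (a * t%:C%C))
    (fun t => a * 1 * expr_tail n (a * t%:C%C)).
  apply: (@is_cderiv_expr_tail _ (fun=> a * 1) n.+1).
  have := is_cderivZ a (is_cderiv_shift 0).
  by under eq_fun do rewrite subr0.
have bd s : normc (a * 1 * expr_tail n (a * s%:C%C)) <=
    (2 ^+ n.+2)^-1 * (4 * T) * expR (4 * T * `|s|).
  rewrite mulr1 normcM.
  apply: (@le_trans _ _ (T * (expR (4 * T * `|s|) / 2 ^+ n))).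
    by apply: ler_pM; rewrite ?normc_ge0.
  rewrite le_eqVlt; apply/orP; left; apply/eqP; rewrite !exprS; field.
  by rewrite expf_neq0// pnatr_eq0.
have h0 : a * (0 : R)%:C%C = 0 by rewrite rmorph0 mulr0.
have M0 : 0 <= (2 ^+ n.+2)^-1 :> R by rewrite invr_ge0 exprn_ge0.
have hr := integrate_exp_bound (fun s => (d s).1) _ M0
  (fun s => le_trans (le_Re_normc _) (bd s)) t.
have hi := integrate_exp_bound (fun s => (d s).2) _ M0
  (fun s => le_trans (le_Im_normc _) (bd s)) t.
apply: (le_trans (le_normc_ReIm _)).
have -> : expR (4 * T * `|t|) / 2 ^+ n.+1 =
    (2 ^+ n.+2)^-1 * expR (4 * T * `|t|) + (2 ^+ n.+2)^-1 * expR (4 * T * `|t|).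
  rewrite !exprS; field; by rewrite expf_neq0// pnatr_eq0.
by apply: lerD; [apply: hr|apply: hi]; rewrite h0 expr_tail_at0.
Qed.

End complex_exponential.

(** * Gaussian bounds on derivatives and the continuity of tempered distributions *)

Section gaussian_bounds.
Context {R : realType}.
Implicit Types (a z : R[i]) (phi psi : R -> R[i]) (t u om M : R).

(* phi is k times differentiable and its k-th derivative is at most M times the
   Gaussian exp(-(t - u)^2). *)
Fixpoint gbound u k M phi : Prop :=
  if k is k'.+1 then exists2 psi, is_cderiv phi psi & gbound u k' M psi
  else forall t, normc (phi t) <= M * expR (- (t - u) ^+ 2).

Lemma gbound_le u k M M' phi : M <= M' -> gbound u k M phi -> gbound u k M' phi.
Proof.
move=> MM'; elim: k phi => [|k IH] phi /=.
  by move=> h t; apply: (le_trans (h t)); rewrite ler_wpM2r// expR_ge0.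
by move=> [psi d h]; exists psi => //; exact: IH.
Qed.

Lemma gboundD u k M M' phi psi : gbound u k M phi -> gbound u k M' psi ->
  gbound u k (M + M') (fun t => phi t + psi t).
Proof.
elim: k phi psi => [|k IH] phi psi /=.
  by move=> h1 h2 t; rewrite mulrDl (le_trans (le_normcD _ _))// lerD.
move=> [phi' d1 h1] [psi' d2 h2]; exists (fun t => phi' t + psi' t).
  exact: is_cderivD.
exact: IH.
Qed.

Lemma gboundZ u k M a phi : gbound u k M phi ->
  gbound u k (normc a * M) (fun t => a * phi t).
Proof.
elim: k phi => [|k IH] phi /=.
  by move=> h t; rewrite normcM -mulrA ler_wpM2l// normc_ge0.
move=> [phi' d h]; exists (fun t => a * phi' t); first exact: is_cderivZ.
exact: IH.
Qed.

Lemma gbound0 u k : gbound u k 0 (fun=> 0).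
Proof.
elim: k => [|k IH]; first by move=> t; rewrite normc0 mul0r.
by exists (fun=> 0) => //; exact: is_cderiv_cst.
Qed.

Lemma cderivE k phi psi : is_cderiv phi psi -> cderiv k.+1 phi = cderiv k psi.
Proof.
move=> d; apply/funext => t; rewrite /cderiv !derive1Sn.
congr (derive1n k _ t +i* derive1n k _ t)%C; apply/funext => s; rewrite derive1E.
  by have [h _] := d s; rewrite derive_val.
by have [_ h] := d s; rewrite derive_val.
Qed.

Lemma gbound_cderiv u k M phi t : gbound u k M phi ->
  normc (cderiv k phi t) <= M * expR (- (t - u) ^+ 2).
Proof.
elim: k phi => [|k IH] phi h.
  have -> : cderiv 0 phi t = phi t by rewrite /cderiv !derive1n0; case: (phi t).
  exact: h.
by case: h => psi d h; rewrite (cderivE k d) IH.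
Qed.

Lemma gbound_smooth u k M phi : gbound u k.+1 M phi -> forall t,
  derivable (derive1n k (fun s => complex.Re (phi s))) t 1 /\
  derivable (derive1n k (fun s => complex.Im (phi s))) t 1.
Proof.
elim: k phi => [|k IH] phi [psi d h] t.
  by have [h1 h2] := d t; rewrite !derive1n0; split; exact: ex_derive.
rewrite !derive1Sn.
have -> : derive1 (fun s => complex.Re (phi s)) = fun s => complex.Re (psi s).
  by apply/funext => s; rewrite derive1E; have [h1 _] := d s; rewrite derive_val.
have -> : derive1 (fun s => complex.Im (phi s)) = fun s => complex.Im (psi s).
  by apply/funext => s; rewrite derive1E; have [_ h1] := d s; rewrite derive_val.
exact: IH.
Qed.

(** With [s = t - u] the weight is at most (1 + |u|)^m (1 + |s|)^m, and the Gaussian absorbs the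
    second factor. The first one is the origin of the polynomial growth of the short-time Fourier
    transform in time. *)
Lemma gbound_seminorm u m k M phi : 0 <= M -> gbound u k M phi ->
  seminorm_le m k phi ((1 + `|u|) ^+ m * expR (m%:R ^+ 2) * M).
Proof.
move=> M0 h t; have := gbound_cderiv t h.
set s := t - u => hb.
have tE : `|t| <= (1 + `|u|) * (1 + `|s|).
  have -> : t = s + u by rewrite subrK.
  rewrite (le_trans (ler_normD _ _))//.
  have := normr_ge0 s; have := normr_ge0 u; nra.
have um0 : 0 <= (1 + `|u|) ^+ m by rewrite exprn_ge0// addr_ge0.
have tm : `|t| ^+ m <= (1 + `|u|) ^+ m * expR (m%:R * `|s|).
  apply: (@le_trans _ _ (((1 + `|u|) * (1 + `|s|)) ^+ m)).
    by apply: lerXn2r; rewrite ?nnegrE// mulr_ge0// addr_ge0.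
  rewrite exprMn ler_wpM2l// expRM_natl; apply: lerXn2r.
  - by rewrite nnegrE addr_ge0.
  - by rewrite nnegrE expR_ge0.
  - exact: expR_ge1Dx.
have gd : expR (m%:R * `|s|) * expR (- s ^+ 2) <= expR (m%:R ^+ 2).
  rewrite -expRD ler_expR -(real_normK (num_real s)).
  have := sqr_ge0 (m%:R - `|s|); have := sqr_ge0 (m%:R : R).
  by have := sqr_ge0 `|s|; nra.
apply: (@le_trans _ _ ((1 + `|u|) ^+ m * expR (m%:R * `|s|) *
    (M * expR (- s ^+ 2)))).
  by apply: ler_pM; rewrite ?normc_ge0// exprn_ge0.
have -> : (1 + `|u|) ^+ m * expR (m%:R * `|s|) * (M * expR (- s ^+ 2)) =
   (1 + `|u|) ^+ m * (expR (m%:R * `|s|) * expR (- s ^+ 2)) * M by ring.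
by rewrite ler_wpM2r// ler_wpM2l.
Qed.

Definition gsmooth phi := exists u, forall k, exists2 M, 0 <= M & gbound u k M phi.

Lemma gsmooth_schwartz phi : gsmooth phi -> schwartz phi.
Proof.
move=> [u h]; split.
- by move=> k t; have [M _ hM] := h k.+1; have [] := gbound_smooth hM t.
- by move=> k t; have [M _ hM] := h k.+1; have [] := gbound_smooth hM t.
move=> m k; have [M M0 hM] := h k; eexists; exact: gbound_seminorm hM.
Qed.

Lemma schwartz0 : schwartz (fun=> 0 : R[i]).
Proof.
apply: gsmooth_schwartz; exists 0 => k; exists 0 => //; exact: gbound0.
Qed.

Section tempered.
Variables (f : (R -> R[i]) -> R[i]) (f_tempered : tempered f).

Lemma temperedD a phi psi : schwartz phi -> schwartz psi ->
  f (fun t => a * phi t + psi t) = a * f phi + f psi.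
Proof. exact: f_tempered.1. Qed.

Lemma tempered0 : f (fun=> 0) = 0.
Proof.
have := temperedD 1 schwartz0 schwartz0.
under [X in f X]eq_fun do rewrite mulr0 addr0.
rewrite mul1r => /(congr1 (fun x => x - f (fun=> 0))).
by rewrite subrr addrK.
Qed.

Lemma temperedZ a phi : schwartz phi -> f (fun t => a * phi t) = a * f phi.
Proof.
move=> h; have := temperedD a h schwartz0.
by under [X in f X]eq_fun do rewrite addr0; rewrite tempered0 addr0.
Qed.

(* Continuity at 0 and homogeneity. *)
Lemma tempered_bound : exists (N : nat) (K : R), 0 < K /\
  forall u M phi, gsmooth phi -> 0 < M ->
    (forall k, (k <= N)%N -> gbound u k M phi) ->
    normc (f phi) <= K * (1 + `|u|) ^+ N * M.
Proof.
have [N [d [d0 hf]]] := f_tempered.2 _ schwartz0 1 ltr01.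
exists N, (expR (N%:R ^+ 2) / d); split; first by rewrite divr_gt0 ?expR_gt0.
move=> u M phi sphi M0 hphi.
have uN : 0 < (1 + `|u|) ^+ N by rewrite exprn_gt0// ltr_pwDl.
set D := (1 + `|u|) ^+ N * expR (N%:R ^+ 2) * M.
have D0 : 0 < D by rewrite !mulr_gt0 ?expR_gt0.
pose a : R[i] := (d / D)%:C%C.
have na : normc a = d / D by rewrite normc_real ger0_norm// divr_ge0 ?ltW.
have [v hv] := sphi.
have sa : schwartz (fun t => a * phi t).
  apply: gsmooth_schwartz; exists v => k; have [M' M'0 h'] := hv k.
  by exists (normc a * M'); [rewrite mulr_ge0 ?normc_ge0|exact: gboundZ].
have := hf _ sa.
rewrite tempered0 subr0 (temperedZ _ (gsmooth_schwartz sphi)) normcM na.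
have -> : expR (N%:R ^+ 2) / d * (1 + `|u|) ^+ N * M = D / d.
  by rewrite /D; field; rewrite gt_eqF.
move=> hlt; rewrite ler_pdivlMr//.
suff : d / D * normc (f phi) < 1.
  by rewrite mulrAC ltr_pdivrMr// mul1r mulrC => /ltW.
apply: hlt => m k mN kN.
under eq_fun do rewrite subr0.
have M'0 : 0 <= normc a * M by rewrite mulr_ge0 ?normc_ge0// ltW.
move=> t; apply: (le_trans (gbound_seminorm m M'0 (gboundZ a (hphi k kN)) t)).
rewrite na.
have dE : (1 + `|u|) ^+ N * expR (N%:R ^+ 2) * (d / D * M) = d.
  rewrite /D; move: (_ ^+ N) uN (expR _) (expR_gt0 (N%:R ^+ 2 : R)).
  by move=> c c0 e e0; field; rewrite !gt_eqF.
rewrite -[leRHS]dE ler_wpM2r//; first by rewrite mulr_ge0// ?divr_ge0 ?ltW.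
apply: ler_pM; rewrite ?exprn_ge0 ?addr_ge0 ?expR_ge0//.
  by apply: ler_weXn2l => //; rewrite lerDl.
by rewrite ler_expR; apply: lerXn2r; rewrite ?nnegrE// ler_nat.
Qed.


End tempered.
End gaussian_bounds.

(** * Taylor expansion under a tempered distribution *)

Section gauss_mono.
Context {R : realType}.
Implicit Types (a z : R[i]) (t u om M T : R).

Definition gauss_exp om t : R[i] :=
  cexp ((- pi)%:C%C * t%:C%C ^+ 2 + (- (2 * pi * om))*i%C * t%:C%C).

(** The index [n] counts the Taylor terms removed from exp(a (t - u)): [n = 0] keeps the whole
    exponential, and [a = 0], [n = 0] leaves the monomial times a modulated Gaussian, whose value
    under [f] is a Taylor coefficient up to a constant. Carrying [j] and [n] together makes
    derivatives combinations of members of the family. *)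
Definition gauss_mono u om a j n t : R[i] :=
  (t - u)%:C%C ^+ j * gauss_exp om (t - u) * expr_tail n (a * (t - u)%:C%C).

Lemma normc_gauss_exp om t : normc (gauss_exp om t) = expR (- pi * t ^+ 2).
Proof. by rewrite normc_cexp /=; congr expR; ring. Qed.

Lemma is_cderiv_gauss_mono u om a j n : is_cderiv (gauss_mono u om a j n)
  (fun t => j%:R * gauss_mono u om a j.-1 n t +
    ((- (2 * pi))%:C%C * gauss_mono u om a j.+1 n t +
     ((- (2 * pi * om))*i%C * gauss_mono u om a j n t +
      a * gauss_mono u om a j n.-1 t))).
Proof.
have ds := @is_cderiv_shift R u.
have dj := is_cderivX j ds.
have dg := is_cderiv_cexp (is_cderivD (is_cderivZ (- pi)%:C%C (is_cderivX 2 ds))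
  (is_cderivZ (- (2 * pi * om))*i%C ds)).
have dt := is_cderiv_expr_tail n (is_cderivZ a ds).
apply: is_cderiv_eq (is_cderivM (is_cderivM dj dg) dt) _.
apply/funext => t; rewrite /gauss_mono /gauss_exp.
have -> : (- (2 * pi))%:C%C = (- pi)%:C%C * 2%:R :> R[i].
  by rewrite -(rmorph_nat (real_complex R)) -rmorphM; congr (_%:C)%C; rewrite mulNr mulrC.
rewrite (exprS _ j) [(2.-1)%N]/= expr1; move: (t - u)%:C%C (- pi)%:C%C => s c.
by move: (s ^+ j) (s ^+ j.-1) (cexp _) => sj sj' g; ring.
Qed.

(** The derivative is a sum of four members of the family: the modulation costs one factor 1 + |om|,
    and lowering [n] doubles 2^-n, which the constant absorbs. The induction on [k] keeps [j] free
    because the derivative also raises [j]. *)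
Lemma gbound_gauss_mono T k j : 0 <= T -> exists2 C : R, 0 <= C &
  forall u om a n, normc a <= T ->
    gbound u k (C * (1 + `|om|) ^+ k / 2 ^+ n) (gauss_mono u om a j n).
Proof.
move=> T0; elim: k j => [|k IH] j.
  exists (expR ((j%:R + 4 * T) ^+ 2)); first exact: expR_ge0.
  move=> u om a n aT t; rewrite expr0 mulr1 /gauss_mono 2!normcM normcX.
  rewrite normc_real normc_gauss_exp; set s := t - u.
  apply: (@le_trans _ _ (expR (j%:R * `|s|) * expR (- pi * s ^+ 2) *
    (expR (4 * T * `|s|) / 2 ^+ n))).
    apply: ler_pM; rewrite ?normc_ge0 ?mulr_ge0 ?exprn_ge0 ?expR_ge0//.
      by rewrite ler_wpM2r ?expR_ge0// exprn_le_expR.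
    exact: normc_expr_tail.
  rewrite mulrA [leRHS]mulrAC; apply: ler_wpM2r.
    by rewrite invr_ge0 exprn_ge0.
  (* A factor exp(- s^2) of exp(- pi s^2) is kept for [gbound]; the rest decays at least as fast as
     exp(- s^2) and absorbs the exponential. *)
  have b1 : 1 <= pi - 1 :> R by have := pi_ge2 R; lra.
  apply: le_trans (gaussian_dominates (j%:R + 4 * T) s b1).
  by rewrite -!expRD ler_expR le_eqVlt; apply/orP; left; apply/eqP; ring.
have [C1 C10 h1] := IH j.-1; have [C2 C20 h2] := IH j.+1; have [C3 C30 h3] := IH j.
have pi0 : 0 <= pi :> R := pi_ge0 R.
exists (j%:R * C1 + (2 * pi * C2 + (2 * pi * C3 + T * (2 * C3)))).
  by rewrite !addr_ge0 ?mulr_ge0.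
move=> u om a n aT; eexists; first exact: is_cderiv_gauss_mono.
have om1 : 1 <= 1 + `|om| by rewrite lerDl.
have o0 : 0 <= (1 + `|om|) ^+ k by rewrite exprn_ge0// (le_trans ler01).
have p20 : 0 <= (2 ^+ n)^-1 :> R by rewrite invr_ge0 exprn_ge0.
have h4 : gbound u k (2 * C3 * (1 + `|om|) ^+ k / 2 ^+ n)
    (gauss_mono u om a j n.-1).
  apply: gbound_le (h3 u om a n.-1 aT); case: n p20 => [|n] p20 /=.
    rewrite expr0 divr1; have := mulr_ge0 C30 o0; nra.
  rewrite exprS le_eqVlt; apply/orP; left; apply/eqP; field.
  by rewrite expf_neq0// pnatr_eq0.
have g1 := gboundZ j%:R (h1 u om a n aT).
have g2 := gboundZ (- (2 * pi))%:C%C (h2 u om a n aT).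
have g3 := gboundZ (- (2 * pi * om))*i%C (h3 u om a n aT).
have g4 := gboundZ a h4.
apply: gbound_le (gboundD g1 (gboundD g2 (gboundD g3 g4))).
rewrite normc_nat normc_real normrN [`|2 * pi|]ger0_norm ?mulr_ge0//.
have -> : normc (- (2 * pi * om))*i%C = 2 * pi * `|om|.
  by rewrite /= expr0n add0r sqrtr_sqr normrN !normrM (ger0_norm pi0) ger0_norm.
have H (c d : R) : 0 <= c -> 0 <= d -> d <= 1 + `|om| ->
    d * (c * (1 + `|om|) ^+ k / 2 ^+ n) <= c * (1 + `|om|) ^+ k.+1 / 2 ^+ n.
  move=> c0 d0 dom; have -> : c * (1 + `|om|) ^+ k.+1 / 2 ^+ n =
    (1 + `|om|) * (c * (1 + `|om|) ^+ k / 2 ^+ n) by rewrite exprS; ring.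
  by rewrite ler_wpM2r// !mulr_ge0.
have e1 := H (j%:R * C1) 1 (mulr_ge0 (ler0n _ _) C10) ler01 om1.
have pc (c : R) : 0 <= c -> 0 <= 2 * pi * c by move=> c0; rewrite !mulr_ge0.
have e2 := H (2 * pi * C2) 1 (pc _ C20) ler01 om1.
have om2 : `|om| <= 1 + `|om| by rewrite lerDr.
have e3 := H (2 * pi * C3) `|om| (pc _ C30) (normr_ge0 _) om2.
have C32 : 0 <= T * (2 * C3) by rewrite !mulr_ge0.
have e4 := H (T * (2 * C3)) 1 C32 ler01 om1.
have e5 : normc a * (2 * C3 * (1 + `|om|) ^+ k / 2 ^+ n) <=
    T * (2 * C3 * (1 + `|om|) ^+ k / 2 ^+ n).
  by rewrite ler_wpM2r// !mulr_ge0.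
move: e1 e2 e3 e4 e5; set A := (1 + `|om|) ^+ k; set A' := _ ^+ k.+1.
move: (2 ^+ n)^-1 => P; lra.
Qed.

Lemma gauss_mono_gsmooth u om a j n : gsmooth (gauss_mono u om a j n).
Proof.
exists u => k; have [C C0 h] := gbound_gauss_mono k j (normc_ge0 a).
exists (C * (1 + `|om|) ^+ k / 2 ^+ n); last exact: h.
by rewrite !mulr_ge0 ?invr_ge0 ?exprn_ge0 ?addr_ge0.
Qed.

Lemma gauss_mono_schwartz u om a j n : schwartz (gauss_mono u om a j n).
Proof. exact/gsmooth_schwartz/gauss_mono_gsmooth. Qed.

Lemma schwartz_sum u om a n (c : nat -> R[i]) :
  gsmooth (fun t => \sum_(i < n) c i * gauss_mono u om a i 0 t).
Proof.
exists u => k.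
elim: n => [|n [M M0 IH]].
  exists 0 => //; rewrite (_ : (fun t => _) = fun=> 0); first exact: gbound0.
  by apply/funext => t; rewrite big_ord0.
have [C C0 h] := gbound_gauss_mono k n (normc_ge0 a).
exists (M + normc (c n) * (C * (1 + `|om|) ^+ k / 2 ^+ 0)).
  by rewrite addr_ge0// ?mulr_ge0 ?normc_ge0 ?invr_ge0 ?exprn_ge0 ?addr_ge0.
rewrite (_ : (fun t => _) = fun t => \sum_(i < n) c i * gauss_mono u om a i 0 t +
    c n * gauss_mono u om a n 0 t); last first.
  by apply/funext => t; rewrite big_ord_recr.
by apply: gboundD => //; apply: gboundZ; exact: h.
Qed.

Section tempered.
Variables (f : (R -> R[i]) -> R[i]) (f_tempered : tempered f).

Lemma tempered_sum u om a n (c : nat -> R[i]) :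
  f (fun t => \sum_(i < n) c i * gauss_mono u om a i 0 t) =
  \sum_(i < n) c i * f (gauss_mono u om a i 0).
Proof.
elim: n => [|n IH].
  rewrite big_ord0 (_ : (fun t => _) = fun=> 0) ?tempered0//.
  by apply/funext => t; rewrite big_ord0.
rewrite big_ord_recr /= -IH addrC.
rewrite -(temperedD f_tempered _ (gauss_mono_schwartz _ _ _ _ _)); last first.
  exact/gsmooth_schwartz/schwartz_sum.
by congr f; apply/funext => t; rewrite big_ord_recr /= addrC.
Qed.

Lemma gauss_monoS u om a j n t : gauss_mono u om a j n.+1 t =
  (- (a ^+ n / n`!%:R)) * gauss_mono u om 0 (j + n) 0 t + gauss_mono u om a j n t.
Proof.
rewrite /gauss_mono expr_tailS expr_tail0 mul0r cexp0 exprMn exprD; ring.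
Qed.

(** Linearity moves [f] through finitely many Taylor terms, so the error of the Taylor polynomial in
    [a] is exactly [f] of a remainder, and no series is interchanged with [f]. *)
Lemma tempered_gauss_mono u om a j n : f (gauss_mono u om a j n) =
  f (gauss_mono u om a j 0) -
  \sum_(k < n) a ^+ k / k`!%:R * f (gauss_mono u om 0 (j + k) 0).
Proof.
elim: n => [|n IH]; first by rewrite big_ord0 subr0.
rewrite big_ord_recr /= opprD addrA -IH.
rewrite (_ : gauss_mono u om a j n.+1 = fun t =>
  (- (a ^+ n / n`!%:R)) * gauss_mono u om 0 (j + n) 0 t + gauss_mono u om a j n t).
  rewrite (temperedD f_tempered _ (gauss_mono_schwartz _ _ _ _ _)
    (gauss_mono_schwartz _ _ _ _ _)).
  by rewrite addrC mulNr.
by apply/funext => t; exact: gauss_monoS.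
Qed.

Lemma tempered_gauss_mono_bound T j : 0 <= T -> exists N (K : R), 0 < K /\
  forall u om a n, normc a <= T ->
  normc (f (gauss_mono u om a j n)) <=
    K * (1 + `|u|) ^+ N * (1 + `|om|) ^+ N / 2 ^+ n.
Proof.
move=> T0; have [N [K [K0 hK]]] := tempered_bound f_tempered.
pose Q (k : nat) (C : R) := 0 <= C /\ forall u om a n, normc a <= T ->
    gbound u k (C * (1 + `|om|) ^+ k / 2 ^+ n) (gauss_mono u om a j n).
have [C hC] : {C : nat -> R & forall k, Q k (C k)}.
  apply: (@choice _ _ Q) => k; have [C C0 h] := gbound_gauss_mono k j T0.
  by exists C.
pose S := 1 + \sum_(k < N.+1) C k.
have S0 : 0 < S.
  by rewrite ltr_pwDl// sumr_ge0// => k _; have [] := hC k.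
exists N, (K * S); split; first exact: mulr_gt0.
move=> u om a n aT.
have om1 : 1 <= 1 + `|om| by rewrite lerDl.
have M0 : 0 < S * (1 + `|om|) ^+ N / 2 ^+ n.
  by rewrite divr_gt0 ?mulr_gt0 ?exprn_gt0// (lt_le_trans ltr01).
have := hK u _ _ (gauss_mono_gsmooth u om a j n) M0.
have -> : K * S * (1 + `|u|) ^+ N * (1 + `|om|) ^+ N / 2 ^+ n =
  K * (1 + `|u|) ^+ N * (S * (1 + `|om|) ^+ N / 2 ^+ n) by ring.
apply => k kN; have [C0 h] := hC k.
have CS : C k <= S.
  have kN' : (k < N.+1)%N by rewrite ltnS.
  rewrite /S (bigD1 (Ordinal kN'))//=.
  have : 0 <= \sum_(i < N.+1 | i != Ordinal kN') C i.
    by rewrite sumr_ge0// => i _; have [] := hC i.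
  lra.
apply: gbound_le (h u om a n aT).
rewrite ler_wpM2r ?invr_ge0 ?exprn_ge0//.
by apply: ler_pM => //; exact: ler_weXn2l.
Qed.

(* The Taylor polynomial at w = u - i om of the Bargmann transform of f. *)
Lemma bargmann_polynomial (T e : R) (N : nat) u om : 0 <= T -> 0 < e ->
  exists P : {poly R[i]}, P.[0] = f (gauss_mono u om 0 0 0) /\
  forall z j, normc z <= T -> (j <= N)%N ->
  normc (f (gauss_mono u om ((2 * pi)%:C%C * z) j 0) -
         P^`(j).[z] / (2 * pi)%:C%C ^+ j) <= e.
Proof.
move=> T0 e0; set c : R[i] := (2 * pi)%:C%C.
have pi0 : 0 < pi :> R := pi_gt0 R.
have c0 : c != 0 by rewrite -normc_gt0 normc_real normr_gt0 gt_eqF// mulr_gt0.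
have cT0 : 0 <= 2 * pi * T by rewrite !mulr_ge0// ltW.
pose Q j (D : R) := forall a n, normc a <= 2 * pi * T ->
  normc (f (gauss_mono u om a j n)) <= D / 2 ^+ n.
have [D hD] : {D : nat -> R & forall j, Q j (D j)}.
  apply: (@choice _ _ Q) => j.
  have [M [K [K0 h]]] := tempered_gauss_mono_bound j cT0.
  by exists (K * (1 + `|u|) ^+ M * (1 + `|om|) ^+ M) => a n; exact: h.
(* [n0] exceeds [D j / e] for every [j <= N], and [n - j >= n0] for these [j]; as 2^(n-j) >= n - j,
   the remainders are at most [e]. *)
pose n0 := (Num.truncn ((\sum_(j < N.+1) `|D j|) / e)).+1.
pose n := (n0 + N).+1.
pose P := \poly_(k < n) (c ^+ k / k`!%:R * f (gauss_mono u om 0 k 0)).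
have dP z j : (j <= N)%N -> P^`(j).[z] / c ^+ j =
    \sum_(k < n - j) (c * z) ^+ k / k`!%:R * f (gauss_mono u om 0 (j + k) 0).
  move=> jN.
  have sP : (size P^`(j) <= n - j)%N.
    have sz := size_poly n (fun k => c ^+ k / k`!%:R * f (gauss_mono u om 0 k 0)).
    apply/leq_sizeP => i ni; rewrite coef_derivn nth_default ?mul0rn//.
    by rewrite (leq_trans sz)// -leq_subLR.
  rewrite (horner_coef_wide z sP) mulr_suml; apply: eq_bigr => k _.
  rewrite coef_derivn coef_poly.
  have -> : (j + k < n)%N by rewrite -ltn_subRL.
  have ff : ((j + k) ^_ j)%:R = (j + k)`!%:R / k`!%:R :> R[i].
    by rewrite -(ffact_fact (leq_addr k j)) addKn natrM mulfK// fact_neq0.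
  rewrite -[_ *+ ((j + k) ^_ j)]mulr_natr ff (exprMn _ c) (exprD c).
  by field; rewrite !fact_neq0 expf_neq0.
exists P; split.
  by rewrite -[P]derivn0 -[_.[0]]divr1 -(expr0 c) dP// subn0 big_ord_recl mulr0 expr0
       fact0 divr1 mul1r addn0 big1 ?addr0// => i _; rewrite exprS !mul0r.
move=> z j zT jN; rewrite dP//.
have ncz : normc (c * z) <= 2 * pi * T.
  rewrite normcM normc_real ger0_norm ?ler_wpM2l//; by rewrite mulr_ge0// ltW.
rewrite -tempered_gauss_mono; apply: (le_trans (hD j _ (n - j)%N ncz)).
rewrite ler_pdivrMr ?exprn_gt0// -ler_pdivrMl// mulrC.
have n0n : (n0 <= n - j)%N by rewrite /n; lia.
apply: (@le_trans _ _ (n0%:R)).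
  apply: (@le_trans _ _ ((\sum_(j < N.+1) `|D j|) / e)).
    rewrite ler_wpM2r ?invr_ge0 ?(ltW e0)// (le_trans (ler_norm _))//.
    have jN' : (j < N.+1)%N by rewrite ltnS.
    by rewrite (bigD1 (Ordinal jN'))//= lerDl sumr_ge0.
  by rewrite ltW// /n0 truncnS_gt.
rewrite (@le_trans _ _ (n - j)%N%:R) ?ler_nat//.
by rewrite -natrX ler_nat ltnW// ltn_expl.
Qed.

End tempered.
End gauss_mono.

(** * Hermite functions as polynomials times a Gaussian *)

Section hermite_functions.
Context {R : realType}.
Implicit Types (q : {poly R[i]}) (t : R).

Lemma derive1n_gaussian n : exists h : {poly R}, forall t,
  derive1n n (fun s : R => expR (- 2 * pi * s ^+ 2)) t = h.[t] * expR (- 2 * pi * t ^+ 2).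
Proof.
elim: n => [|n [h IH]]; first by exists 1 => t; rewrite derive1n0 hornerC mul1r.
exists (h^`() - (4 * pi) *: (h * 'X)) => t; rewrite derive1nS.
rewrite (_ : derive1n n _ = (fun s => h.[s]) * (expR \o (fun s => - 2 * pi * s ^+ 2))); last first.
  by apply/funext => s; rewrite IH.
have d1 : is_derive t 1 (fun s : R => - 2 * pi * s ^+ 2) (- 2 * pi * (2 * t)).
  have := is_deriveZ (- 2 * pi) (is_deriveX 2 (is_derive_id t (1 : R))).
  by rewrite [X in is_derive _ _ _ X](_ : _ = - 2 * pi * (2 * t));
    last by rewrite /GRing.scale/= expr1 mulr1.
have d2 := @is_derive1_comp R expR (fun s => - 2 * pi * s ^+ 2) t _ _
  (is_derive_expR _) d1.
have d3 := is_derive_poly h t.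
have d4 := is_deriveM d3 d2; rewrite derive1E derive_val /GRing.scale/=.
rewrite hornerD hornerN hornerZ hornerMX.
by move: (@pi R) => p; ring.
Qed.

Definition poly_gauss q t : R[i] := q.[t%:C%C] * (expR (- pi * t ^+ 2))%:C%C.

Lemma hermite_poly n : exists h : {poly R}, forall t,
  hermite n t = h.[t] * expR (- pi * t ^+ 2).
Proof.
have [h hE] := derive1n_gaussian n.
exists ((2 `^ (4^-1) / Num.sqrt (n`!%:R) * (- 1 / (2 * Num.sqrt pi)) ^+ n) *: h).
move=> t; rewrite /hermite hE hornerZ -!mulrA; congr (_ * (_ * (_ * _))).
rewrite mulrCA; congr (_ * _); rewrite -expRD; congr expR.
by move: (@pi R) => p; ring.
Qed.

Lemma hermite_span_poly (g : R -> R[i]) : hermite_span g ->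
  exists q, g = poly_gauss q.
Proof.
move=> [N [c ->]].
have [h hE] : {h : nat -> {poly R} & forall n t,
    hermite n t = (h n).[t] * expR (- pi * t ^+ 2)}.
  by apply: (@choice _ _ (fun n (h : {poly R}) => forall t,
    hermite n t = h.[t] * expR (- pi * t ^+ 2))) => n; exact: hermite_poly.
exists (\sum_(n < N) (c n)%:P * map_poly (real_complex R) (h n)).
apply/funext => t; rewrite /poly_gauss horner_sum mulr_suml.
apply: eq_bigr => n _; rewrite hornerM hornerC horner_map hE rmorphM/=.
by rewrite mulrA.
Qed.

Lemma gaussianE t : gaussian t = (2 `^ (4^-1) * expR (- pi * t ^+ 2))%:C%C.
Proof.
rewrite /gaussian /hermite derive1n0 fact0 sqrtr1 divr1 expr0 mulr1.
congr (_%:C)%C; rewrite -mulrA -expRD; congr (_ * expR _).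
by move: (@pi R) => p; ring.
Qed.

End hermite_functions.

(** * The short-time Fourier transform as a polyanalytic function *)

Section stft_expansion.
Context {R : realType}.
Implicit Types (q : {poly R[i]}) (w z : R * R) (t : R).

(* The conjugate of z : the Bargmann transform is holomorphic in x - i xi. *)
Definition bargmann_var z : R[i] := (z.1 -i* z.2)%C.

Definition conj_poly q : {poly R[i]} := map_poly (@conjc R) q.

Definition stft_phase w z : R[i] :=
  cexp ((- pi * z.1 ^+ 2) +i* (- (2 * pi * (w.2 + z.2) * w.1)))%C.

Lemma normc_stft_phase w z : normc (stft_phase w z) = expR (- pi * z.1 ^+ 2).
Proof. by rewrite normc_cexp. Qed.

(** The conjugate of [q] is expanded at [- z.1] in powers of [t - w.1], and expanding the square in
    the Gaussian joins its cross term with the modulation to exp(2 pi zeta (t - w.1)), zeta =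
    [bargmann_var z]. The functions of [t] fed to [f] thus depend on [z] through zeta alone; the
    nonholomorphic dependence is confined to scalar factors. *)
Lemma conj_tf_shift q w z t : (tf_shift (w + z) (poly_gauss q) t)^*%C =
  \sum_(i < size q) (stft_phase w z * (conj_poly q)^`N(i).[- z.1%:C%C]) *
   gauss_mono w.1 w.2 ((2 * pi)%:C%C * bargmann_var z) i 0 t.
Proof.
have -> : tf_shift (w + z) (poly_gauss q) t =
    cexp (2 * pi * (w.2 + z.2) * t)*i%C *
    (q.[(t - w.1 - z.1)%:C%C] * cexp (- pi * (t - w.1 - z.1) ^+ 2)%:C%C).
  rewrite /tf_shift /poly_gauss /cexp /= expR0 cos0 sin0 opprD addrA.
  congr (_ * (_ * _)).
    by apply/eqP; rewrite eq_complex/=; apply/andP; split; apply/eqP; ring.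
  by apply/eqP; rewrite eq_complex/=; apply/andP; split; apply/eqP; ring.
have cM (a b : R[i]) : (a * b)^*%C = a^*%C * b^*%C := rmorphM (@conjc R) a b.
rewrite cM (cM q.[_]) !conj_cexp.
have -> : (q.[(t - w.1 - z.1)%:C%C])^*%C =
    (conj_poly q).[- z.1%:C%C + (t - w.1)%:C%C].
  transitivity (conj_poly q).[((t - w.1 - z.1)%:C^*)%C]; first by rewrite horner_map.
  rewrite conjc_real; congr (_.[_]).
  by rewrite [RHS]addrC (rmorphB (real_complex R) (t - w.1)).
have sq : (size (conj_poly q) <= size q)%N by exact: size_poly.
rewrite (nderiv_taylor_wide _ sq); last exact: mulrC.
rewrite mulrCA mulr_suml; apply: eq_bigr => i _.
rewrite /gauss_mono expr_tail0 /gauss_exp /stft_phase.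
have perm (a b c d e x y : R[i]) : a * b = c * d * e ->
    x * y * (a * b) = c * x * (y * d * e) by move=> ->; ring.
apply: perm.
rewrite -!cexpD; congr cexp; rewrite /bargmann_var.
apply/eqP; rewrite eq_complex/=; apply/andP; split; apply/eqP.
  by move: (@pi R) => p; ring.
by move: (@pi R) => p; ring.
Qed.

Variables (f : (R -> R[i]) -> R[i]) (f_tempered : tempered f).

(** Up to a power of 2 pi, this is the [i]-th derivative at [bargmann_var z] of the Bargmann
    transform of [f] recentred at [w]. *)
Definition bargmann_moment w z i : R[i] :=
  f (gauss_mono w.1 w.2 ((2 * pi)%:C%C * bargmann_var z) i 0).

Lemma stft_expansion q w z : normc (stft (poly_gauss q) f (w + z)) =
  expR (- pi * z.1 ^+ 2) *
  normc (\sum_(i < size q) (conj_poly q)^`N(i).[- z.1%:C%C] * bargmann_moment w z i).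
Proof.
rewrite -(normc_stft_phase w) -normcM mulr_sumr /stft /pairing.
under [X in f X]eq_fun do rewrite conj_tf_shift.
rewrite (tempered_sum f_tempered _ _ _ _
  (fun i => stft_phase w z * (conj_poly q)^`N(i).[- z.1%:C%C])).
by congr normc; apply: eq_bigr => i _; rewrite mulrA.
Qed.

Lemma stft_gaussian w z : normc (stft gaussian f (w + z)) =
  2 `^ (4^-1) * expR (- pi * z.1 ^+ 2) * normc (bargmann_moment w z 0).
Proof.
have -> : gaussian = poly_gauss (2 `^ (4^-1))%:C%C%:P :> (R -> R[i]).
  by apply/funext => t; rewrite gaussianE /poly_gauss hornerC rmorphM.
rewrite stft_expansion.
have c0 : (2 `^ (4^-1))%:C%C != 0 :> R[i].
  by rewrite -normc_gt0 normc_real normr_gt0 gt_eqF// powR_gt0.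
rewrite size_polyC c0 big_ord_recl big_ord0 addr0 nderivn0 /conj_poly map_polyC.
have e : normc ((2 `^ (4^-1))%:C^*)%C = 2 `^ (4^-1) :> R.
  by rewrite normc_conj normc_real ger0_norm ?powR_ge0.
rewrite hornerC normcM e.
by rewrite mulrCA !mulrA.
Qed.

Lemma bargmann_moment0 w i : bargmann_moment w 0 i = f (gauss_mono w.1 w.2 0 i 0).
Proof.
rewrite /bargmann_moment (_ : bargmann_var 0 = 0) ?mulr0//.
by rewrite /bargmann_var/= oppr0.
Qed.

Lemma stft_gaussian_growth : exists N (K : R), 0 < K /\
  forall w, normc (stft gaussian f w) <= K * (1 + `|w.1|) ^+ N * (1 + `|w.2|) ^+ N.
Proof.
have [N [K [K0 h]]] := tempered_gauss_mono_bound f_tempered 0 (lexx (0 : R)).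
have c0 : 0 < 2 `^ (4^-1) :> R by rewrite powR_gt0.
exists N, (2 `^ (4^-1) * K); split; first exact: mulr_gt0.
move=> w; have -> : stft gaussian f w = stft gaussian f (w + 0) by rewrite addr0.
rewrite stft_gaussian bargmann_moment0.
rewrite expr0n/= mulr0 expR0 mulr1 -!mulrA ler_wpM2l ?(ltW c0)//.
have := h w.1 w.2 0 0; rewrite normc0 expr0 divr1 !mulrA; exact.
Qed.

End stft_expansion.

(** * Local estimates *)

Section local_estimates.
Context {R : realType}.
Implicit Types (q P A : {poly R[i]}) (w z : R * R) (ts : seq (R * R)) (r d m S : R).

Local Notation zeta := bargmann_var.
Local Notation V f := (fun w => normc (stft gaussian f w)).

Lemma le_add_eps (x y c : R) : 0 <= c ->
  (forall e, 0 < e -> x <= y + c * e) -> x <= y.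
Proof.
move=> c0 h; apply/ler_addgt0Pr => e e0.
have c1 : 0 < c + 1 by rewrite ltr_wpDl.
apply: (le_trans (h (e / (c + 1)) _)); first exact: divr_gt0.
rewrite lerD2l mulrCA -[leRHS]mulr1 ler_wpM2l ?(ltW e0)//.
by rewrite ler_pdivrMr// mul1r lerDl.
Qed.

Lemma le_fst_normc z : `|z.1| <= normc (zeta z).
Proof. exact: (le_Re_normc (zeta z)). Qed.

Lemma ex_bargmann_var (a : R[i]) : exists z, a = zeta z.
Proof. by case: a => x y; exists (x, - y); rewrite /bargmann_var /= opprK. Qed.

Lemma fst_sqr_bound r z : normc (zeta z) <= r -> z.1 ^+ 2 <= r ^+ 2.
Proof.
move=> zr; rewrite -(real_normK (num_real z.1)).
apply: lerXn2r; rewrite ?nnegrE//; first exact: le_trans (normr_ge0 _) (le_trans (le_fst_normc z) zr).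
exact: le_trans (le_fst_normc z) zr.
Qed.

(** The price of removing the factor exp(- pi x^2) on the disc of radius [r]. *)
Definition growth r : R := expR (pi * r ^+ 2).

Lemma growth_ge1 r : 1 <= growth r.
Proof. by rewrite /growth -expR0 ler_expR mulr_ge0 ?pi_ge0 ?sqr_ge0. Qed.

Lemma growth_bound r z x m : normc (zeta z) <= r -> 0 <= x ->
  expR (- pi * z.1 ^+ 2) * x <= m -> x <= growth r * m.
Proof.
move=> zr x0 h; apply: (@le_trans _ _ (expR (pi * z.1 ^+ 2) *
    (expR (- pi * z.1 ^+ 2) * x))).
  by rewrite mulrA -expRD mulNr subrr expR0 mul1r.
have m0 : 0 <= m by apply: le_trans h; rewrite mulr_ge0 ?expR_ge0.
apply: ler_pM => //; rewrite ?expR_ge0 ?mulr_ge0 ?expR_ge0//.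
by rewrite ler_expR ler_wpM2l ?pi_ge0// fst_sqr_bound.
Qed.

Let g0 : R := 2 `^ (4^-1).

Let g01 : 1 <= g0.
Proof. by rewrite /g0 -[leLHS](powRr0 2); apply: ler_powR; rewrite ?ler1n ?invr_ge0. Qed.

Lemma moment_le f w z r S : tempered f -> normc (zeta z) <= r ->
  V f (w + z) <= S -> normc (bargmann_moment f w z 0) <= growth r * S.
Proof.
move=> ft zr; rewrite /= stft_gaussian// => h.
apply: (growth_bound zr (normc_ge0 _)); apply: le_trans h.
rewrite -mulrA -/g0 ler_peMl// mulr_ge0 ?expR_ge0 ?normc_ge0//.
Qed.

Lemma stft_gaussian_at f w : tempered f ->
  V f w = g0 * normc (f (gauss_mono w.1 w.2 0 0 0)).
Proof.
move=> ft; have := stft_gaussian ft w 0; rewrite [w + 0]addr0 => ->; rewrite bargmann_moment0.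
by rewrite expr0n/= mulr0 expR0 mulr1.
Qed.

(** For the Gaussian window [P] itself is interpolated, so the points may lie anywhere in the disc.
    The radius [18 * r] is twice the [9 * r] of the interpolation, since a supremum controls [wnorm]
    at half its radius. [C] is chosen before [d] and [n], as the absorption requires. *)
Lemma gaussian_local r : 0 < r -> exists2 C : R, 0 <= C &
  forall d n, 0 < d -> exists2 K : R, 0 <= K &
  forall f w m S ts, tempered f -> 0 <= m -> 0 <= S -> size ts = n ->
    separated d (map zeta ts) ->
    (forall t, t \in ts -> normc (zeta t) <= r /\ V f (w + t) <= m) ->
    (forall z, normc (zeta z) <= 18 * r -> V f (w + z) <= S) ->
    V f w <= K * m + C / 2 ^+ n * S.
Proof.
move=> r0; set r' := 18 * r; have r'0 : 0 < r' by rewrite mulr_gt0.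
have G0 : 0 <= growth r' by rewrite (le_trans ler01)// growth_ge1.
have g00 : 0 <= g0 by rewrite (le_trans ler01).
exists (2 * g0 * growth r'); first by rewrite !mulr_ge0.
move=> d n d0; have [K K0 hK] := polynomial_interpolation n r0 d0.
exists (g0 * K * growth r'); first by rewrite !mulr_ge0.
move=> f w m S ts ft m0 S0 sts septs tsm zS.
have p20 : 0 <= (2 ^+ n)^-1 :> R by rewrite invr_ge0 exprn_ge0.
apply: (@le_add_eps _ _ (g0 * (K + 2 / 2 ^+ n))).
  by rewrite mulr_ge0// addr_ge0// mulr_ge0.
move=> e e0; have [P [P0 hP]] :=
  bargmann_polynomial ft 0 w.1 w.2 (ltW r'0) e0.
have hP' z : normc (zeta z) <= r' -> normc P.[zeta z] <= normc (bargmann_moment f w z 0) + e.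
  move=> zr; have := hP (zeta z) 0%N zr (leqnn _).
  rewrite expr0 divr1 derivn0 normcB_sym => h.
  rewrite -(subrK (bargmann_moment f w z 0) P.[zeta z]).
  by rewrite (le_trans (le_normcD _ _))// addrC lerD2l.
have wP : wnorm (9 * r) P <= 2 * (growth r' * S + e).
  apply: wnorm_le_sup => [|a]; first by rewrite mulr_gt0.
  have [z ->] := ex_bargmann_var a.
  have -> : 2 * (9 * r) = r' by rewrite /r'; ring.
  move=> zr; apply: (le_trans (hP' z zr)); rewrite lerD2r.
  exact: moment_le (zS z zr).
have tsP a : a \in map zeta ts -> normc a <= r /\ normc P.[a] <= growth r' * m + e.
  move=> /mapP[z zts ->]; have [zr zm] := tsm z zts; split => //.
  have zr' : normc (zeta z) <= r' by rewrite (le_trans zr)// /r'; lra.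
  by apply: (le_trans (hP' z zr')); rewrite lerD2r; exact: moment_le zm.
have m1 : 0 <= growth r' * m + e by rewrite addr_ge0 ?mulr_ge0// ltW.
have := hK P (map zeta ts) _ (9 * r) 0 m1 (lexx _) _ septs tsP _.
rewrite size_map normc0 => /(_ sts (ltW r0)); rewrite P0 => h.
rewrite stft_gaussian_at//.
apply: (@le_trans _ _ (g0 * (K * (growth r' * m + e) +
   2 * (growth r' * S + e) / 2 ^+ n))).
  by rewrite ler_wpM2l// (le_trans h)// lerD2l ler_wpM2r.
by rewrite le_eqVlt; apply/orP; left; apply/eqP; ring.
Qed.

Lemma mxcoef_bound (F : nat -> R) N : exists2 C, 0 <= C & forall i, (i < N)%N -> `|F i| <= C.
Proof.
exists (\sum_(i < N) `|F i|); first exact: sumr_ge0.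
move=> i iN; rewrite (bigD1 (Ordinal iN))//= lerDl; exact: sumr_ge0.
Qed.

Section polyanalytic.
Variables (q : {poly R[i]}) (N : nat) (sq : size q = N.+1).

Local Notation qc := (conj_poly q).

Let sqc i : (size qc^`N(i) <= N.+1)%N.
Proof.
apply/leq_sizeP => j Nj; rewrite coef_nderivn nth_default ?mul0rn//.
by rewrite (leq_trans (size_poly _ _))// sq (leq_trans Nj)// leq_addl.
Qed.

(* If P approximates the Bargmann transform, then sum_j F_j(zeta) x^j
   approximates exp(pi x^2) V_g f up to a phase. *)
Definition stft_coef P j : {poly R[i]} :=
  \sum_(i < N.+1) ((-1) ^+ j * qc^`N(i)`_j / (2 * pi)%:C%C ^+ i)%:P * P^`(i).

Lemma stft_coefE P (z x : R[i]) :
  \sum_(j < N.+1) (stft_coef P j).[z] * x ^+ j =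
  \sum_(i < N.+1) qc^`N(i).[- x] * (P^`(i).[z] / (2 * pi)%:C%C ^+ i).
Proof.
transitivity (\sum_(j < N.+1) \sum_(i < N.+1)
    qc^`N(i)`_j * (- x) ^+ j * (P^`(i).[z] / (2 * pi)%:C%C ^+ i)).
  apply: eq_bigr => j _; rewrite horner_sum mulr_suml; apply: eq_bigr => i _.
  rewrite hornerM hornerC (exprNn x); move: (_ ^+ i)^-1 => c.
  by move: (_ ^+ j) (x ^+ j) => c1 c2; ring.
rewrite exchange_big; apply: eq_bigr => i _.
by rewrite (horner_coef_wide _ (sqc i)) mulr_suml.
Qed.

(** Derivatives of positive order of a polynomial of degree [N] have no term of degree [N], so only
    the undifferentiated [P] contributes to x^N. This isolates the Bargmann transform. *)
Lemma stft_coef_lead P : stft_coef P N = ((-1) ^+ N * qc`_N)%:P * P.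
Proof.
rewrite /stft_coef big_ord_recl big1 ?addr0.
  by rewrite nderivn0 expr0 divr1 derivn0.
move=> i _; rewrite coef_nderivn nth_default ?mul0rn ?mulr0 ?mul0r//.
by rewrite (leq_trans (size_poly _ _))// sq lift0 addSn ltnS leq_addl.
Qed.

(** The substitution x = X / A, cleared of denominators by the factor A^N. *)
Definition restricted_poly P A X : {poly R[i]} :=
  \sum_(j < N.+1) stft_coef P j * X ^+ j * A ^+ (N - j).

Lemma restricted_polyE P A X (z x : R[i]) : A.[z] * x = X.[z] ->
  (restricted_poly P A X).[z] =
  A.[z] ^+ N * \sum_(j < N.+1) (stft_coef P j).[z] * x ^+ j.
Proof.
move=> AX; rewrite horner_sum mulr_sumr; apply: eq_bigr => j _.
have -> : A.[z] ^+ N = A.[z] ^+ j * A.[z] ^+ (N - j).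
  by rewrite -exprD subnKC// -ltnS.
rewrite !hornerM !horner_exp -AX exprMn.
by move: (A.[z] ^+ j) (x ^+ j) (A.[z] ^+ (N - j)) => a b c; ring.
Qed.

Lemma wnorm_stft_coef r : 0 < r -> exists2 C : R, 0 <= C & forall P j, (j <= N)%N ->
  wnorm r (stft_coef P j) <= C * wnorm (2 ^+ N * r) P.
Proof.
move=> r0.
pose c i j : R := normc ((-1) ^+ j * qc^`N(i)`_j / (2 * pi)%:C%C ^+ i) / r ^+ i.
have c0 i j : 0 <= c i j.
  by rewrite divr_ge0 ?normc_ge0// exprn_ge0// ltW.
exists (\sum_(i < N.+1) \sum_(j < N.+1) c i j).
  by apply: sumr_ge0 => i _; apply: sumr_ge0 => j _.
move=> P j jN; apply: (le_trans (le_wnorm_sum _ _ _ (ltW r0))).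
rewrite mulr_suml; apply: ler_sum => i _; rewrite wnormZ.
have jN' : (j < N.+1)%N by rewrite ltnS.
apply: (@le_trans _ _ (c i j * wnorm (2 ^+ N * r) P)); last first.
  apply: ler_wpM2r.
    by apply: wnorm_ge0; rewrite mulr_ge0 ?exprn_ge0// ltW.
  by rewrite (bigD1 (Ordinal jN'))//= lerDl sumr_ge0.
rewrite /c -[leRHS]mulrA; apply: ler_wpM2l; first exact: normc_ge0.
apply: (le_trans (wnorm_derivn _ _ r0)); rewrite mulrC.
apply: ler_wpM2l; first by rewrite invr_ge0 exprn_ge0// ltW.
apply: le_wnorm; first by rewrite mulr_ge0 ?exprn_ge0// ltW.
apply: ler_wpM2r; first exact: ltW.
by apply: ler_weXn2l; rewrite ?ler1n// -ltnS.
Qed.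

Lemma wnorm_restricted r k : 0 < r -> 0 <= k -> exists2 C : R, 0 <= C & forall P A X,
  wnorm r A <= k -> wnorm r X <= k ->
  wnorm r (restricted_poly P A X) <= C * wnorm (2 ^+ N * r) P.
Proof.
move=> r0 k0; have [C C0 hC] := wnorm_stft_coef r0.
exists (\sum_(j < N.+1) C * k ^+ N).
  by apply: sumr_ge0 => j _; rewrite mulr_ge0// exprn_ge0.
move=> P A X Ak Xk; apply: (le_trans (le_wnorm_sum _ _ _ (ltW r0))).
rewrite mulr_suml; apply: ler_sum => j _.
have jN : (j <= N)%N by rewrite -ltnS.
apply: (le_trans (le_wnormM _ _ (ltW r0))).
have -> : C * k ^+ N * wnorm (2 ^+ N * r) P =
    C * wnorm (2 ^+ N * r) P * k ^+ j * k ^+ (N - j).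
  by rewrite -{1}(subnKC jN) exprD; ring.
have w0 := wnorm_ge0 _ (ltW r0).
have pw B n : wnorm r B <= k -> wnorm r (B ^+ n) <= k ^+ n.
  move=> Bk; apply: (le_trans (le_wnormX _ _ (ltW r0))).
  by apply: lerXn2r; rewrite ?nnegrE.
apply: ler_pM => //; last exact: pw.
apply: (le_trans (le_wnormM _ _ (ltW r0))).
by apply: ler_pM => //; [exact: hC|exact: pw].
Qed.

(** Passes from V_g f at one point to the polynomial model: [growth r] removes the Gaussian factor,
    and [C * e] pays for replacing the moments by derivatives of [P]. *)
Lemma stft_sum_bound r : exists2 C : R, 0 <= C & forall f w z m e P,
  tempered f -> 0 <= e -> normc (zeta z) <= r ->
  (forall j, (j <= N)%N -> normc (bargmann_moment f w z j -
     P^`(j).[zeta z] / (2 * pi)%:C%C ^+ j) <= e) ->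
  normc (stft (poly_gauss q) f (w + z)) <= m ->
  normc (\sum_(i < N.+1) qc^`N(i).[- z.1%:C%C] *
    (P^`(i).[zeta z] / (2 * pi)%:C%C ^+ i)) <= growth r * m + C * e.
Proof.
exists (\sum_(i < N.+1) wnorm `|r| qc^`N(i)).
  by apply: sumr_ge0 => i _; exact: wnorm_ge0.
move=> f w z m e P ft e0 zr hP; rewrite stft_expansion// sq => h.
have {}h := growth_bound zr (normc_ge0 _) h.
set s1 := \sum_(i < _) _ in h; set s2 := \sum_(i < _) _.
have -> : s2 = s1 - (s1 - s2) by rewrite opprB addrC subrK.
apply: (le_trans (le_normcB _ _)); apply: lerD => //.
rewrite -sumrB; apply: (le_trans (le_normc_sum _ _ _)).
rewrite mulr_suml; apply: ler_sum => i _; rewrite -mulrBr normcM.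
apply: ler_pM; rewrite ?normc_ge0//; last by apply: hP; rewrite -ltnS.
apply: le_horner_wnorm; rewrite normcN normc_real.
exact: le_trans (le_fst_normc z) (le_trans zr (ler_norm _)).
Qed.

End polyanalytic.

(** For each arc, [restricted_poly] is small at [n] points, hence at 0. Its values at 0 for the
    different arcs are those of one polynomial of degree at most [N] at the separated points [(X
    i).[0]], and the top coefficient of that polynomial is a constant times [P.[0]]. The radius
    collects [N] doublings for the derivatives and one for the passage from a supremum to
    coefficients. *)
Lemma stft_local q N (r k dl : R) : size q = N.+1 -> 0 < r -> 0 <= k -> 0 < dl ->
  exists2 C : R, 0 <= C & forall d n, 0 < d -> exists2 K : R, 0 <= K &
  forall f w m S A (X : nat -> {poly R[i]}) (ts : nat -> seq (R * R)),
    tempered f -> 0 <= m -> 0 <= S -> wnorm (9 * r) A <= k ->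
    (forall i, (i <= N)%N -> wnorm (9 * r) (X i) <= k) ->
    (forall i j, (i < j <= N)%N -> dl <= normc ((X i).[0] - (X j).[0])) ->
    (forall i, (i <= N)%N -> size (ts i) = n /\ separated d (map zeta (ts i))) ->
    (forall i t, (i <= N)%N -> t \in ts i -> [/\ normc (zeta t) <= r,
       A.[zeta t] * t.1%:C%C = (X i).[zeta t] &
       normc (stft (poly_gauss q) f (w + t)) <= m]) ->
    (forall z, normc (zeta z) <= 2 * (2 ^+ N * (9 * r)) -> V f (w + z) <= S) ->
    V f w <= K * m + C / 2 ^+ n * S.
Proof.
move=> sq r0 k0 dl0; set r9 := 9 * r; have r90 : 0 < r9 by rewrite mulr_gt0.
set rb := 2 * (2 ^+ N * r9).
have rb0 : 0 < rb by rewrite !mulr_gt0// exprn_gt0.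
have r9b : r9 <= rb.
  have : 1 <= 2 ^+ N :> R by rewrite exprn_ege1// ler1n.
  by rewrite /rb; nra.
have [C1 C10 hC1] := wnorm_restricted q N r90 k0.
have [C2 C20 hC2] := stft_sum_bound sq rb.
have G0 : 0 <= growth rb by rewrite (le_trans ler01)// growth_ge1.
have g00 : 0 <= g0 by rewrite (le_trans ler01).
have qN0 : 0 < normc ((conj_poly q)`_N).
  rewrite /conj_poly coef_map normc_conj normc_gt0.
  by have := lead_coef_eq0 q; rewrite lead_coefE sq /= => ->; rewrite -size_poly_eq0 sq.
have [L LE] : exists L, L = g0 / normc ((conj_poly q)`_N) * (2 / dl) ^+ N by eexists.
have L0 : 0 <= L by rewrite LE mulr_ge0 ?divr_ge0 ?exprn_ge0 ?divr_ge0 ?normc_ge0// ltW.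
exists (L * C1 * 2 * growth rb); first by rewrite !mulr_ge0.
move=> d n d0; have [K K0 hK] := polynomial_interpolation n r0 d0.
have kN0 : 0 <= k ^+ N by rewrite exprn_ge0.
exists (L * K * k ^+ N * growth rb); first by rewrite !mulr_ge0.
move=> f w m S A X ts ft m0 S0 Ak Xk Xsep ts1 ts2 zS.
have p20 : 0 <= (2 ^+ n)^-1 :> R by rewrite invr_ge0 exprn_ge0.
apply: (@le_add_eps _ _ (L * (K * (k ^+ N * C2) + C1 * 2 / 2 ^+ n))).
  by rewrite mulr_ge0// addr_ge0 ?mulr_ge0.
move=> e e0; have [P [P0 hP]] := bargmann_polynomial ft N w.1 w.2 (ltW rb0) e0.
have wP : wnorm (2 ^+ N * r9) P <= 2 * (growth rb * S + e).
  apply: wnorm_le_sup => [|a]; first by rewrite mulr_gt0// exprn_gt0.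
  have [z ->] := ex_bargmann_var a; move=> zr.
  have := hP (zeta z) 0%N zr (leq0n _).
  rewrite expr0 divr1 derivn0 normcB_sym => h.
  rewrite -(subrK (bargmann_moment f w z 0) P.[zeta z]).
  rewrite (le_trans (le_normcD _ _))// addrC lerD//.
  exact: moment_le (zS z zr).
pose Psi i := restricted_poly q N P A (X i).
set m1 := k ^+ N * (growth rb * m + C2 * e).
have m10 : 0 <= m1 by rewrite !(mulr_ge0, addr_ge0)// ltW.
have Psi0 i : (i <= N)%N -> normc (Psi i).[0] <=
    K * m1 + C1 * (2 * (growth rb * S + e)) / 2 ^+ n.
  move=> iN; have [sts septs] := ts1 i iN.
  have tsP a : a \in map zeta (ts i) -> normc a <= r /\ normc (Psi i).[a] <= m1.
    move=> /mapP[z zts ->]; have [zr AX Vm] := ts2 i z iN zts; split => //.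
    have zr9 : normc (zeta z) <= r9 by rewrite (le_trans zr)// /r9; lra.
    rewrite /Psi (restricted_polyE q N P AX) normcM.
    apply: ler_pM; rewrite ?normc_ge0//.
      rewrite normcX; apply: lerXn2r; rewrite ?nnegrE ?normc_ge0//.
      exact: le_trans (le_horner_wnorm _ zr9) Ak.
    rewrite (stft_coefE sq).
    apply: (hC2 f w z m e P) => //; [exact: ltW|exact: le_trans r9b|].
    by move=> j jN; apply: hP => //; exact: le_trans r9b.
  have := hK (Psi i) (map zeta (ts i)) _ r9 0 m10 (lexx _) _ septs tsP _.
  rewrite size_map normc0 => /(_ sts (ltW r0)) h; apply: (le_trans h).
  rewrite lerD2l ler_wpM2r//; apply: (le_trans (hC1 P A (X i) Ak (Xk i iN))).
  by rewrite ler_wpM2l.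
set m2 := K * m1 + _ in Psi0.
have m20 : 0 <= m2 by rewrite !(mulr_ge0, addr_ge0)// ltW.
(* The powers of [A.[0]] sit in the lower coefficients and the top one carries none, so the estimate
   stays uniform as [A.[0]] tends to 0. For concentric circles this happens when [w] approaches the
   centre. *)
pose Q : {poly R[i]} := \poly_(j < N.+1) ((stft_coef q N P j).[0] * A.[0] ^+ (N - j)).
have QX i : Q.[(X i).[0]] = (Psi i).[0].
  rewrite horner_poly /Psi /restricted_poly horner_sum; apply: eq_bigr => j _.
  by rewrite !hornerM !horner_exp; ring.
pose ys := [seq (X i).[0] | i <- iota 0 N.+1].
have ysep : separated dl ys.
  rewrite /separated pairwise_map.
  have := iota_ltn_sorted 0 N.+1; rewrite (sorted_pairwise ltn_trans).
  apply: sub_in_pairwise (_ : all (fun i => (i < N.+1)%N) _); last first.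
    by apply/allP => i; rewrite mem_iota.
  by move=> i j _; rewrite -!topredE/= ltnS => jN ij; apply: Xsep; rewrite ij.
have := @coef_le_separated _ dl N Q ys m2 dl0 m20 (size_poly _ _) _ ysep _.
rewrite size_map size_iota => /(_ erefl) h.
have {}h : normc Q`_N <= (2 / dl) ^+ N * m2.
  apply: h => y /mapP[l]; rewrite mem_iota/= add0n ltnS => lN ->.
  by rewrite QX; exact: Psi0.
have QN : normc Q`_N = normc ((conj_poly q)`_N) * normc P.[0].
  rewrite coef_poly ltnSn subnn expr0 mulr1 (stft_coef_lead sq).
  by rewrite hornerM hornerC !normcM normcX normcN normc1 expr1n mul1r.
rewrite stft_gaussian_at// -P0.
have {}h : normc P.[0] <= (2 / dl) ^+ N * m2 / normc ((conj_poly q)`_N).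
  by rewrite ler_pdivlMr// mulrC -QN.
apply: (@le_trans _ _ (L * m2)).
  apply: (le_trans (ler_wpM2l g00 h)).
  by rewrite le_eqVlt; apply/orP; left; apply/eqP; rewrite LE; ring.
by rewrite le_eqVlt; apply/orP; left; apply/eqP; rewrite /m2 /m1; ring.
Qed.

End local_estimates.

(** * One-dimensional Hausdorff measure *)

Section euclidean_distance.
Context {R : realType}.
Implicit Types (z w : R * R) (A B : set (R * R)).

Lemma edistE z w : edist z w = normc ((z.1 - w.1) +i* (z.2 - w.2))%C.
Proof. by []. Qed.

Lemma edist_ge0 z w : 0 <= edist z w.
Proof. exact: sqrtr_ge0. Qed.

Lemma edist_sym z w : edist z w = edist w z.
Proof.
by rewrite /edist; congr Num.sqrt; congr (_ + _); rewrite -sqrrN opprB.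
Qed.

Lemma edist_triangle w z z' : edist z z' <= edist z w + edist w z'.
Proof.
rewrite !edistE; apply: le_trans (le_normcD _ _).
by rewrite le_eqVlt; apply/orP; left; apply/eqP; congr normc;
  apply/eqP; rewrite eq_complex/=; apply/andP; split; apply/eqP; ring.
Qed.

Lemma edist_sqr z w : edist z w ^+ 2 = (z.1 - w.1) ^+ 2 + (z.2 - w.2) ^+ 2.
Proof. by rewrite sqr_sqrtr// addr_ge0 ?sqr_ge0. Qed.

(** Cauchy-Schwarz, by Lagrange's identity. *)
Lemma linear_lipschitz (a b : R) z w : a ^+ 2 + b ^+ 2 = 1 ->
  `|(a * z.1 + b * z.2) - (a * w.1 + b * w.2)| <= edist z w.
Proof.
move=> ab; rewrite -ler_sqr ?nnegrE ?edist_ge0// edist_sqr.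
rewrite real_normK ?num_real//.
have := sqr_ge0 (a * (z.2 - w.2) - b * (z.1 - w.1)).
set x := z.1 - w.1; set y := z.2 - w.2 => h.
have -> : a * z.1 + b * z.2 - (a * w.1 + b * w.2) = a * x + b * y.
  by rewrite /x /y; ring.
have : (a * x + b * y) ^+ 2 + (a * y - b * x) ^+ 2 = (a ^+ 2 + b ^+ 2) * (x ^+ 2 + y ^+ 2).
  by ring.
by rewrite ab mul1r; lra.
Qed.

Local Open Scope ereal_scope.

Lemma le_edist_ediam A z w : A z -> A w -> (edist z w)%:E <= ediam A.
Proof.
move=> Az Aw; rewrite /ediam le_max; apply/orP; right.
by apply: ereal_sup_ubound; exists (z, w).
Qed.

Lemma ediam_le A (c : R) : (0 <= c)%R ->
  (forall z w, A z -> A w -> (edist z w <= c)%R) -> ediam A <= c%:E.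
Proof.
move=> c0 h; rewrite /ediam ge_max lee_fin c0 /=.
apply: ge_ereal_sup => _ [[z w] [/= Az Aw] <-]; rewrite lee_fin; exact: h.
Qed.

Lemma hausdorff1_pre_antitone (d d' : R) A : (d <= d')%R ->
  hausdorff1_pre d' A <= hausdorff1_pre d A.
Proof.
move=> dd'; apply: ereal_inf_le_tmp => x [F [AF Fd] <-]; exists F => //.
by split => // k; rewrite (le_trans (Fd k))// lee_fin.
Qed.

Lemma hausdorff1_pre_le (d : R) A : (0 < d)%R ->
  hausdorff1_pre d A <= hausdorff1 A.
Proof. by move=> d0; apply: ereal_sup_ubound; exists d. Qed.

(** A set of diameter at most [d < c] cannot meet both [A] and [B], so every admissible cover splits
    in two. *)
Lemma hausdorff1_separated_pre A B (c d : R) : (0 < c)%R -> (0 < d)%R -> (d < c)%R ->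
  (forall z w, A z -> B w -> (c <= edist z w)%R) ->
  hausdorff1_pre d A + hausdorff1_pre d B <= hausdorff1_pre d (A `|` B).
Proof.
move=> c0 d0 dc sep; apply: le_ereal_inf_tmp => _ [F [ABF Fd] <-].
pose FA k := if pselect (exists z, F k z /\ A z) then F k else set0.
pose FB k := if pselect (exists z, F k z /\ A z) then set0 else F k.
have -> : \sum_(k <oo) ediam (F k) =
    \sum_(k <oo) ediam (FA k) + \sum_(k <oo) ediam (FB k).
  rewrite -nneseriesD; try by move=> *; exact: ediam_ge0.
  apply: eq_eseriesr => k _; rewrite /FA /FB.
  by case: pselect => ?; rewrite ediam_set0 ?adde0 ?add0e.
apply: leeD; apply: ereal_inf_lbound.
- exists FA => //; split; last first.
    move=> k; rewrite /FA; case: pselect => ?; first exact: Fd.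
    by rewrite ediam_set0 lee_fin ltW.
  move=> z Az; have [k _ Fkz] := ABF z (or_introl Az).
  by exists k => //; rewrite /FA; case: pselect => // -[]; exists z.
- exists FB => //; split; last first.
    move=> k; rewrite /FB; case: pselect => ?; last exact: Fd.
    by rewrite ediam_set0 lee_fin ltW.
  move=> w Bw; have [k _ Fkw] := ABF w (or_intror Bw).
  exists k => //; rewrite /FB; case: pselect => // -[z [Fkz Az]].
  have := le_trans (le_edist_ediam Fkz Fkw) (Fd k).
  by rewrite lee_fin => h; have := sep z w Az Bw; lra.
Qed.

Lemma hausdorff1_separated A B (c : R) : (0 < c)%R ->
  (forall z w, A z -> B w -> (c <= edist z w)%R) ->
  hausdorff1 A + hausdorff1 B <= hausdorff1 (A `|` B).
Proof.
move=> c0 sep; set M := hausdorff1 (A `|` B).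
have [Moo|Mfin] := eqVneq M +oo; first by rewrite Moo leey.
have fM : M \is a fin_num.
  by rewrite ge0_fin_numE ?hausdorff1_ge0// ltey.
have fsub (X : set (R * R)) : X `<=` A `|` B -> hausdorff1 X \is a fin_num.
  move=> XAB; rewrite ge0_fin_numE ?hausdorff1_ge0//.
  by rewrite (le_lt_trans (le_hausdorff1 XAB))// ltey.
have fA := fsub A (@subsetUl _ _ _); have fB := fsub B (@subsetUr _ _ _).
have pre (d d' : R) : (0 < d)%R -> (0 < d')%R ->
    hausdorff1_pre d A + hausdorff1_pre d' B <= M.
  (* The suprema defining the two measures run over independent meshes; one mesh finer than both,
     and below [c], serves them together. *)
  move=> d0 d'0; pose e : R := Num.min (Num.min d d') (c / 2)%R.
  have e0 : (0 < e)%R by rewrite !lt_min d0 d'0 divr_gt0.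
  have [ed [ed' ec]] : (e <= d)%R /\ (e <= d')%R /\ (e < c)%R.
    split; first by rewrite /e !ge_min lexx.
    split; first by rewrite /e !ge_min lexx orbT.
    by rewrite /e gt_min; apply/orP; right; lra.
  apply: le_trans (leeD (hausdorff1_pre_antitone _ ed) (hausdorff1_pre_antitone _ ed')) _.
  apply: (le_trans (hausdorff1_separated_pre c0 e0 ec sep)).
  exact: hausdorff1_pre_le.
have fpre (d : R) (X : set (R * R)) : (0 < d)%R -> hausdorff1 X \is a fin_num -> hausdorff1_pre d X \is a fin_num.
  move=> d0; rewrite ge0_fin_numE ?hausdorff1_ge0// => Xoo.
  rewrite ge0_fin_numE ?hausdorff1_pre_ge0//.
  exact: le_lt_trans (hausdorff1_pre_le _ d0) Xoo.
rewrite -leeBrDr//; apply: ge_ereal_sup => _ [d d0 <-].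
rewrite leeBrDr// addeC -leeBrDr ?fpre//.
apply: ge_ereal_sup => _ [d' d'0 <-].
by rewrite leeBrDr ?fpre// addeC; exact: pre.
Qed.

Section halfplane.
Variables (phi : R * R -> R)
  (phi_lip : forall z w, (`|phi z - phi w| <= edist z w)%R).
Variables (a : R) (X : set (R * R)).

Let lev (n : nat) : R := (a + n.+1%:R^-1)%R.
Let shell n := X `&` [set z | (lev n.+1 <= phi z < lev n)%R].

Let lev_lt m n : (m < n)%N -> (lev n < lev m)%R.
Proof.
move=> mn; rewrite /lev ltrD2l ltf_pV2 ?posrE ?ltr0n// ltr_nat//.
Qed.

Let lev_le m n : (m <= n)%N -> (lev n <= lev m)%R.
Proof. by rewrite leq_eqVlt => /orP[/eqP ->//|/lev_lt/ltW]. Qed.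

Let sep_dist (c c' : R) z w : (c <= phi z)%R -> (phi w <= c')%R -> (c - c' <= edist z w)%R.
Proof. by move=> h h'; have := phi_lip z w; rewrite ler_norml => /andP[_]; lra. Qed.

(** Shells of equal parity are kept apart by the shell between them, so their measures add up. *)
Let shell_sum (b K : nat) : \sum_(k < K.+1) hausdorff1 (shell (k.*2 + b)) <=
  hausdorff1 (\bigcup_(k in `I_K.+1) shell (k.*2 + b)).
Proof.
elim: K => [|K IH].
  rewrite big_ord1; apply: le_hausdorff1 => z h; by exists 0%N.
rewrite big_ord_recr /=.
apply: le_trans (leeD IH (lexx _)) _.
apply: (@le_trans _ _ (hausdorff1 ((\bigcup_(k in `I_K.+1) shell (k.*2 + b)) `|`
  shell (K.+1.*2 + b)))).
  apply: (@hausdorff1_separated _ _ (lev (K.*2 + b).+1 - lev (K.+1.*2 + b))).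
    by rewrite subr_gt0 lev_lt// doubleS; lia.
  move=> z w [k /= kK [_ /andP[h1 _]]] [_ /andP[_ h2]].
  apply: sep_dist (ltW h2); apply: le_trans h1; apply: lev_le; lia.
apply: le_hausdorff1 => z [[k /= kK h]|h].
  by exists k => //=; rewrite (leq_trans kK).
by exists K.+1 => /=.
Qed.

Let shell_series : \sum_(k <oo) hausdorff1 (shell k) <= hausdorff1 X + hausdorff1 X.
Proof.
apply: lime_le.
  by apply: is_cvg_nneseries => n _ _; exact: hausdorff1_ge0.
apply: nearW => n; apply: (@le_trans _ _ (\sum_(0 <= k < n.+1.*2) hausdorff1 (shell k))).
  by apply: lee_sum_nneg_natr => //; [move=> *; exact: hausdorff1_ge0|lia].
have -> : \sum_(0 <= k < n.+1.*2) hausdorff1 (shell k) =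
    \sum_(k < n.+1) hausdorff1 (shell (k.*2 + 0)) +
    \sum_(k < n.+1) hausdorff1 (shell (k.*2 + 1)).
  elim: n.+1 => [|m IH]; first by rewrite !big_ord0 big_geq// adde0.
  rewrite doubleS !big_nat_recr//= IH !big_ord_recr /= addn0 addn1.
  by rewrite -addeA addeACA.
by apply: leeD; apply: le_trans (shell_sum _ _) _; apply: le_hausdorff1 => z [k _ []].
Qed.

(** Caratheodory's criterion for metric outer measures. The part of [X] above level [a] need not be
    at positive distance from the part below, so a neighbourhood of the level is cut into shells.
    Even and odd shells both have a finite sum, hence the shells close to the level contribute
    arbitrarily little, and what remains is separated from the sublevel set. *)
Lemma hausdorff1_halfplane_le : hausdorff1 (X `&` [set z | (phi z <= a)%R]) +
  hausdorff1 (X `&` ~` [set z | (phi z <= a)%R]) <= hausdorff1 X.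
Proof.
have [Xoo|Xfin] := eqVneq (hausdorff1 X) +oo; first by rewrite Xoo leey.
have fX : hausdorff1 X \is a fin_num by rewrite ge0_fin_numE ?hausdorff1_ge0// ltey.
set A := X `&` _; set B := X `&` _.
have tail n : hausdorff1 A + hausdorff1 B <=
    hausdorff1 X + \sum_(n <= k <oo) hausdorff1 (shell k).
  pose E := X `&` [set z | (lev n <= phi z)%R].
  have BE : hausdorff1 B <= hausdorff1 E + \sum_(n <= k <oo) hausdorff1 (shell k).
    apply: (@le_trans _ _ (hausdorff1 (E `|` \bigcup_(k in ~` `I_n) shell k))).
      apply: le_hausdorff1 => z [Xz /negP]; rewrite -ltNge => az.
      have [h|h] := leP (lev n) (phi z); [by left|right].
      have [m hm] : exists m, (lev m <= phi z)%R.
        exists (Num.truncn (phi z - a)^-1); rewrite /lev.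
        have pz : (0 < phi z - a)%R by rewrite subr_gt0.
        have := truncnS_gt (phi z - a)^-1; set m := Num.truncn _ => hm.
        have : (m.+1%:R^-1 < phi z - a)%R.
          by rewrite -[ltRHS]invrK ltf_pV2 ?posrE ?invr_gt0// ltr0n.
        by rewrite ltrBrDl => /ltW.
      pose P k := (lev k <= phi z)%R.
      have exP : exists k, P k by exists m.
      case: (ex_minnP exP) => k Pk mink.
      have nk : (n < k)%N.
        rewrite ltnNge; apply/negP => kn; have := lev_le kn.
        by move: Pk h; rewrite /P; lra.
      exists k.-1 => /=; first by apply/negP; rewrite -leqNgt -ltnS (ltn_predK nk).
      split => //=; rewrite (ltn_predK nk); apply/andP; split; first exact: Pk.
      rewrite ltNge; apply/negP => h'.
      by have := mink _ h'; lia.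
    apply: le_trans (outer_measureU2 hausdorff1 _ _) _; apply: leeD => //.
    exact: (outer_measure_sigma_subadditive_tail hausdorff1).
  have AE : hausdorff1 A + hausdorff1 E <= hausdorff1 X.
    apply: (@le_trans _ _ (hausdorff1 (E `|` A))).
      rewrite addeC; apply: (@hausdorff1_separated _ _ (lev n - a)).
        by rewrite /lev addrC addKr invr_gt0 ltr0n.
      by move=> z w [_ /= h1] [_ /= h2]; exact: sep_dist.
    by apply: le_hausdorff1 => z [[]|[]].
  apply: le_trans (leeD (lexx _) BE) _.
  by rewrite addeA leeD.
have fser : \sum_(k <oo) hausdorff1 (shell k) < +oo.
  apply: le_lt_trans shell_series _.
  by rewrite -ge0_fin_numE ?adde_ge0 ?hausdorff1_ge0// fin_numD fX.
have fS : hausdorff1 A + hausdorff1 B - hausdorff1 X <= 0.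
  have h0 := nneseries_tail_cvg fser (fun k _ => hausdorff1_ge0 (shell k)).
  rewrite -(cvg_lim _ h0)//; apply: lime_ge; first by apply/cvg_ex; exists 0.
  by apply: nearW => n; rewrite leeBlDl.
by move: fS; rewrite leeBlDr// add0e.
Qed.

End halfplane.

Lemma caratheodory_halfplane (phi : R * R -> R) (a : R) :
  (forall z w, (`|phi z - phi w| <= edist z w)%R) ->
  hausdorff1.-caratheodory [set z | (phi z <= a)%R].
Proof.
move=> h; apply: (@le_caratheodory_measurable _ _ hausdorff1) => X.
exact: hausdorff1_halfplane_le.
Qed.

(* The factor 2 absorbs the end piece of the subdivision. *)
Lemma hausdorff1_le (phi : R * R -> R) A (a b L : R) : (a <= b)%R -> (0 <= L)%R ->
  (forall z, A z -> (a <= phi z <= b)%R) ->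
  (forall z w, A z -> A w -> (edist z w <= L * `|phi z - phi w|)%R) ->
  hausdorff1 A <= (2 * L * (b - a))%:E.
Proof.
move=> ab L0 Aab Alip; apply: ge_ereal_sup => _ [d d0 <-].
pose n := (Num.truncn (L * (b - a) / d)).+1.
have n0 : (0 < n%:R :> R)%R by rewrite ltr0n.
pose h := ((b - a) / n%:R)%R.
have h0 : (0 <= h)%R by rewrite divr_ge0 ?subr_ge0// ltW.
have Lhd : (L * h <= d)%R.
  have := truncnS_gt (L * (b - a) / d)%R; rewrite -/n ltr_pdivrMr// => /ltW nd.
  by rewrite /h mulrA ler_pdivrMr// mulrC mulrC [(d * _)%R]mulrC.
pose F (k : nat) : set (R * R) := if (k < n.+1)%N then
  A `&` [set z | (a + k%:R * h <= phi z <= a + k%:R * h + h)%R] else set0.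
have Fd k : ediam (F k) <= (L * h)%:E.
  rewrite /F; case: ifP => _; last by rewrite ediam_set0 lee_fin mulr_ge0.
  apply: ediam_le; first exact: mulr_ge0.
  move=> z w [Az /= /andP[z1 z2]] [Aw /= /andP[w1 w2]].
  apply: (le_trans (Alip z w Az Aw)); rewrite ler_wpM2l// ler_norml; lra.
apply: (@le_trans _ _ (\sum_(k <oo) ediam (F k))).
  apply: ereal_inf_lbound; exists F => //; split; last first.
    by move=> k; rewrite (le_trans (Fd k))// lee_fin.
  move=> z Az; have /andP[az zb] := Aab z Az.
  have [h00|hn0] := eqVneq h 0%R.
    exists 0%N => //; rewrite /F /=; split => //=.
    move: h00; rewrite /h => /eqP; rewrite mulf_eq0 invr_eq0 (gt_eqF n0) orbF.
    by rewrite subr_eq0 => /eqP ba; move: az zb; rewrite ba /h; lra.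
  have hp : (0 < h)%R by rewrite lt_neqAle eq_sym hn0.
  have za0 : (0 <= (phi z - a) / h)%R by rewrite divr_ge0// subr_ge0.
  have /andP[k1 k2] := truncn_itv za0.
  move: k1 k2; set k := Num.truncn _ => k1 k2.
  exists k => //; rewrite /F.
  have -> : (k < n.+1)%N.
    rewrite ltnS -(ler_nat R); apply: (le_trans k1); rewrite ler_pdivrMr//.
    by rewrite /h mulrCA mulfV ?gt_eqF// mulr1 lerD2r.
  split => //=; move: k1 k2; rewrite ler_pdivlMr// ltr_pdivrMr// -natr1 mulrDl mul1r.
  by move=> *; apply/andP; split; lra.
rewrite (nneseries_split 0 n.+1); last by move=> *; exact: ediam_ge0.
rewrite eseries0 ?adde0; last first.
  by move=> k; rewrite add0n => nk _; rewrite /F ltnNge nk /= ediam_set0.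
apply: (@le_trans _ _ (\sum_(0 <= k < 0 + n.+1) (L * h)%:E)).
  by apply: lee_sum => k _; exact: Fd.
rewrite sumEFin lee_fin add0n big_mkord sumr_const card_ord -[leLHS]mulr_natr.
have -> : (2 * L * (b - a) = L * h * (2 * n%:R))%R.
  by rewrite /h; field; rewrite gt_eqF.
apply: ler_wpM2l; first exact: mulr_ge0.
have : (1 <= n%:R :> R)%R by rewrite ler1n.
by rewrite -[n.+1%:R]natr1; lra.
Qed.

(** A 1-Lipschitz map does not increase diameters: each covering set is mapped into an interval
    [I k] as long as its diameter, and these intervals cover [a, b], so the subadditivity of
    Lebesgue measure on the line applies. *)
Lemma hausdorff1_ge (phi : R * R -> R) A (a b : R) : (a <= b)%R ->
  (forall z w, (`|phi z - phi w| <= edist z w)%R) ->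
  (forall s, (a <= s <= b)%R -> exists2 z, A z & phi z = s) ->
  (b - a)%:E <= hausdorff1 A.
Proof.
move=> ab lip surj; apply: le_trans (hausdorff1_pre_le A ltr01).
apply: le_ereal_inf_tmp => _ [F [AF F1] <-].
have fD k : ediam (F k) \is a fin_num.
  by rewrite ge0_fin_numE ?ediam_ge0// (le_lt_trans (F1 k))// ltey.
pose D k : R := fine (ediam (F k)).
have DE k : ediam (F k) = (D k)%:E by rewrite fineK.
pose x k : R := inf (phi @` F k).
pose I k : set R := `[x k, (x k + D k)%R]%classic.
have D0 k : (0 <= D k)%R by rewrite fine_ge0// ediam_ge0.
have FI k z : F k z -> I k (phi z).
  move=> Fz.
  have lbF : lbound (phi @` F k) (phi z - D k)%R.
    move=> _ [w Fw <-]; have := le_edist_ediam Fz Fw; rewrite DE lee_fin.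
    by have := lip z w; rewrite ler_norml => /andP[_]; lra.
  rewrite /I /= in_itv /=; apply/andP; split.
    by apply: ge_inf; [exists (phi z - D k)%R|exists z].
  rewrite -lerBlDr; apply: lb_le_inf => //; by exists (phi z), z.
have lebI k : lebesgue_measure (I k) = ediam (F k).
  rewrite /I lebesgue_measure_itv /= lte_fin DE; case: ltP => h.
    by rewrite -EFinB addrC addKr.
  by congr (_%:E); apply/eqP; rewrite eq_le D0 /=; move: h; rewrite gerDl.
have -> : (b - a)%:E = lebesgue_measure (`[a, b]%classic : set R).
  rewrite lebesgue_measure_itv /= lte_fin; case: ltP => h; first by rewrite -EFinB.
  by congr (_%:E); apply/eqP; rewrite subr_eq0 eq_le h ab.
under eq_eseriesr do rewrite -lebI.
apply: (measure_sigma_subadditive (@lebesgue_measure R)) => //.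
- by move=> k; exact: measurable_itv.
- move=> s; rewrite /= in_itv /= => sab.
  by have [z Az <-] := surj s sab; have [k _ Fz] := AF z Az; exists k => //; exact: FI.
Qed.
End euclidean_distance.

(** * From local to global estimates *)

Section lattice_sums.
Context {R : realType}.
Implicit Types (s : int -> int -> R).

Definition box_sum s (L : nat) : R :=
  \sum_(a < L.*2) \sum_(b < L.*2) s (a%:Z - L%:Z) (b%:Z - L%:Z).

Definition window_sum s (rho : nat) (i j : int) : R :=
  \sum_(a < rho.*2.+1) \sum_(b < rho.*2.+1)
    s (i - rho%:Z + a%:Z) (j - rho%:Z + b%:Z).

Lemma box_sum_ge0 s L : (forall i j, 0 <= s i j) -> 0 <= box_sum s L.
Proof. by move=> s0; apply: sumr_ge0 => a _; apply: sumr_ge0 => b _. Qed.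

Lemma shifted_sum (t : int -> R) (L rho a : nat) : (forall i, 0 <= t i) ->
  (a <= rho.*2)%N ->
  \sum_(i < L.*2) t (i%:Z - L%:Z - rho%:Z + a%:Z) <=
  \sum_(i < (L + rho).*2) t (i%:Z - (L + rho)%:Z).
Proof.
move=> t0 ar.
rewrite -(big_mkord xpredT (fun i : nat => t (i%:Z - L%:Z - rho%:Z + a%:Z))).
rewrite -(big_mkord xpredT (fun i : nat => t (i%:Z - (L + rho)%:Z))).
rewrite (@big_cat_nat _ _ _ a 0 (L + rho).*2)//=; last by lia.
rewrite (@big_cat_nat _ _ _ (L.*2 + a) a (L + rho).*2)/=; [|lia|lia].
have -> : \sum_(a <= i < L.*2 + a) t (i%:Z - (L + rho)%:Z) =
    \sum_(0 <= i < L.*2) t (i%:Z - L%:Z - rho%:Z + a%:Z).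
  rewrite -{1}[a]add0n big_addn addnK; apply: eq_bigr => i _; congr t; lia.
by rewrite addrCA lerDl addr_ge0// sumr_ge0.
Qed.

(** For each of the [rho.*2.+1 ^ 2] offsets inside the window, the shifted box lies in the box
    enlarged by [rho]. *)
Lemma box_window_sum s L rho : (forall i j, 0 <= s i j) ->
  box_sum (window_sum s rho) L <= (rho.*2.+1 ^ 2)%:R * box_sum s (L + rho).
Proof.
move=> s0; rewrite /box_sum /window_sum.
under eq_bigr => i _ do rewrite exchange_big.
rewrite exchange_big /=.
have -> : (rho.*2.+1 ^ 2)%:R * box_sum s (L + rho) =
    \sum_(a < rho.*2.+1) \sum_(b < rho.*2.+1) box_sum s (L + rho).
  rewrite !sumr_const !card_ord -mulrnA mulrC mulr_natr; congr (_ *+ _); lia.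
apply: ler_sum => a _.
under eq_bigr => i _ do rewrite exchange_big.
rewrite exchange_big /=.
apply: ler_sum => b _.
have ar : (a <= rho.*2)%N by rewrite -ltnS.
have br : (b <= rho.*2)%N by rewrite -ltnS.
pose t i := \sum_(j < (L + rho).*2) s i (j%:Z - (L + rho)%:Z).
apply: (@le_trans _ _ (\sum_(i < L.*2) t (i%:Z - L%:Z - rho%:Z + a%:Z))).
  by apply: ler_sum => i _; apply: (@shifted_sum (s _)).
by apply: (@shifted_sum t) => // i; apply: sumr_ge0.
Qed.

(* Polynomial growth is beaten by the factors 1/2 of the iterated inequality. *)
Lemma absorb_half (a : nat -> R) (c C : R) (rho N : nat) : 0 <= C ->
  (forall L, a L <= c + a (L + rho)%N / 2) ->
  (forall L, a L <= C * (2 + L%:R) ^+ N) -> forall L, a L <= 2 * c.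
Proof.
move=> C0 ha hC L.
have iter n : a L <= 2 * c - 2 * c / 2 ^+ n + a (L + n * rho)%N / 2 ^+ n.
  elim: n => [|n IH]; first by rewrite mul0n addn0 expr0 !divr1 subrr add0r.
  apply: (le_trans IH).
  have := ha (L + n * rho)%N.
  rewrite -addnA -mulSnr => h.
  have p2 : 0 < (2 ^+ n)^-1 :> R by rewrite invr_gt0 exprn_gt0.
  have -> : (2 ^+ n.+1)^-1 = (2 ^+ n)^-1 / 2 :> R.
    by rewrite exprS invfM mulrC.
  nra.
(* As [k >= 3 * N], the power ((n+1)/k)^N is at most exp((n+1)/3), and exp(1/3) <= 3/2; polynomial
   growth divided by 2^n is thus at most a constant times (3/4)^n. *)
pose k := (3 * N.+1)%N.
have k0 : 0 < k%:R :> R by rewrite ltr0n.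
pose B : R := 2 + L%:R + rho%:R.
have B0 : 0 <= B by rewrite !addr_ge0.
have bnd n : a (L + n * rho)%N / 2 ^+ n <= C * (B * k%:R) ^+ N * expR (1/3) * (3 / 4) ^+ n.
  rewrite ler_pdivrMr ?exprn_gt0//; apply: (le_trans (hC _)).
  have e3 : expR (1 / 3) <= 3 / 2 :> R.
    have := expR_ge1Dx (- (1 / 3) : R); rewrite expRN => h.
    rewrite -[leLHS]invrK -[leRHS]invrK lef_pV2 ?posrE ?invr_gt0 ?expR_gt0//.
    by apply: le_trans h; lra.
  have h1 : (2 + (L + n * rho)%:R) <= B * n.+1%:R.
    rewrite natrD natrM -natr1 /B.
    have := mulr_ge0 (ler0n R L) (ler0n R n).
    have := ler0n R rho; have := ler0n R n; have := ler0n R L; nra.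
  have h2 : n.+1%:R ^+ N <= k%:R ^+ N * (expR (1 / 3) * expR (1 / 3) ^+ n) :> R.
    have -> : expR (1 / 3) * expR (1 / 3) ^+ n = expR (n.+1%:R / 3) :> R.
      by rewrite -exprS -expRM_natl; congr expR; rewrite mul1r.
    apply: (@le_trans _ _ (k%:R ^+ N * (n.+1%:R / k%:R) ^+ N)).
      by rewrite -exprMn mulrCA mulfV ?gt_eqF// mulr1.
    rewrite ler_wpM2l ?exprn_ge0//.
    apply: (le_trans (exprn_le_expR N _)); first by rewrite divr_ge0.
    rewrite ler_expR mulrCA ler_wpM2l// ler_pdivrMr//.
    by rewrite /k natrM mulKf ?pnatr_eq0// ler_nat.
  have h3 : expR (1 / 3) ^+ n <= (3 / 2) ^+ n :> R.
    by apply: lerXn2r; rewrite ?nnegrE ?expR_ge0// divr_ge0.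
  apply: (@le_trans _ _ (C * (B * n.+1%:R) ^+ N)).
    apply: ler_wpM2l => //; apply: lerXn2r => //; rewrite nnegrE.
      by rewrite addr_ge0.
    exact: mulr_ge0.
  rewrite -!mulrA ler_wpM2l// !(exprMn _ B) -!mulrA ler_wpM2l ?exprn_ge0//.
  apply: (le_trans h2); rewrite ler_wpM2l ?exprn_ge0// ler_wpM2l ?expR_ge0//.
  apply: (le_trans h3); rewrite -exprMn.
  by rewrite (_ : 3 / 4 * 2 = 3 / 2)//; field.
have E0 : 0 <= C * (B * k%:R) ^+ N * expR (1/3).
  by rewrite !mulr_ge0 ?exprn_ge0 ?expR_ge0// mulr_ge0// ltW.
set E := C * _ * _ in bnd E0.
have lim1 : (fun n => 2 * c - 2 * c * (1 / 2) ^+ n + E * (3 / 4) ^+ n) @ \oo -->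
    2 * c - 2 * c * 0 + E * 0.
  apply: cvgD; last by apply: cvgMr; apply: cvg_expr; rewrite ger0_norm; lra.
  apply: cvgB; first exact: cvg_cst.
  by apply: cvgMr; apply: cvg_expr; rewrite ger0_norm; lra.
have -> : 2 * c = 2 * c - 2 * c * 0 + E * 0 by ring.
rewrite -(cvg_lim _ lim1)//; apply: limr_ge; first by apply/cvg_ex; eexists; exact: lim1.
apply: nearW => n; apply: (le_trans (iter n)).
rewrite expr_div_n expr1n mul1r; have := bnd n; lra.
Qed.

End lattice_sums.

(** * Summation of local estimates over unit squares *)

Section local_to_global.
Context {R : realType}.
Implicit Types (z w : R * R) (i j : int) (S : R).

Definition square i j : set (R * R) :=
  [set z | Num.floor z.1 = i /\ Num.floor z.2 = j].

Definition rectangle i n j m : set (R * R) :=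
  [set z | (i <= Num.floor z.1 < i + n%:Z) && (j <= Num.floor z.2 < j + m%:Z)].

Definition window (rho : nat) i j : set (R * R) :=
  rectangle (i - rho%:Z) rho.*2.+1 (j - rho%:Z) rho.*2.+1.

Lemma squareE i j : square i j = rectangle i 1 j 1.
Proof.
apply/seteqP; split => z; first by move=> [<- <-]; rewrite /rectangle/=; lia.
rewrite /rectangle /square /=; lia.
Qed.

Lemma window_self rho w : window rho (Num.floor w.1) (Num.floor w.2) w.
Proof. by rewrite /window /rectangle/=; lia. Qed.

(** Keeps the [sup] of [square_sup] away from its default value on unbounded sets. *)
Definition bounded_on_squares (v : R * R -> R) :=
  forall i j, exists M, forall z, square i j z -> v z <= M.

Definition square_sup (v : R * R -> R) i j : R := sup [set v z | z in square i j].

Lemma square_nonempty i j : square i j (i%:~R, j%:~R).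
Proof. by rewrite /square /= !intrKfloor. Qed.

Lemma le_square_sup v i j z : bounded_on_squares v -> square i j z ->
  v z <= square_sup v i j.
Proof.
move=> bv zij; apply: ub_le_sup; last by exists z.
by have [M hM] := bv i j; exists M => _ [w wij <-]; exact: hM.
Qed.

Lemma square_sup_le v i j S : (forall z, square i j z -> v z <= S) ->
  square_sup v i j <= S.
Proof.
move=> h; apply: ge_sup => [|_ [w wij <-]]; last exact: h.
by exists (v (i%:~R, j%:~R)); exists (i%:~R, j%:~R) => //; exact: square_nonempty.
Qed.

Lemma square_sup_ge0 v i j : bounded_on_squares v -> (forall z, 0 <= v z) ->
  0 <= square_sup v i j.
Proof.
by move=> bv v0; apply: le_trans (le_square_sup bv (square_nonempty i j)).
Qed.

Lemma le_window_sup v rho i j z : bounded_on_squares v -> (forall z, 0 <= v z) ->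
  window rho i j z -> v z <= window_sum (square_sup v) rho i j.
Proof.
move=> bv v0 /=; rewrite /window/rectangle/= => h.
pose a := absz (Num.floor z.1 - (i - rho%:Z))%R.
pose b := absz (Num.floor z.2 - (j - rho%:Z))%R.
have ha : (a < rho.*2.+1)%N by rewrite /a; lia.
have hb : (b < rho.*2.+1)%N by rewrite /b; lia.
have s0 k l : 0 <= square_sup v k l by exact: square_sup_ge0.
rewrite /window_sum (bigD1 (Ordinal ha))//= (bigD1 (Ordinal hb))//= -addrA.
apply: (@le_trans _ _ (square_sup v (i - rho%:Z + a%:Z) (j - rho%:Z + b%:Z))).
  by apply: le_square_sup => //; rewrite /square /= /a /b; lia.
by rewrite lerDl addr_ge0// sumr_ge0// => *; rewrite ?sumr_ge0.
Qed.

Context d (T : measurableType d) (mu : {measure set T -> \bar R}).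
Variables (pr : T -> R * R).
Hypotheses (m1 : measurable_fun setT (fun t => (pr t).1))
  (m2 : measurable_fun setT (fun t => (pr t).2)).
Variables (D : set T) (mD : measurable D) (phi : T -> R).
Hypotheses (mphi : measurable_fun setT phi) (phi0 : forall t, 0 <= phi t).

Local Open Scope ereal_scope.

Let slab (h : T -> R) i (n : nat) : set T :=
  [set t | (i <= Num.floor (h t) < i + n%:Z)%R].

Let measurable_slab h i n : measurable_fun setT h -> measurable (slab h i n).
Proof.
move=> mh; have -> : slab h i n = h @^-1` `[i%:~R, (i + n%:Z)%:~R[.
  apply/seteqP; split => t; rewrite /slab/= in_itv/= floor_ge_int floor_lt_int//.
by rewrite -[X in measurable X]setTI; apply: mh => //; exact: measurable_itv.
Qed.

Let integral_slab h E i n : measurable_fun setT h -> measurable E ->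
  \int[mu]_(t in E `&` slab h i n) (phi t)%:E =
  \sum_(a < n) \int[mu]_(t in E `&` slab h (i + a%:Z) 1) (phi t)%:E.
Proof.
move=> mh mE; elim: n => [|n IH].
  rewrite big_ord0 (_ : _ `&` _ = set0) ?integral_set0//.
  by apply/seteqP; split => t// []; rewrite /slab/= addr0 => _; lia.
rewrite big_ord_recr /= -IH -ge0_integral_setU//.
- congr (integral mu _ _); rewrite -setIUr; congr (_ `&` _).
  by apply/seteqP; split => t; rewrite /slab/=; [|case]; lia.
- by apply: measurableI => //; exact: measurable_slab.
- by apply: measurableI => //; exact: measurable_slab.
- apply/measurable_EFinP; exact: measurable_funTS.
- by move=> t _; rewrite lee_fin.
- rewrite disj_set2E; apply/eqP/seteqP; split => t//= [[_ +] [_ +]].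
  by rewrite /slab/=; lia.
Qed.

(** The abstract space [T] with its map [pr] to the plane serves two measures: Lebesgue measure on
    [R * R], and Hausdorff measure on [hausdorff_plane], which carries another sigma-algebra. *)
Definition mass (E : set (R * R)) := \int[mu]_(t in D `&` pr @^-1` E) (phi t)%:E.

Let rectE i n j m : D `&` pr @^-1` rectangle i n j m =
  (D `&` slab (fun t => (pr t).1) i n) `&` slab (fun t => (pr t).2) j m.
Proof.
rewrite -setIA; congr (_ `&` _); apply/seteqP.
by split => t; rewrite /slab/rectangle/=; [move=> /andP[-> ->]|move=> [-> ->]].
Qed.

Lemma measurable_pre_rectangle i n j m : measurable (D `&` pr @^-1` rectangle i n j m).
Proof.
by rewrite rectE; apply: measurableI; [apply: measurableI|]; rewrite //; exact: measurable_slab.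
Qed.

Lemma mass_rectangle i n j m : mass (rectangle i n j m) =
  \sum_(a < n) \sum_(b < m) mass (square (i + a%:Z) (j + b%:Z)).
Proof.
rewrite /mass rectE setIAC (integral_slab _ _ m1); last first.
  by apply: measurableI => //; exact: measurable_slab.
apply: eq_bigr => a _; rewrite setIAC (integral_slab _ _ m2); last first.
  by apply: measurableI => //; exact: measurable_slab.
by apply: eq_bigr => b _; rewrite squareE rectE.
Qed.

Lemma le_mass (E F : set (R * R)) : measurable (D `&` pr @^-1` E) ->
  measurable (D `&` pr @^-1` F) -> E `<=` F -> mass E <= mass F.
Proof.
move=> mE mF EF; apply: ge0_subset_integral => //.
- apply/measurable_EFinP; exact: measurable_funTS.
- by move=> t _; rewrite lee_fin.
- by move=> t [Dt Et]; split => //; exact: EF.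
Qed.

Lemma mass_setT : mass setT = \int[mu]_(t in D) (phi t)%:E.
Proof. by rewrite /mass preimage_setT setIT. Qed.

Lemma mass_ge0 E : 0 <= mass E.
Proof. by apply: integral_ge0 => t _; rewrite lee_fin. Qed.

Lemma growth_on_square (v : R * R -> R) (K : R) N L i j z :
  (0 <= K)%R -> (forall z, (v z <= K * (1 + `|z.1|) ^+ N * (1 + `|z.2|) ^+ N)%R) ->
  (- L%:Z <= i < L%:Z)%R -> (- L%:Z <= j < L%:Z)%R ->
  square i j z -> (v z <= K * (2 + L%:R) ^+ N * (2 + L%:R) ^+ N)%R.
Proof.
move=> K0 hv iL jL [zi zj].
have coord (x : R) k : Num.floor x = k -> (- L%:Z <= k < L%:Z)%R ->
    ((1 + `|x|) ^+ N <= (2 + L%:R) ^+ N)%R.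
  move=> xk /andP[k1 k2]; apply: lerXn2r; rewrite ?nnegrE ?addr_ge0//.
  have /andP[f1 f2] := floor_itv x; rewrite xk in f1 f2.
  have h1 : (- L%:R <= x)%R.
    apply: le_trans f1; rewrite -(ler_int R) rmorphN/= in k1; exact: k1.
  have h2 : (x < L%:R)%R.
    apply: lt_le_trans f2 _; have : (k + 1 <= L%:Z)%R by lia.
    by rewrite -(ler_int R).
  have : (`|x| <= L%:R)%R by rewrite ler_norml h1 ltW.
  lra.
apply: (le_trans (hv z)); apply: ler_pM; rewrite ?mulr_ge0 ?exprn_ge0 ?addr_ge0//.
  by apply: ler_wpM2l => //; exact: coord zi iL.
exact: coord zj jL.
Qed.

Lemma growth_bounded_on_squares (v : R * R -> R) (K : R) N :
  (0 <= K)%R -> (forall z, (v z <= K * (1 + `|z.1|) ^+ N * (1 + `|z.2|) ^+ N)%R) ->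
  bounded_on_squares v.
Proof.
move=> K0 hv i j.
pose L := (absz i + absz j).+1.
exists (K * (2 + L%:R) ^+ N * (2 + L%:R) ^+ N)%R => z zij.
by apply: growth_on_square zij => //; rewrite /L; lia.
Qed.

(** Summed over a box, the local inequality bounds the box sum at [L] by a multiple of the energy
    plus half the box sum at [L + rho], which is the form [absorb_half] needs. In the local
    hypothesis [m] lies strictly above the mass, so that Markov's inequality can supply actual
    points; the excess [e] is removed by [le_add_eps]. *)
Lemma sampling_lower_bound (v : R * R -> R) (K c th : R) (N rho : nat) :
  (forall z, (0 <= v z)%R) ->
  (0 <= K)%R -> (forall z, (v z <= K * (1 + `|z.1|) ^+ N * (1 + `|z.2|) ^+ N)%R) ->
  (0 < c)%R -> (0 <= th)%R -> (th * (rho.*2.+1 ^ 2)%:R <= 1 / 2)%R ->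
  (forall w S m, (forall z, window rho (Num.floor w.1) (Num.floor w.2) z -> (v z <= S)%R) ->
    mass (window rho (Num.floor w.1) (Num.floor w.2)) < m%:E ->
    (v w <= c * m + th * S)%R) ->
  forall L, (box_sum (square_sup v) L)%:E <=
    (2 * (c * (rho.*2.+1 ^ 2)%:R))%:E * \int[mu]_(t in D) (phi t)%:E.
Proof.
move=> v0 K0 hv c0 th0 thr local L.
have bv := growth_bounded_on_squares K0 hv.
set C := (c * (rho.*2.+1 ^ 2)%:R)%R.
have C0 : (0 < C)%R by rewrite mulr_gt0// ltr0n expn_gt0.
have [Ioo|Ifin] := eqVneq (\int[mu]_(t in D) (phi t)%:E) +oo.
  by rewrite Ioo gt0_muley ?leey// lte_fin mulr_gt0.
have fm E : measurable (D `&` pr @^-1` E) -> mass E \is a fin_num.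
  move=> mE; rewrite ge0_fin_numE ?mass_ge0//.
  apply: (@le_lt_trans _ _ (mass setT)); last by rewrite mass_setT ltey.
  by apply: le_mass => //; rewrite preimage_setT setIT.
have fsq i j : mass (square i j) \is a fin_num.
  by apply: fm; rewrite squareE; exact: measurable_pre_rectangle.
have fI : \int[mu]_(t in D) (phi t)%:E \is a fin_num.
  by rewrite -mass_setT; apply: fm; rewrite preimage_setT setIT.
set J0 := fine (\int[mu]_(t in D) (phi t)%:E).
have J0E : \int[mu]_(t in D) (phi t)%:E = J0%:E by rewrite /J0 fineK.
pose s := square_sup v; pose js i j := fine (mass (square i j)).
have s0 i j : (0 <= s i j)%R by exact: square_sup_ge0.
have js0 i j : (0 <= js i j)%R by rewrite fine_ge0// mass_ge0.
have massE i j : mass (window rho i j) = (window_sum js rho i j)%:E.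
  rewrite /window mass_rectangle /window_sum -sumEFin; apply: eq_bigr => a _.
  by rewrite -sumEFin; apply: eq_bigr => b _; rewrite fineK.
have ptw i j : (s i j <= c * window_sum js rho i j + th * window_sum s rho i j)%R.
  apply: square_sup_le => z [zi zj].
  apply: (@le_add_eps _ _ _ c); first exact: ltW.
  move=> e e0.
  have -> : (c * window_sum js rho i j + th * window_sum s rho i j + c * e =
    c * (window_sum js rho i j + e) + th * window_sum s rho i j)%R by ring.
  apply: local; rewrite zi zj.
    by move=> z' hz'; exact: le_window_sup.
  by rewrite massE lte_fin ltrDl.
have boxjs L' : (box_sum js L' <= J0)%R.
  rewrite -lee_fin -J0E -mass_setT.
  have -> : (box_sum js L')%:E = mass (rectangle (- L'%:Z) L'.*2 (- L'%:Z) L'.*2).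
    rewrite mass_rectangle -sumEFin; apply: eq_bigr => a _.
    rewrite -sumEFin; apply: eq_bigr => b _.
    by rewrite /js fineK// addrC [X in square _ X]addrC.
  apply: le_mass => //; first exact: measurable_pre_rectangle.
  by rewrite preimage_setT setIT.
rewrite J0E -EFinM lee_fin -mulrA.
(* The exponent counts [N] for each coordinate and 2 for the number of squares in the box. *)
apply: (@absorb_half _ (box_sum s) (C * J0) (4 * K) rho (N + N).+2).
- by rewrite mulr_ge0.
- move=> L'; apply: (@le_trans _ _ (c * box_sum (window_sum js rho) L' +
    th * box_sum (window_sum s rho) L')%R).
    rewrite /box_sum !mulr_sumr -big_split; apply: ler_sum => a _.
    rewrite !mulr_sumr -big_split; apply: ler_sum => b _; exact: ptw.
  have h1 := ler_wpM2l (ltW c0) (box_window_sum L' rho js0).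
  have h2 := ler_wpM2l th0 (box_window_sum L' rho s0).
  have h3 := ler_wpM2l (ltW C0) (boxjs (L' + rho)%N).
  have h4 := ler_wpM2r (box_sum_ge0 (L' + rho) s0) thr.
  move: h3 h4; rewrite /C; move: (_ ^ 2)%:R h1 h2 => n h1 h2; lra.
- move=> L'.
  apply: (@le_trans _ _ (\sum_(a < L'.*2) \sum_(b < L'.*2)
    (K * (2 + L'%:R) ^+ N * (2 + L'%:R) ^+ N)))%R.
    apply: ler_sum => a _; apply: ler_sum => b _.
    apply: square_sup_le => z; apply: growth_on_square => //.
      by have := ltn_ord a; lia.
    by have := ltn_ord b; lia.
  rewrite !sumr_const !card_ord -mulrnA -[leLHS]mulr_natr.
  have -> : (4 * K * (2 + L'%:R) ^+ (N + N).+2 =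
    K * (2 + L'%:R) ^+ N * (2 + L'%:R) ^+ N * (4 * (2 + L'%:R) ^+ 2))%R.
    by rewrite !exprS expr0 exprD; ring.
  rewrite ler_wpM2l ?mulr_ge0 ?exprn_ge0 ?addr_ge0//.
  rewrite natrM -muln2 natrM; have := ler0n R L'; nra.
Qed.

(** On one square the integral is at most [H] times the bound coming from the suprema over the
    window; the boxes then exhaust [D] by monotone convergence. *)
Lemma sampling_upper_bound (v : R * R -> R) (K c H B : R) (N rho : nat) :
  (forall z, (0 <= v z)%R) ->
  (0 <= K)%R -> (forall z, (v z <= K * (1 + `|z.1|) ^+ N * (1 + `|z.2|) ^+ N)%R) ->
  (0 <= c)%R -> (0 <= H)%R ->
  (forall i j, mu (D `&` pr @^-1` square i j) <= H%:E) ->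
  (forall t S, D t -> (forall z,
     window rho (Num.floor (pr t).1) (Num.floor (pr t).2) z -> (v z <= S)%R) ->
    (phi t <= c * S)%R) ->
  (forall L, (box_sum (square_sup v) L <= B)%R) ->
  \int[mu]_(t in D) (phi t)%:E <= (H * c * (rho.*2.+1 ^ 2)%:R * B)%:E.
Proof.
move=> v0 K0 hv c0 H0 muH local hB.
have bv := growth_bounded_on_squares K0 hv.
pose s := square_sup v.
have s0 i j : (0 <= s i j)%R by exact: square_sup_ge0.
have msq i j : measurable (D `&` pr @^-1` square i j).
  by rewrite squareE; exact: measurable_pre_rectangle.
have msE i j : mass (square i j) <= (H * c * window_sum s rho i j)%:E.
  have w0 : (0 <= window_sum s rho i j)%R.
    by apply: sumr_ge0 => a _; apply: sumr_ge0.
  apply: (@le_trans _ _ (\int[mu]_(t in D `&` pr @^-1` square i j)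
      (cst (c * window_sum s rho i j)%:E t))).
    apply: ge0_le_integral => //.
    - by move=> t _; rewrite lee_fin.
    - apply/measurable_EFinP; exact: measurable_funTS.
    - move=> t [Dt [ti tj]]; rewrite lee_fin; apply: local => // z.
      by rewrite ti tj => hz; exact: le_window_sup.
  rewrite integral_cst// -mulrA [(H * _)%R]mulrC [leRHS]EFinM.
  by apply: lee_wpmul2l => //; rewrite lee_fin mulr_ge0.
pose F L := D `&` pr @^-1` rectangle (- L%:Z) L.*2 (- L%:Z) L.*2.
have FL L : \int[mu]_(t in F L) (phi t)%:E <= (H * c * (rho.*2.+1 ^ 2)%:R * B)%:E.
  rewrite -/(mass _) mass_rectangle.
  apply: (@le_trans _ _ (H * c * box_sum (window_sum s rho) L)%:E).
    rewrite mulr_sumr -sumEFin; apply: lee_sum => a _.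
    rewrite mulr_sumr -sumEFin; apply: lee_sum => b _.
    by rewrite addrC [X in square _ X]addrC; exact: msE.
  rewrite lee_fin -!mulrA ler_wpM2l// ler_wpM2l//.
  apply: (le_trans (box_window_sum L rho s0)); rewrite ler_wpM2l//; exact: hB.
have -> : D = \bigcup_L F L.
  apply/seteqP; split => [t Dt|t [L _ []]//].
  exists (absz (Num.floor (pr t).1) + absz (Num.floor (pr t).2)).+1 => //.
  by split => //; rewrite /rectangle/=; lia.
have cv : \int[mu]_(t in F L) (phi t)%:E @[L --> \oo] -->
    \int[mu]_(t in \bigcup_L F L) (phi t)%:E.
  apply: ge0_nondecreasing_set_cvg_integral => //.
  - move=> m n mn; rewrite subsetEset => t [Dt]; rewrite /rectangle/= => h.
    by split => //; rewrite /rectangle/=; lia.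
  - by move=> L; exact: measurable_pre_rectangle.
  - move=> L; apply/measurable_EFinP; exact: measurable_funTS.
  - by move=> L t _; rewrite lee_fin.
rewrite -(cvg_lim _ cv)//; apply: lime_le; first by apply/cvg_ex; eexists; exact: cv.
exact: nearW.
Qed.

(** Markov's inequality: were [phi] above [m / m0] throughout [Y], the mass would reach [m]. *)
Lemma select_point (E : set (R * R)) (Y : set T) (m m0 : R) :
  measurable (D `&` pr @^-1` E) -> measurable Y -> Y `<=` D `&` pr @^-1` E ->
  (0 < m0)%R -> m0%:E <= mu Y -> mass E < m%:E ->
  exists2 t, Y t & (phi t <= m / m0)%R.
Proof.
move=> mE mY YE m00 muY; rewrite ltNge => Em; apply: contrapT => h; move/negP: Em; apply.
have hY t : Y t -> (m / m0 <= phi t)%R.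
  by move=> Yt; rewrite leNgt; apply/negP => ht; apply: h; exists t => //; exact: ltW.
have [m_le0|mp] := leP m 0%R.
  by apply: le_trans (mass_ge0 E); rewrite lee_fin.
apply: (@le_trans _ _ (\int[mu]_(t in Y) (cst (m / m0)%:E t))).
  rewrite integral_cst//; apply: (@le_trans _ _ ((m / m0)%:E * m0%:E)).
    by rewrite -EFinM mulfVK// gt_eqF.
  by apply: lee_wpmul2l => //; rewrite lee_fin divr_ge0// ltW.
apply: (@le_trans _ _ (\int[mu]_(t in Y) (phi t)%:E)).
  apply: ge0_le_integral => //.
  - by move=> t _; rewrite lee_fin divr_ge0// ltW.
  - apply/measurable_EFinP; exact: measurable_funTS.
apply: ge0_subset_integral => //.
- apply/measurable_EFinP; exact: measurable_funTS.
- by move=> t _; rewrite lee_fin.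
Qed.

End local_to_global.

Section sampling_of_points.
Context {R : realType}.
Implicit Types (z w : R * R) (S : R).

Lemma powR_add_le (p a b x : R) : 0 <= p -> 0 <= a -> 0 <= b -> 0 <= x ->
  x <= a + b -> x `^ p <= 2 `^ p * (a `^ p + b `^ p).
Proof.
move=> p0 a0 b0 x0 xab; wlog ab : a b a0 b0 xab / a <= b.
  move=> h; have [ab|/ltW ba] := leP a b; first exact: h.
  by rewrite addrC; apply: h => //; rewrite addrC.
apply: (@le_trans _ _ ((2 * b) `^ p)).
  by apply: ge0_ler_powR => //; rewrite ?nnegrE ?mulr_ge0//; lra.
by rewrite powRM// ler_wpM2l ?powR_ge0// lerDr powR_ge0.
Qed.

Lemma powR_growth (p K : R) (N : nat) : 0 <= p -> 0 <= K ->
  exists K' N', 0 <= K' /\ forall (v : R * R -> R), (forall z, 0 <= v z) ->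
  (forall z, v z <= K * (1 + `|z.1|) ^+ N * (1 + `|z.2|) ^+ N) ->
  forall z, v z `^ p <= K' * (1 + `|z.1|) ^+ N' * (1 + `|z.2|) ^+ N'.
Proof.
move=> p0 K0; pose n := (Num.truncn p).+1.
(* With [K + 1] in place of [K] the base is at least 1, so the exponent [p] may be raised to the
   integer [n]. *)
exists ((K + 1) ^+ n), (N * n)%N; split; first by rewrite exprn_ge0// addr_ge0.
move=> v v0 hv z.
have g1 (x : R) k : 1 <= (1 + `|x|) ^+ k by rewrite exprn_ege1// lerDl.
rewrite !exprM -!exprMn; set b := (1 + _) ^+ N; set c := (1 + _) ^+ N.
have bc : 1 <= (K + 1) * b * c.
  have := g1 z.1 N; have := g1 z.2 N; rewrite -/b -/c => c1 b1.
  have : 1 <= b * c by rewrite mulr_ege1.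
  rewrite -mulrA; nra.
apply: (@le_trans _ _ (((K + 1) * b * c) `^ p)).
  apply: ge0_ler_powR => //; rewrite ?nnegrE//; first exact: le_trans bc.
  apply: (le_trans (hv z)); rewrite -/b -/c.
  have b0 : 0 <= b by rewrite exprn_ge0// addr_ge0.
  have c0 : 0 <= c by rewrite exprn_ge0// addr_ge0.
  have := mulr_ge0 b0 c0; nra.
rewrite -powR_mulrn; last exact: le_trans bc.
by apply: ler_powR => //; rewrite ltW// truncnS_gt.
Qed.

Context d (T : measurableType d) (mu : {measure set T -> \bar R}).
Variables (pr : T -> R * R).
Hypotheses (m1 : measurable_fun setT (fun t => (pr t).1))
  (m2 : measurable_fun setT (fun t => (pr t).2)).
Variables (D : set T) (mD : measurable D).

(* In each Y i l there is a point where psi^p is at most its average; summing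
   over the squares, the error term is absorbed. *)
Lemma sampling_of_points (F : Type) (good : set F) (u : F -> R * R -> R)
  (psi : F -> T -> R) (p C : R) (rho N : nat) :
  0 < p -> 0 <= C ->
  (forall f, good f -> measurable_fun setT (psi f) /\ forall t, 0 <= psi f t) ->
  (forall f, good f -> (forall z, 0 <= u f z) /\ exists (M : nat) (K : R), 0 < K /\
    forall z, u f z <= K * (1 + `|z.1|) ^+ M * (1 + `|z.2|) ^+ M) ->
  (forall n : nat, exists K m0 : R, [/\ 0 <= K, 0 < m0 & forall w,
    exists Y : nat -> nat -> set T,
    (forall i l, (i < N)%N -> (l < n)%N -> [/\ measurable (Y i l),
       Y i l `<=` D `&` pr @^-1` window rho (Num.floor w.1) (Num.floor w.2) &
       (m0%:E <= mu (Y i l))%E]) /\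
    forall f (t : nat -> nat -> T) m S, good f -> 0 <= m -> 0 <= S ->
      (forall i l, (i < N)%N -> (l < n)%N -> Y i l (t i l) /\ psi f (t i l) <= m) ->
      (forall z, window rho (Num.floor w.1) (Num.floor w.2) z -> u f z <= S) ->
      u f w <= K * m + C / 2 ^+ n * S]) ->
  exists2 B : R, 0 < B & forall f, good f -> forall L,
    ((box_sum (square_sup (fun z => u f z `^ p)) L)%:E <=
     B%:E * \int[mu]_(t in D) (psi f t `^ p)%:E)%E.
Proof.
move=> p0 C0 hpsi hu hpts.
pose q : R := (rho.*2.+1 ^ 2)%:R.
have q0 : 0 < q by rewrite ltr0n expn_gt0.
(* th = 2^p (C / 2^n)^p, made at most 1 / (2 q) by the choice of n. *)
pose e : R := (2 `^ p * q * 2) `^ (- p^-1).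
have e0 : 0 < e by rewrite powR_gt0// !mulr_gt0// powR_gt0.
pose n := (Num.truncn (C / e)).+1.
have Cn : C / 2 ^+ n <= e.
  rewrite ler_pdivrMr ?exprn_gt0// mulrC -ler_pdivrMr//.
  apply: (@le_trans _ _ n%:R); first by rewrite ltW// truncnS_gt.
  by rewrite -natrX ler_nat ltnW// ltn_expl.
have Cn0 : 0 <= C / 2 ^+ n by rewrite divr_ge0// exprn_ge0.
have [K [m0 [K0 m00 hY]]] := hpts n.
pose c : R := 2 `^ p * (K `^ p / m0) + 1.
have c0 : 0 < c by rewrite ltr_wpDl// !mulr_ge0 ?powR_ge0// invr_ge0 ltW.
pose th : R := 2 `^ p * (C / 2 ^+ n) `^ p.
have th0 : 0 <= th by rewrite mulr_ge0// powR_ge0.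
have thq : th * q <= 1 / 2.
  have : (C / 2 ^+ n) `^ p <= (2 `^ p * q * 2)^-1.
    apply: (@le_trans _ _ (e `^ p)).
      by apply: ge0_ler_powR => //; rewrite ?nnegrE// ltW.
    by rewrite /e -powRrM mulNr mulVf ?gt_eqF// powR_inv1// !mulr_ge0 ?powR_ge0// ltW.
  rewrite /th; have : 0 < 2 `^ p * q by rewrite mulr_gt0 ?powR_gt0.
  move=> h0 h; rewrite mulrAC.
  apply: (le_trans (ler_wpM2l (ltW h0) h)).
  by rewrite invfM mulrA mulfV ?gt_eqF.
exists (2 * (c * q)); first by rewrite !mulr_gt0.
move=> f gf L.
have [mpsi psi0] := hpsi f gf; have [u0 [M [K1 [K10 uM]]]] := hu f gf.
have [K2 [M2 [K20 uM2]]] := powR_growth M (ltW p0) (ltW K10).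
have mphi : measurable_fun setT (fun t => psi f t `^ p).
  exact: (measurableT_comp (measurable_powR p)).
apply: (@sampling_lower_bound _ _ _ mu pr m1 m2 D mD _ mphi _ _ K2 c th M2 rho) => //.
- by move=> t; exact: powR_ge0.
- by move=> z; exact: powR_ge0.
- exact: uM2.
move=> w S m hS hm.
have m_gt0 : 0 < m.
  by rewrite -lte_fin; apply: le_lt_trans hm; apply: mass_ge0 => t; exact: powR_ge0.
have S0 : 0 <= S.
  apply: (@le_trans _ _ (u f w `^ p)); first exact: powR_ge0.
  exact/hS/window_self.
have [Y [hY1 hY2]] := hY w.
have [t ht] : exists t : nat -> nat -> T, forall i l, (i < N)%N -> (l < n)%N ->
    Y i l (t i l) /\ psi f (t i l) `^ p <= m / m0.
  have ht i : {ti : nat -> T & forall l, (i < N)%N -> (l < n)%N ->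
      Y i l (ti l) /\ psi f (ti l) `^ p <= m / m0}.
    apply: (@choice _ _ (fun l tl => (i < N)%N -> (l < n)%N ->
      Y i l tl /\ psi f tl `^ p <= m / m0)) => l.
    have [[iN ln]|h] := pselect ((i < N)%N /\ (l < n)%N).
      have [mY YD muY] := hY1 i l iN ln.
      have [] := select_point mphi (fun t => powR_ge0 (psi f t) p)
        (measurable_pre_rectangle m1 m2 mD _ _ _ _) mY YD m00 muY hm.
      by move=> x Yx hx; exists x.
    by exists point => iN ln; case: h.
  by exists (fun i => projT1 (ht i)) => i l; exact: (projT2 (ht i)).
have inv a b : 0 <= a -> 0 <= b -> a `^ p <= b -> a <= b `^ (p^-1).
  move=> a0 b0 ab; rewrite -[a](powRr1 a0) -(@mulfV _ p) ?gt_eqF// powRrM.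
  by apply: ge0_ler_powR; rewrite ?nnegrE ?invr_ge0 ?powR_ge0// ltW.
have invK b : 0 <= b -> (b `^ (p^-1)) `^ p = b.
  by move=> b0; rewrite -powRrM mulVf ?gt_eqF// powRr1.
have mm0 : 0 <= m / m0 by rewrite divr_ge0// ltW.
have := hY2 f t ((m / m0) `^ (p^-1)) (S `^ (p^-1)) gf (powR_ge0 _ _) (powR_ge0 _ _).
have h1 i l : (i < N)%N -> (l < n)%N -> Y i l (t i l) /\ psi f (t i l) <= (m / m0) `^ p^-1.
  by move=> iN ln; have [Yt ?] := ht i l iN ln; split => //; exact: inv.
have h2 z : window rho (Num.floor w.1) (Num.floor w.2) z -> u f z <= S `^ p^-1.
  by move=> zw; apply: inv => //; exact: hS.
move=> /(_ h1 h2) h.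
have := powR_add_le (ltW p0) (mulr_ge0 K0 (powR_ge0 _ _))
  (mulr_ge0 Cn0 (powR_ge0 _ _)) (u0 w) h.
rewrite (powRM _ K0 (powR_ge0 _ _)) (powRM _ Cn0 (powR_ge0 _ _)) !invK//; move=> /le_trans; apply.
rewrite /c /th mulrDr lerD//; last by rewrite mulrA.
rewrite [in leRHS]mulrDl mul1r -!mulrA [m0^-1 * m]mulrC lerDl; exact: ltW.
Qed.

End sampling_of_points.

(** * Measurability of the short-time Fourier transform *)

Section stft_measurable.
Context {R : realType}.
Implicit Types (q P : {poly R[i]}) (z w : R * R).

Local Notation zeta := bargmann_var.

Definition cmeasurable (F : R * R -> R[i]) :=
  measurable_fun setT (fun z => complex.Re (F z)) /\
  measurable_fun setT (fun z => complex.Im (F z)).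

Lemma cmeasurable_cst (a : R[i]) : cmeasurable (fun=> a).
Proof. by split; exact: measurable_cst. Qed.

Lemma cmeasurableD F G : cmeasurable F -> cmeasurable G ->
  cmeasurable (fun z => F z + G z).
Proof.
move=> [F1 F2] [G1 G2]; split.
- rewrite (_ : (fun z => _) = (fun z => complex.Re (F z) + complex.Re (G z))).
    exact: measurable_funD.
  by apply/funext => z; case: (F z) (G z) => [? ?] [].
- rewrite (_ : (fun z => _) = (fun z => complex.Im (F z) + complex.Im (G z))).
    exact: measurable_funD.
  by apply/funext => z; case: (F z) (G z) => [? ?] [].
Qed.

Lemma cmeasurableM F G : cmeasurable F -> cmeasurable G ->
  cmeasurable (fun z => F z * G z).
Proof.
move=> [F1 F2] [G1 G2]; split.
- rewrite (_ : (fun z => _) = (fun z => complex.Re (F z) * complex.Re (G z) -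
    complex.Im (F z) * complex.Im (G z))).
    by apply: measurable_funB; exact: measurable_funM.
  by apply/funext => z; case: (F z) (G z) => [? ?] [].
- rewrite (_ : (fun z => _) = (fun z => complex.Re (F z) * complex.Im (G z) +
    complex.Im (F z) * complex.Re (G z))).
    by apply: measurable_funD; exact: measurable_funM.
  by apply/funext => z; case: (F z) (G z) => [? ?] [].
Qed.

Lemma cmeasurable_sum n (F : nat -> R * R -> R[i]) :
  (forall i, cmeasurable (F i)) -> cmeasurable (fun z => \sum_(i < n) F i z).
Proof.
move=> mF; elim: n => [|n IH].
  rewrite (_ : (fun z => _) = fun=> 0); first exact: cmeasurable_cst.
  by apply/funext => z; rewrite big_ord0.
rewrite (_ : (fun z => _) = fun z => \sum_(i < n) F i z + F n z).
  exact: cmeasurableD.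
by apply/funext => z; rewrite big_ord_recr.
Qed.

Lemma cmeasurable_horner P F : cmeasurable F -> cmeasurable (fun z => P.[F z]).
Proof.
move=> mF; elim/poly_ind: P => [|P c IH].
  rewrite (_ : (fun z => _) = fun=> 0); first exact: cmeasurable_cst.
  by apply/funext => z; rewrite horner0.
rewrite (_ : (fun z => _) = fun z => P.[F z] * F z + c).
  by apply: cmeasurableD; [exact: cmeasurableM|exact: cmeasurable_cst].
by apply/funext => z; rewrite hornerMXaddC.
Qed.

Lemma measurable_normc F : cmeasurable F -> measurable_fun setT (fun z => normc (F z)).
Proof.
move=> [F1 F2].
rewrite (_ : (fun z => _) = (fun z => (complex.Re (F z) ^+ 2 + complex.Im (F z) ^+ 2) `^ 2^-1)).
  apply: (measurableT_comp (measurable_powR _)).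
  by apply: measurable_funD; exact: measurable_funX.
apply/funext => z; rewrite powR12_sqrt ?addr_ge0 ?sqr_ge0//.
by case: (F z).
Qed.

Lemma cmeasurable_bargmann_var : cmeasurable zeta.
Proof.
split; first exact: measurable_fst.
apply: measurableT_comp; [exact: oppr_measurable|exact: measurable_snd].
Qed.

Lemma cmeasurable_fst : cmeasurable (fun z => - z.1%:C%C).
Proof.
split => /=; last by rewrite oppr0; exact: measurable_cst.
apply: measurableT_comp; [exact: oppr_measurable|exact: measurable_fst].
Qed.

Variables (f : (R -> R[i]) -> R[i]) (f_tempered : tempered f) (q : {poly R[i]}).

(* A pointwise limit of the functions obtained from the Taylor polynomials of
   the Bargmann transform at the origin. *)
Lemma measurable_stft : measurable_fun setT (fun z => normc (stft (poly_gauss q) f z)).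
Proof.
have [P hP] : {P : nat -> {poly R[i]} & forall n, forall a j, normc a <= n%:R -> (j <= size q)%N ->
   normc (f (gauss_mono 0 0 ((2 * pi)%:C%C * a) j 0) -
         (P n)^`(j).[a] / (2 * pi)%:C%C ^+ j) <= n.+1%:R^-1}.
  apply: (@choice _ _ (fun n P => forall a j, normc a <= n%:R -> (j <= size q)%N ->
   normc (f (gauss_mono 0 0 ((2 * pi)%:C%C * a) j 0) -
         P^`(j).[a] / (2 * pi)%:C%C ^+ j) <= n.+1%:R^-1)) => n.
  have [||P [_ hP]] := bargmann_polynomial f_tempered (T := n%:R) (e := n.+1%:R^-1) (size q) 0 0 => //.
  by exists P.
pose s n z := \sum_(i < size q) (conj_poly q)^`N(i).[- z.1%:C%C] *
  ((P n)^`(i).[zeta z] / (2 * pi)%:C%C ^+ i).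
pose s' z := \sum_(i < size q) (conj_poly q)^`N(i).[- z.1%:C%C] * bargmann_moment f 0 z i.
have sE z : normc (stft (poly_gauss q) f z) = expR (- pi * z.1 ^+ 2) * normc (s' z).
  by rewrite -[in LHS](add0r z) stft_expansion.
rewrite (_ : (fun z => _) = fun z => expR (- pi * z.1 ^+ 2) * normc (s' z)); last first.
  by apply/funext => z.
apply: measurable_funM.
  apply: (measurableT_comp (@measurable_expR R)).
  apply: measurable_funM; first exact: measurable_cst.
  by apply: measurable_funX; exact: measurable_fst.
apply: (@measurable_fun_cvg _ _ _ setT (fun n z => normc (s n z))).
  move=> n; apply: measurable_normc; apply: (@cmeasurable_sum _ (fun i z =>
    (conj_poly q)^`N(i).[- z.1%:C%C] * ((P n)^`(i).[zeta z] / (2 * pi)%:C%C ^+ i))).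
  move=> i; apply: cmeasurableM.
    by apply: cmeasurable_horner; exact: cmeasurable_fst.
  apply: cmeasurableM; last exact: cmeasurable_cst.
  by apply: cmeasurable_horner; exact: cmeasurable_bargmann_var.
move=> z _.
pose C := \sum_(i < size q) normc (conj_poly q)^`N(i).[- z.1%:C%C].
have C0 : 0 <= C by apply: sumr_ge0 => i _; exact: normc_ge0.
have key n : normc (zeta z) <= n%:R -> `|normc (s n z) - normc (s' z)| <= C * n.+1%:R^-1.
  move=> zn; apply: (@le_trans _ _ (normc (s' z - s n z))).
    rewrite ler_norml; apply/andP; split.
      rewrite lerNl opprB lerBlDr; apply: le_trans (le_normcD _ _).
      by rewrite subrK.
    rewrite lerBlDr normcB_sym; apply: le_trans (le_normcD _ _).
    by rewrite subrK.
  rewrite -sumrB mulr_suml; apply: (le_trans (le_normc_sum _ _ _)).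
  apply: ler_sum => i _; rewrite -mulrBr normcM ler_wpM2l ?normc_ge0//.
  by apply: hP => //; exact: ltnW.
apply/cvgrPdist_le => e e0; near=> n.
have zn : normc (zeta z) <= n%:R by near: n; exact: nbhs_infty_ger.
have Cn : C / e <= n%:R by near: n; exact: nbhs_infty_ger.
rewrite distrC; apply: (le_trans (key n zn)).
rewrite ler_pdivrMr ?ltr0n// mulrC -ler_pdivrMr//.
by rewrite (le_trans Cn)// ler_nat.
Unshelve. all: by end_near. Qed.

End stft_measurable.

Section stft_upper.
Context {R : realType}.
Implicit Types (q P : {poly R[i]}) (z w : R * R).

Lemma poly_gauss_neq0 q : poly_gauss q <> (fun=> 0) :> (R -> R[i]) -> q != 0.
Proof.
move=> h; apply/eqP => q0; apply: h; apply/funext => t.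
by rewrite /poly_gauss q0 horner0 mul0r.
Qed.

(** At [w] itself the expansion involves the derivatives of the Bargmann transform up to order [N],
    which Cauchy's estimate bounds. The radius is made of [N] doublings for the derivatives and one
    for the passage to coefficients. *)
Lemma stft_le_local_sup q N : size q = N.+1 -> exists2 C : R, 0 <= C &
  forall f w S, tempered f -> 0 <= S ->
    (forall z, normc (bargmann_var z) <= 2 * 2 ^+ N -> normc (stft gaussian f (w + z)) <= S) ->
    normc (stft (poly_gauss q) f w) <= C * S.
Proof.
move=> sq; set rb : R := 2 * 2 ^+ N.
have rb0 : 0 < rb by rewrite mulr_gt0// exprn_gt0.
have G0 : 0 <= growth rb by rewrite (le_trans ler01)// growth_ge1.
pose c i : R := normc ((conj_poly q)^`N(i).[0]).
have pi0 : 0 < pi :> R := pi_gt0 R.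
have cpi i : normc ((2 * pi)%:C%C ^+ i)^-1 <= 1 :> R.
  rewrite normcV normcX normc_real ger0_norm ?mulr_ge0// ?(ltW pi0)//.
  have := pi_ge2 R => pi2.
  by rewrite invf_le1 ?exprn_gt0 ?mulr_gt0// exprn_ege1//; lra.
have c0 i : 0 <= c i by exact: normc_ge0.
exists (\sum_(i < N.+1) c i * (2 * growth rb)).
  by apply: sumr_ge0 => i _; rewrite !mulr_ge0.
move=> f w S ft S0 hS.
apply: (@le_add_eps _ _ _ (\sum_(i < N.+1) c i * 3)).
  by apply: sumr_ge0 => i _; rewrite mulr_ge0.
move=> e e0; have [P [_ hP]] := bargmann_polynomial ft N w.1 w.2 (ltW rb0) e0.
have wP : wnorm (2 ^+ N * 1) P <= 2 * (growth rb * S + e).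
  apply: wnorm_le_sup => [|a]; first by rewrite mulr1 exprn_gt0.
  have [z ->] := ex_bargmann_var a; rewrite mulr1 => zr.
  have := hP (bargmann_var z) 0%N zr (leq0n _).
  rewrite expr0 divr1 derivn0 normcB_sym => h.
  rewrite -(subrK (bargmann_moment f w z 0) P.[bargmann_var z]).
  rewrite (le_trans (le_normcD _ _))// addrC lerD//.
  exact: moment_le (hS z zr).
rewrite -[w in normc (stft _ _ w)]addr0 stft_expansion// sq.
rewrite expr0n/= mulr0 expR0 mul1r.
apply: (le_trans (le_normc_sum _ _ _)).
rewrite !mulr_suml -big_split; apply: ler_sum => i _ /=.
have iN : (i <= N)%N by rewrite -ltnS.
rewrite normcM oppr0 -/(c i) -mulrA -[c i * 3 * e]mulrA -mulrDr ler_wpM2l//.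
have z0 : normc (0 : R[i]) <= rb by rewrite normc0 ltW.
have := hP 0 i z0 iN; rewrite mulr0 -bargmann_moment0 => h.
rewrite -(subrK (P^`(i).[0] / (2 * pi)%:C%C ^+ i) (bargmann_moment f w 0 i)).
apply: (le_trans (le_normcD _ _)).
have : normc (P^`(i).[0] / (2 * pi)%:C%C ^+ i) <= 2 * (growth rb * S + e).
  rewrite normcM -[leRHS]mulr1; apply: ler_pM; rewrite ?normc_ge0//.
  apply: (@le_trans _ _ (wnorm 1 P^`(i))); first by apply: le_horner_wnorm; rewrite normc0.
  apply: (le_trans (wnorm_derivn _ _ ltr01)); rewrite expr1n divr1.
  apply: le_trans wP; apply: le_wnorm; first by rewrite mulr1 exprn_ge0.
  by rewrite !mulr1; apply: ler_weXn2l; rewrite // ler1n.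
lra.
Qed.

End stft_upper.

(** * The modulation norm as a sum over unit squares *)

Section modulation_norm_discretization.
Context {R : realType}.
Implicit Types (z w : R * R) (S : R).

Local Notation zeta := bargmann_var.
Local Notation V := (fun f w => normc (stft gaussian f w)).

Lemma separated_iota (dl : R) (n : nat) (g : nat -> R[i]) :
  (forall l l', (l < l' < n)%N -> dl <= normc (g l - g l')) ->
  separated dl [seq g l | l <- iota 0 n].
Proof.
move=> h; rewrite /separated pairwise_map.
have := iota_ltn_sorted 0 n; rewrite (sorted_pairwise ltn_trans).
apply: sub_in_pairwise (_ : all (fun i => (i < n)%N) _); last first.
  by apply/allP => i; rewrite mem_iota.
by move=> i j _; rewrite -!topredE/= => jn ij; apply: h; rewrite ij.
Qed.

Lemma bargmann_varB z w : zeta (z - w) = zeta z - zeta w.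
Proof.
by rewrite /bargmann_var; apply/eqP; rewrite eq_complex/=; apply/andP; split; apply/eqP; ring.
Qed.

Lemma normc_bargmann_varB z w : normc (zeta (z - w)) = edist z w.
Proof. by rewrite /edist /= sqrrN. Qed.

Lemma edist_le z w : edist z w <= `|z.1 - w.1| + `|z.2 - w.2|.
Proof. exact: (le_normc_ReIm ((z.1 - w.1) +i* (z.2 - w.2))%C). Qed.

Lemma le_fst_edist z w : `|z.1 - w.1| <= edist z w.
Proof. exact: (le_Re_normc ((z.1 - w.1) +i* (z.2 - w.2))%C). Qed.

Lemma le_snd_edist z w : `|z.2 - w.2| <= edist z w.
Proof. exact: (le_Im_normc ((z.1 - w.1) +i* (z.2 - w.2))%C). Qed.

Lemma floor_near (x y : R) (n : nat) : `|x - y| <= n%:R ->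
  (Num.floor y - n.+1%:Z <= Num.floor x <= Num.floor y + n.+1%:Z).
Proof.
rewrite ler_norml => /andP[h1 h2].
have /andP[x1 x2] := floor_itv x; have /andP[y1 y2] := floor_itv y.
apply/andP; split; rewrite -ltzD1 -(ltr_int R).
  rewrite !rmorphD rmorphN /= in x2 y2 *; rewrite -[n.+1%:~R]natr1; lra.
by rewrite !rmorphD /= in x2 y2 *; rewrite -[n.+1%:~R]natr1; lra.
Qed.

Lemma window_near w z (rho : nat) : edist z w <= rho%:R ->
  window rho.+1 (Num.floor w.1) (Num.floor w.2) z.
Proof.
move=> h; have h1 := le_trans (le_fst_edist z w) h.
have h2 := le_trans (le_snd_edist z w) h.
have := floor_near h1; have := floor_near h2; rewrite /window/rectangle/=.
move: (Num.floor _) (Num.floor _) (Num.floor _) (Num.floor _) => a b c e.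
clear; lia.
Qed.

Let mgauss f : tempered f -> measurable_fun setT (V f).
Proof.
move=> ft; have -> : gaussian = poly_gauss (2 `^ (4^-1))%:C%C%:P :> (R -> R[i]).
  by apply/funext => t; rewrite gaussianE /poly_gauss hornerC rmorphM.
exact: measurable_stft.
Qed.

Lemma gauss_sampling_data (f : (R -> R[i]) -> R[i]) : tempered f ->
  (forall z, 0 <= V f z) /\ exists (M : nat) (K : R), 0 < K /\
    forall z, V f z <= K * (1 + `|z.1|) ^+ M * (1 + `|z.2|) ^+ M.
Proof.
move=> ft; split; first by move=> z; exact: normc_ge0.
exact: stft_gaussian_growth.
Qed.

(** Vertical strips with spacing 1/(n+1) and half that width: neighbours leave a gap as wide as a
    strip, and since the height is 1 the width is also the area. *)
Let box (n l : nat) w : set (R * R) :=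
  `[(w.1 + l%:R / n.+1%:R)%R, (w.1 + l%:R / n.+1%:R + (2 * n.+1%:R)^-1)%R]%classic `*`
  `[w.2, (w.2 + 1)%R]%classic.

Let box_measurable n l w : measurable (box n l w).
Proof. by apply: measurableX; exact: measurable_itv. Qed.

Let box_mass n l w : (((2 * n.+1%:R)^-1)%:E <= (@lebesgue2 R) (box n l w))%E.
Proof.
have n0 : 0 < (2 * n.+1%:R)^-1 :> R by rewrite invr_gt0 mulr_gt0// ltr0n.
rewrite /lebesgue2 product_measure1E; [|exact: measurable_itv|exact: measurable_itv].
rewrite /= !lebesgue_measure_itv /= !lte_fin !ltrDl n0 ltr01.
by rewrite -!EFinB ![_ + _ - _]addrC !addKr -EFinM mulr1.
Qed.

Let box_near n l w z : (l < n)%N -> box n l w z -> edist z w <= 2.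
Proof.
move=> ln [/=]; rewrite !in_itv/= => /andP[a1 a2] /andP[b1 b2].
apply: (le_trans (edist_le _ _)).
have n0 : 0 < n.+1%:R :> R by rewrite ltr0n.
have h1 : 0 <= l%:R / n.+1%:R :> R by rewrite divr_ge0.
have h2 : l%:R / n.+1%:R + (2 * n.+1%:R)^-1 <= 1 :> R.
  rewrite invfM -mulrDl ler_pdivrMr// mul1r.
  have : l.+1%:R <= n.+1%:R :> R by rewrite ler_nat ltnS ltnW.
  by rewrite -[l.+1%:R]natr1; apply: le_trans; rewrite lerD2l; lra.
move: (l%:R / n.+1%:R) ((2 * n.+1%:R)^-1) h1 h2 a1 a2 => c e *.
have : `|z.1 - w.1| <= 1 by rewrite ler_norml; lra.
have : `|z.2 - w.2| <= 1 by rewrite ler_norml; lra.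
lra.
Qed.

Let box_separated n l l' w z z' : (l < l')%N -> box n l w z -> box n l' w z' ->
  (2 * n.+1%:R)^-1 <= edist z z'.
Proof.
move=> ll [/=]; rewrite !in_itv/= => /andP[_ a2] _ [/=]; rewrite !in_itv/= => /andP[a1' _] _.
apply: le_trans (le_fst_edist z z'); rewrite distrC; apply: le_trans (ler_norm _).
have n0 : 0 < n.+1%:R :> R by rewrite ltr0n.
have : l.+1%:R / n.+1%:R <= l'%:R / n.+1%:R :> R.
  by rewrite ler_wpM2r ?invr_ge0 ?(ltW n0)// ler_nat.
rewrite -[l.+1%:R]natr1 mulrDl mul1r; move: a2; rewrite invfM.
move: (n.+1%:R^-1) (l%:R / _) (l'%:R / _) a1' => *; lra.
Qed.

Lemma modulation_norm_discrete (p : R) : 0 < p -> exists2 B : R, 0 < B &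
  forall f, tempered f -> forall L,
  ((box_sum (square_sup (fun z => V f z `^ p)) L)%:E <=
   B%:E * \int[(@lebesgue_measure R \x @lebesgue_measure R)]_(z in setT) (V f z `^ p)%:E)%E.
Proof.
move=> p0; have [C C0 hC] := @gaussian_local R 2 (ltr0Sn _ _).
(* The strips lie within distance 2 of [w], so suprema are taken over the disc of radius 18 * 2 =
   36; [window_near] adds one square for rounding, whence 37. One family of points suffices for the
   Gaussian window, whence 1. *)
apply: (@sampling_of_points R _ _ (@lebesgue_measure R \x @lebesgue_measure R)%E id
  (@measurable_fst _ _ _ _) (@measurable_snd _ _ _ _) setT measurableT _ tempered
  (fun f => V f) (fun f => V f) p C 37 1) => //.
- move=> f ft; split; first exact: mgauss.
  by move=> z; exact: normc_ge0.
- exact: gauss_sampling_data.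
move=> n; pose m0 : R := (2 * n.+1%:R)^-1.
have m00 : 0 < m0 by rewrite invr_gt0 mulr_gt0// ltr0n.
have [K K0 hK] := hC m0 n m00.
exists K, m0; split => // w; exists (fun _ l => box n l w); split.
  move=> i l _ ln; split; [exact: box_measurable| |exact: box_mass].
  move=> z hz; split => //; apply: window_near; apply: (le_trans (box_near ln hz)).
  by rewrite ler_nat.
move=> f t m S ft m0' S0 ht hS.
pose ts := [seq t 0%N l - w | l <- iota 0 n].
apply: (hK f w m S ts) => //.
- by rewrite size_map size_iota.
- rewrite /ts -map_comp; apply: separated_iota => l l' /andP[ll ln].
  rewrite -[X in normc X](bargmann_varB (t 0%N l - w) (t 0%N l' - w)).
  have -> : t 0%N l - w - (t 0%N l' - w) = t 0%N l - t 0%N l'.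
    by rewrite opprB addrA subrK.
  have [Yl _] := ht 0%N l isT (ltn_trans ll ln).
  have [Yl' _] := ht 0%N l' isT ln.
  by rewrite normc_bargmann_varB; exact: box_separated ll Yl Yl'.
- move=> x /mapP[l]; rewrite mem_iota add0n => /andP[_ ln] ->.
  have [hY hm] := ht 0%N l isT ln.
  rewrite normc_bargmann_varB; split; first exact: box_near hY.
  by rewrite addrC subrK.
- move=> z hz; apply: hS; apply: window_near.
  rewrite -normc_bargmann_varB [w + z]addrC addrK.
  by apply: (le_trans hz); rewrite -natrM ler_nat.
Qed.

Lemma modulation_norm_le_discrete (p B : R) f : 0 < p -> tempered f ->
  (forall L, box_sum (square_sup (fun z => V f z `^ p)) L <= B) ->
  (\int[(@lebesgue_measure R \x @lebesgue_measure R)]_(z in setT) (V f z `^ p)%:E <= B%:E)%E.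
Proof.
move=> p0 ft hB.
have [_ [M [K [K0 hK]]]] := gauss_sampling_data ft.
have [K2 [M2 [K20 hM2]]] := powR_growth M (ltW p0) (ltW K0).
have mphi : measurable_fun setT (fun z => V f z `^ p).
  by apply: (measurableT_comp (measurable_powR p)); exact: mgauss.
have v0 z : 0 <= V f z `^ p by exact: powR_ge0.
have := @sampling_upper_bound R _ _ (@lebesgue_measure R \x @lebesgue_measure R)%E id
  (@measurable_fst _ _ _ _) (@measurable_snd _ _ _ _) setT measurableT _ mphi v0
  (fun z => V f z `^ p) K2 1 1 B M2 0 v0 K20 (hM2 _ (fun z => normc_ge0 _) hK) ler01 ler01.
rewrite !mul1r; apply => //.
- move=> i j; rewrite setTI preimage_id.
  have sub : square i j `<=` `[(i%:~R : R), (i + 1)%:~R]%classic `*` `[(j%:~R : R), (j + 1)%:~R]%classic.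
    move=> z [<- <-]; split; rewrite /= in_itv/=.
      by have /andP[-> /ltW ->] := floor_itv z.1.
    by have /andP[-> /ltW ->] := floor_itv z.2.
  have mS : measurable (square i j : set (R * R)).
    rewrite squareE; have := measurable_pre_rectangle
      (@measurable_fst _ _ R R) (@measurable_snd _ _ R R) measurableT i 1 j 1.
    by rewrite setTI.
  apply: (@le_trans _ _ ((@lebesgue_measure R \x @lebesgue_measure R)%E
      (`[(i%:~R : R), (i + 1)%:~R]%classic `*` `[(j%:~R : R), (j + 1)%:~R]%classic))).
    apply: le_measure => //; rewrite inE//.
    by apply: measurableX; exact: measurable_itv.
  rewrite product_measure1E; [|exact: measurable_itv|exact: measurable_itv].
  rewrite /= !lebesgue_measure_itv /= !lte_fin !ltr_int !ltrDl ltr01.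
  by rewrite -!EFinB !rmorphD /= ![_ + _ - _]addrC !addKr -EFinM mulr1.
- by move=> t S _ h; rewrite mul1r; apply: h; exact: window_self.
Qed.

End modulation_norm_discretization.

(** * A sampling criterion *)

Section sampling_criterion.
Context {R : realType}.
Implicit Types (q : {poly R[i]}) (z w a : R * R) (S : R) (Gamma : set (R * R)).

Local Notation zeta := bargmann_var.
Local Notation V := (fun f w => normc (stft gaussian f w)).

Definition dot a z : R := a.1 * z.1 + a.2 * z.2.

(* N + 1 arcs of Gamma near w, each longer than l.  On the i-th arc x = Re zeta
   satisfies A(zeta) x = X_i(zeta), so a polyanalytic function restricts to a
   holomorphic one there; the values X_i(0) separate the arcs. *)
Definition analytic_arcs Gamma (N : nat) (r k dl l : R) w : Prop :=
  exists (A : {poly R[i]}) (X : nat -> {poly R[i]}) (Y : nat -> set (R * R))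
    (a : nat -> R * R) (s0 : nat -> R),
  [/\ wnorm (9 * r) A <= k,
      forall i, (i <= N)%N -> wnorm (9 * r) (X i) <= k,
      forall i j, (i < j <= N)%N -> dl <= normc ((X i).[0] - (X j).[0]),
      forall i, (i <= N)%N -> [/\ hausdorff1.-caratheodory (Y i), Y i `<=` Gamma &
        forall z, Y i z -> normc (zeta (z - w)) <= r /\
          A.[zeta (z - w)] * (z - w).1%:C%C = (X i).[zeta (z - w)]] &
      forall i, (i <= N)%N -> (a i).1 ^+ 2 + (a i).2 ^+ 2 = 1 /\
        forall s, s0 i <= s <= s0 i + l -> exists2 z, Y i z & dot (a i) z = s].

(** The constants come before [w]: this uniformity is what allows the local estimates to be
    summed. *)
Definition rich_in_arcs Gamma := forall N : nat, exists r k dl l : R,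
  [/\ 0 < r, 0 <= k, 0 < dl & 0 < l] /\ forall w, analytic_arcs Gamma N r k dl l w.

Definition locally_finite_length Gamma := exists2 H : R, 0 <= H &
  forall i j, (hausdorff1 (Gamma `&` square i j) <= H%:E)%E.

Let plane_pr (t : @hausdorff_plane R) : R * R := t.

Lemma measurable_halfplane (phi : R * R -> R) c :
  (forall z w, `|phi z - phi w| <= edist z w) ->
  measurable ([set z | phi z <= c] : set (@hausdorff_plane R)).
Proof. exact: caratheodory_halfplane. Qed.

Lemma measurable_lipschitz (phi : R * R -> R) :
  (forall z w, `|phi z - phi w| <= edist z w) ->
  measurable_fun setT (fun t : @hausdorff_plane R => phi t).
Proof.
move=> lip _; apply: (measurability _ (RGenOInfty.measurableE R)) => // _ [_ [c ->] <-].
rewrite setTI (_ : _ @^-1` _ = ~` [set z : @hausdorff_plane R | phi z <= c]).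
  by apply: measurableC; exact: measurable_halfplane.
by apply/seteqP; split => z; rewrite /= in_itv/= andbT ltNge => /negP.
Qed.

Lemma measurable_plane_fst : measurable_fun setT (fun t => (plane_pr t).1).
Proof. exact: (measurable_lipschitz (phi := fst) (@le_fst_edist R)). Qed.

Lemma measurable_plane_snd : measurable_fun setT (fun t => (plane_pr t).2).
Proof. exact: (measurable_lipschitz (phi := snd) (@le_snd_edist R)). Qed.

Lemma measurable_plane_pr : measurable_fun setT plane_pr.
Proof.
apply/measurable_fun_pairP; split; [exact: measurable_plane_fst|exact: measurable_plane_snd].
Qed.

Lemma measurable_plane_stft f q : tempered f ->
  measurable_fun setT (fun t : @hausdorff_plane R => normc (stft (poly_gauss q) f t)).
Proof.
move=> ft; exact: (measurableT_comp (measurable_stft ft q) measurable_plane_pr).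
Qed.

Lemma dot_lipschitz a z w : a.1 ^+ 2 + a.2 ^+ 2 = 1 -> `|dot a z - dot a w| <= edist z w.
Proof. exact: linear_lipschitz. Qed.

Lemma measurable_strip a (c c' : R) : a.1 ^+ 2 + a.2 ^+ 2 = 1 ->
  measurable ([set z | c <= dot a z <= c'] : set (@hausdorff_plane R)).
Proof.
move=> a1.
rewrite (_ : [set z | _] = [set z | - dot a z <= - c] `&` [set z | dot a z <= c']).
  apply: measurableI.
    apply: (@measurable_halfplane (fun z => - dot a z)) => z w.
    by rewrite -opprD normrN; exact: dot_lipschitz.
  by apply: measurable_halfplane => z w; exact: dot_lipschitz.
by apply/seteqP; split => z /=; [move=> /andP[h1 h2]; split => //|move=> [h1 h2]; apply/andP; split => //];
  rewrite ?lerN2 // -lerN2.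
Qed.

Lemma sampling_from_arcs q N (p : R) Gamma : size q = N.+1 -> 0 < p ->
  hausdorff1.-caratheodory Gamma -> rich_in_arcs Gamma ->
  exists2 B : R, 0 < B & forall f, tempered f -> forall L,
  ((box_sum (square_sup (fun z => V f z `^ p)) L)%:E <=
   B%:E * sampling_energy (poly_gauss q) p f Gamma)%E.
Proof.
move=> sq p0 mG rich; have [r [k [dl [len [[r0 k0 dl0 len0] arcs]]]]] := rich N.
have [C C0 hC] := stft_local sq r0 k0 dl0.
set rb : R := 2 * (2 ^+ N * (9 * r)) in hC.
have rrb : r <= rb.
  have : 1 <= 2 ^+ N :> R by rewrite exprn_ege1// ler1n.
  by rewrite /rb; nra.
pose rho := (Num.truncn rb).+1.
have rbrho : rb <= rho%:R by rewrite ltW// truncnS_gt.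
have sample := @sampling_of_points R _ _ (@hausdorff_measure1 R) plane_pr
  measurable_plane_fst measurable_plane_snd Gamma mG.
have {}sample := sample _ tempered (fun f => V f).
have {}sample := sample (fun f t => normc (stft (poly_gauss q) f t)) p C rho.+1 N.+1 p0 C0.
apply: sample.
- move=> f ft; split; first exact: measurable_plane_stft.
  by move=> t; exact: normc_ge0.
- exact: gauss_sampling_data.
(* The range of [dot (a i)] on an arc is cut into [2 * n.+1] intervals of length [l0], and [n]
   alternate ones are kept: points of different pieces are then at least [l0] apart, and each piece
   has length at least [l0]. *)
move=> n; pose l0 : R := len / (2 * n.+1%:R).
have n0 : 0 < 2 * n.+1%:R :> R by rewrite mulr_gt0// ltr0n.
have l00 : 0 < l0 by rewrite divr_gt0.
have [K K0 hK] := hC l0 n l00.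
exists K, l0; split => // w.
have [A [X [Y [a [s0 [Ak Xk Xsep YG Ya]]]]]] := arcs w.
pose lo i l : R := s0 i + 2 * l%:R * l0.
pose Z i l : set (R * R) := Y i `&` [set z | lo i l <= dot (a i) z <= lo i l + l0].
exists Z; split.
  move=> i l; rewrite ltnS => iN ln; have [mY YGi hYi] := YG i iN; have [a1 surj] := Ya i iN.
  split.
  - by apply: (@measurableI _ (@hausdorff_plane R)); [exact: mY|exact: measurable_strip].
  - move=> z [Yz _]; split; first exact: YGi.
    apply: window_near; rewrite -normc_bargmann_varB.
    by have [zr _] := hYi z Yz; exact: le_trans zr (le_trans rrb rbrho).
  - have -> : l0 = lo i l + l0 - lo i l by rewrite addrC addKr.
    apply: (@hausdorff1_ge _ (dot (a i))).
    + by rewrite lerDl ltW.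
    + by move=> z z'; exact: dot_lipschitz.
    + move=> s hs; have [|z Yz zs] := surj s; last by exists z => //; split => //=; rewrite zs.
      have /andP[h1 h2] := hs.
      have h3 : lo i l + l0 <= s0 i + len.
        rewrite /lo -addrA lerD2l.
        have -> : len = 2 * n.+1%:R * l0 by rewrite /l0 mulrC divfK// gt_eqF.
        rewrite -{2}[l0]mul1r -mulrDl ler_wpM2r ?(ltW l00)//.
        have : l.+1%:R <= n.+1%:R :> R by rewrite ler_nat ltnS ltnW.
        rewrite -[l.+1%:R]natr1 => h; have := h; lra.
      have h4 : s0 i <= lo i l by rewrite lerDl !mulr_ge0// ltW.
      by rewrite (le_trans h4 h1) (le_trans h2 h3).
move=> f t m S ft m0 S0 ht hS.
pose ts i := [seq t i l - w | l <- iota 0 n].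
apply: (hK f w m S A X ts) => //.
- move=> i iN; rewrite size_map size_iota; split => //.
  rewrite /ts -map_comp; apply: separated_iota => l l' /andP[ll ln].
  rewrite -[X in normc X](bargmann_varB (t i l - w) (t i l' - w)).
  have -> : t i l - w - (t i l' - w) = t i l - t i l'.
    by rewrite opprB addrA subrK.
  rewrite normc_bargmann_varB.
  have iN' : (i < N.+1)%N by rewrite ltnS.
  have [[_ /= /andP[_ h1]] _] := ht i l iN' (ltn_trans ll ln).
  have [[_ /= /andP[h2 _]] _] := ht i l' iN' ln.
  have [a1 _] := Ya i iN.
  apply: le_trans (dot_lipschitz _ _ a1).
  rewrite distrC; apply: le_trans (ler_norm _).
  have h3 : 2 * l.+1%:R * l0 <= 2 * l'%:R * l0.
    by rewrite ler_wpM2r ?(ltW l00)// ler_wpM2l// ler_nat.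
  move: h3 h1 h2; rewrite /lo -[l.+1%:R]natr1 mulrDr mulr1 mulrDl; lra.
- move=> i x iN /mapP[l]; rewrite mem_iota add0n => /andP[_ ln] ->.
  have iN' : (i < N.+1)%N by rewrite ltnS.
  have [[hY _] hm] := ht i l iN' ln.
  have [_ _ hYi] := YG i iN; have [zr zA] := hYi _ hY.
  by split => //; rewrite addrC subrK.
- move=> z hz; apply: hS; apply: window_near.
  rewrite -normc_bargmann_varB [w + z]addrC addrK.
  exact: le_trans hz rbrho.
Qed.

Lemma energy_upper_bound q N (p : R) Gamma : size q = N.+1 -> 0 < p ->
  hausdorff1.-caratheodory Gamma -> locally_finite_length Gamma ->
  exists2 C : R, 0 <= C & forall f B, tempered f ->
  (forall L, box_sum (square_sup (fun z => V f z `^ p)) L <= B) ->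
  (sampling_energy (poly_gauss q) p f Gamma <= (C * B)%:E)%E.
Proof.
move=> sq p0 mG [H H0 hH].
have [C C0 hC] := stft_le_local_sup sq.
set rb : R := 2 * 2 ^+ N in hC.
pose rho := (Num.truncn rb).+1.
have rbrho : rb <= rho%:R by rewrite ltW// truncnS_gt.
exists (H * C `^ p * (rho.+1.*2.+1 ^ 2)%:R); first by rewrite !mulr_ge0// powR_ge0.
move=> f B ft hB.
have [_ [M [K [K0 hK]]]] := gauss_sampling_data ft.
have [K2 [M2 [K20 hM2]]] := powR_growth M (ltW p0) (ltW K0).
have mphi : measurable_fun setT (fun t : @hausdorff_plane R => normc (stft (poly_gauss q) f t) `^ p).
  by apply: (measurableT_comp (measurable_powR p)); exact: measurable_plane_stft.
have v0 z : 0 <= V f z `^ p by exact: powR_ge0.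
apply: (@sampling_upper_bound R _ _ (@hausdorff_measure1 R) plane_pr
  measurable_plane_fst measurable_plane_snd Gamma mG _ mphi _
  (fun z => V f z `^ p) K2 (C `^ p) H B M2 rho.+1) => //.
- by move=> t; exact: powR_ge0.
- exact: hM2 (fun z => normc_ge0 _) hK.
- exact: powR_ge0.
move=> t S _ hS.
have S0 : 0 <= S by apply: le_trans (v0 (plane_pr t)) _; apply: hS; exact: window_self.
have inv x b : 0 <= x -> 0 <= b -> x `^ p <= b -> x <= b `^ (p^-1).
  move=> a0 b0 ab; rewrite -[x](powRr1 a0) -(@mulfV _ p) ?gt_eqF// powRrM.
  by apply: ge0_ler_powR; rewrite ?nnegrE ?invr_ge0 ?powR_ge0// ltW.
have invK b : 0 <= b -> (b `^ (p^-1)) `^ p = b.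
  by move=> b0; rewrite -powRrM mulVf ?gt_eqF// powRr1.
rewrite -[S]invK// -powRM ?powR_ge0//.
apply: ge0_ler_powR; rewrite ?nnegrE ?mulr_ge0 ?normc_ge0 ?powR_ge0// ?(ltW p0)//.
apply: hC => //; first exact: powR_ge0.
move=> z hz; apply: inv; rewrite ?normc_ge0//; apply: hS; apply: window_near.
rewrite -normc_bargmann_varB [_ + z]addrC addrK; exact: le_trans hz rbrho.
Qed.

Lemma modulation_normE (p : R) f : 0 < p ->
  (modulation_norm p f `^ p = \int[(@lebesgue_measure R \x @lebesgue_measure R)]_(z in setT)
    (V f z `^ p)%:E)%E.
Proof.
move=> p0; rewrite /modulation_norm poweR_Lnorm ?gt_eqF//.
apply: eq_integral => z _.
by rewrite gee0_abs ?lee_fin ?normc_ge0// poweR_EFin.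
Qed.

(** Both bounds pass through the box sums of the local suprema of |V_(h_0) f|^p, which are
    comparable with the modulation norm on one side and with the energy along [Gamma] on the
    other. *)
Theorem rich_gabor_sampling_trajectory (g : R -> R[i]) (p : R) Gamma :
  hermite_span g -> g <> (fun=> 0) -> 0 < p ->
  trajectory_set Gamma -> hausdorff1.-caratheodory Gamma ->
  locally_finite_length Gamma -> rich_in_arcs Gamma ->
  gabor_sampling_trajectory g p Gamma.
Proof.
move=> /hermite_span_poly[q ->] /poly_gauss_neq0 q0 p0 tG mG lG rG; split => //.
have [N sq] : exists N, size q = N.+1.
  by exists (size q).-1; rewrite prednK// lt0n size_poly_eq0.
have [B1 B10 h1] := modulation_norm_discrete p0.
have [B2 B20 h2] := sampling_from_arcs sq p0 mG rG.
have [C C0 h3] := energy_upper_bound sq p0 mG lG.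
exists B2^-1, (C * B1 + 1); split; rewrite ?invr_gt0 ?ltr_wpDl ?mulr_ge0 ?(ltW B10)//.
move=> f [ft _ _ fin]; rewrite modulation_normE//.
set E := sampling_energy _ _ _ _; set I := (\int[_]_(z in setT) _)%E.
have E0 : (0 <= E)%E by apply: integral_ge0 => z _; rewrite lee_fin powR_ge0.
have I0 : (0 <= I)%E by apply: integral_ge0 => z _; rewrite lee_fin powR_ge0.
have fI : I \is a fin_num.
  rewrite ge0_fin_numE// /I -modulation_normE//.
  by apply: poweR_lty; exact: fin.
split.
- have [Eoo|Efin] := eqVneq E +oo%E; first by rewrite Eoo leey.
  have fE : E \is a fin_num by rewrite ge0_fin_numE// ltey.
  rewrite lee_pdivrMl//.
  rewrite -(fineK fE) -EFinM; apply: modulation_norm_le_discrete => // L.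
  by have := h2 f ft L; rewrite -/E -(fineK fE) -EFinM lee_fin.
- have := h3 f (B1 * fine I) ft; rewrite -/E => h.
  apply: (@le_trans _ _ (C * (B1 * fine I))%:E).
    by apply: h => L; have := h1 f ft L; rewrite -/I -(fineK fI) -EFinM lee_fin.
  rewrite -{2}(fineK fI) -EFinM lee_fin mulrA ler_wpM2r ?fine_ge0//.
  by rewrite lerDl.
Qed.

End sampling_criterion.

(** * Straight arcs *)

Section straight_arcs.
Context {R : realType}.
Implicit Types (z w a b P Q : R * R) (Gamma : set (R * R)).

Local Notation zeta := bargmann_var.

Definition cross a b : R := a.1 * b.2 - a.2 * b.1.

Lemma affine_combE P Q (t : R) : affine_comb P Q t =
  ((1 - t) * P.1 + t * Q.1, (1 - t) * P.2 + t * Q.2).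
Proof. by []. Qed.

Lemma edist_lipschitz w z z' : `|edist z w - edist z' w| <= edist z z'.
Proof.
rewrite ler_norml; have := edist_triangle z' z w; have := edist_triangle z z' w.
by rewrite (edist_sym z' z); lra.
Qed.

(** The segment is cut out of its line [f = 0] by the condition [0 <= g <= D] on the projection; the
    coordinates are Lipschitz, hence measurable for the Caratheodory sigma-algebra. *)
Lemma measurable_segment P Q : P != Q -> hausdorff1.-caratheodory (segment P Q).
Proof.
move=> PQ.
pose D : R := (Q.1 - P.1) ^+ 2 + (Q.2 - P.2) ^+ 2.
have D0 : 0 < D.
  rewrite lt_neqAle addr_ge0 ?sqr_ge0// andbT eq_sym; apply: contra PQ.
  rewrite paddr_eq0 ?sqr_ge0// !sqrf_eq0 !subr_eq0 => /andP[/eqP h1 /eqP h2].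
  by apply/eqP; rewrite (surjective_pairing P) (surjective_pairing Q) h1 h2.
pose f (z : @hausdorff_plane R) : R := (z.1 - P.1) * (Q.2 - P.2) - (z.2 - P.2) * (Q.1 - P.1).
pose g (z : @hausdorff_plane R) : R := (z.1 - P.1) * (Q.1 - P.1) + (z.2 - P.2) * (Q.2 - P.2).
have m1 : measurable_fun setT (fun z : @hausdorff_plane R => z.1) := measurable_plane_fst.
have m2 : measurable_fun setT (fun z : @hausdorff_plane R => z.2) := measurable_plane_snd.
have c1 : measurable_fun setT (fun z : @hausdorff_plane R => z.1 - P.1) :=
  measurable_funB m1 (measurable_cst _).
have c2 : measurable_fun setT (fun z : @hausdorff_plane R => z.2 - P.2) :=
  measurable_funB m2 (measurable_cst _).
have mf : measurable_fun setT f := measurable_funB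
  (measurable_funM c1 (measurable_cst _)) (measurable_funM c2 (measurable_cst _)).
have mg : measurable_fun setT g := measurable_funD
  (measurable_funM c1 (measurable_cst _)) (measurable_funM c2 (measurable_cst _)).
have -> : segment P Q = (f @^-1` [set 0]) `&` (g @^-1` `[0, D]).
  apply/seteqP; split => z.
    move=> [t /andP[t0 t1] <-]; rewrite affine_combE /f /g /=; split; first by ring.
    rewrite in_itv /=.
    rewrite (_ : _ + _ = t * D); last by rewrite /D; ring.
    by rewrite mulr_ge0 ?(ltW D0)//= ler_piMl// ltW.
  rewrite /f /g /= in_itv/= => -[f0 /andP[g0 gD]].
  exists (g z / D); first by rewrite /= divr_ge0 ?(ltW D0)//= ler_pdivrMr// mul1r.
  rewrite affine_combE /g; case: z f0 g0 gD => x y /= f0 _ _.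
  have Dn : D != 0 by rewrite gt_eqF.
  have e1 : (x - P.1) * D = ((x - P.1) * (Q.1 - P.1) + (y - P.2) * (Q.2 - P.2)) * (Q.1 - P.1).
    apply/eqP; rewrite -subr_eq0 /D; apply/eqP.
    transitivity ((Q.2 - P.2) * ((x - P.1) * (Q.2 - P.2) - (y - P.2) * (Q.1 - P.1))); first by ring.
    by rewrite f0 mulr0.
  have e2 : (y - P.2) * D = ((x - P.1) * (Q.1 - P.1) + (y - P.2) * (Q.2 - P.2)) * (Q.2 - P.2).
    apply/eqP; rewrite -subr_eq0 /D; apply/eqP.
    transitivity (- (Q.1 - P.1) * ((x - P.1) * (Q.2 - P.2) - (y - P.2) * (Q.1 - P.1))); first by ring.
    by rewrite f0 mulr0.
  congr (_, _).
    apply: (mulIf Dn); rewrite -[RHS](subrK (P.1 * D)) -mulrBl e1.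
    by field.
  apply: (mulIf Dn); rewrite -[RHS](subrK (P.2 * D)) -mulrBl e2.
  by field.
apply: (@measurableI _ (@hausdorff_plane R)).
  by rewrite -[X in measurable X]setTI; apply: mf => //; exact: measurable_set1.
by rewrite -[X in measurable X]setTI; apply: mg => //; exact: measurable_itv.
Qed.

Lemma edist_affine P Q (s t : R) :
  edist (affine_comb P Q s) (affine_comb P Q t) = `|s - t| * edist P Q.
Proof.
apply/eqP; rewrite -(@eqrXn2 _ 2)// ?edist_ge0 ?mulr_ge0 ?edist_ge0//.
rewrite exprMn !edist_sqr real_normK ?num_real//.
by rewrite !affine_combE /=; apply/eqP; ring.
Qed.

Lemma wnorm_linear (r : R) (c d : R[i]) : wnorm r (c%:P + d%:P * 'X) = normc c + r * normc d.
Proof. by rewrite addrC wnorm_cons wnormC. Qed.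

(* With unit normal n = nu conj, the line n.(z - w) = c reads
   2x = zeta + conj zeta = zeta + 2 c conj(nu) - conj(nu)^2 zeta. *)
Lemma line_arcs Gamma (N : nat) w (r dl l : R) (P Q : nat -> R * R) (t0 : nat -> R) :
  0 < l -> 0 < r ->
  (forall j, (j <= N)%N -> [/\ segment (P j) (Q j) `<=` Gamma,
     2 * l <= edist (P j) (Q j), 0 <= t0 j <= 1 &
     edist (affine_comb (P j) (Q j) (t0 j)) w + l <= r]) ->
  (forall i j, (i < j <= N)%N ->
     `|cross (Q i - P i) (P i - w)| / edist (P i) (Q i) + dl <=
     `|cross (Q j - P j) (P j - w)| / edist (P j) (Q j)) ->
  analytic_arcs Gamma N r (10 * r + 1) dl l w.
Proof.
move=> l0 r0 hPQ hsep.
pose D j := edist (P j) (Q j).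
have D0 j : (j <= N)%N -> 0 < D j.
  by move=> jN; have [_ h _ _] := hPQ j jN; apply: lt_le_trans h; rewrite mulr_gt0.
pose u j : R * R := ((Q j - P j).1 / D j, (Q j - P j).2 / D j).
have u1 j : (j <= N)%N -> (u j).1 ^+ 2 + (u j).2 ^+ 2 = 1.
  move=> jN; have Dn : D j != 0 by rewrite gt_eqF// D0.
  rewrite /u /= !expr_div_n -mulrDl.
  have -> : (Q j - P j).1 ^+ 2 + (Q j - P j).2 ^+ 2 = D j ^+ 2.
    by rewrite /D edist_sym edist_sqr.
  by rewrite mulfV// expf_neq0.
pose c j : R := cross (u j) (P j - w).
pose nu j : R[i] := (- (u j).2 +i* (u j).1)%C.
have nu1 j : (j <= N)%N -> normc (nu j) = 1.
  by move=> jN; rewrite /nu /= sqrrN addrC u1// sqrtr1.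
have cE j : (j <= N)%N -> `|c j| = `|cross (Q j - P j) (P j - w)| / D j.
  move=> jN; have Dp := D0 j jN.
  rewrite -[X in _ / X](ger0_norm (ltW Dp)) -normf_div; congr `|_|.
  by rewrite /c /cross /u /=; field; rewrite gt_eqF.
have cseg j z : (j <= N)%N -> segment (P j) (Q j) z -> cross (u j) (z - w) = c j.
  move=> jN [t _ <-]; have Dn : D j != 0 by rewrite gt_eqF// D0.
  by rewrite affine_combE /c /cross /u /=; field.
have c_le j : (j <= N)%N -> `|c j| <= r.
  move=> jN; have [_ _ t01 hr] := hPQ j jN.
  have := cseg j (affine_comb (P j) (Q j) (t0 j)) jN (ex_intro2 _ _ (t0 j) t01 erefl).
  set z := affine_comb _ _ _ in hr * => <-.
  have := @linear_lipschitz R (- (u j).2) (u j).1 z w.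
  rewrite sqrrN addrC u1// => /(_ erefl).
  have -> : - (u j).2 * z.1 + (u j).1 * z.2 - (- (u j).2 * w.1 + (u j).1 * w.2) =
    cross (u j) (z - w) by rewrite /cross /=; ring.
  by move: hr; lra.
(* The arc starts at the parameter [t0 j] and runs towards the farther endpoint, which is at least
   [l] away because the segment is at least [2 * l] long. *)
exists 1, (fun j => ((c j)%:C%C * nu j)%:P + ((2^-1)%:C%C * (1 - nu j ^+ 2))%:P * 'X),
  (fun j => segment (P j) (Q j) `&` [set z | edist z w <= r]), u,
  (fun j => dot (u j) (affine_comb (P j) (Q j) (t0 j)) - (if t0 j <= 1 / 2 then 0 else l)).
split.
- by rewrite -polyC1 wnormC normc1 lerDr mulr_ge0// ltW.
(* A constant term of modulus at most [r] and a slope of modulus at most 1 at radius [9 * r] give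
   [10 * r]; the 1 in [10 * r + 1] is the norm of [A = 1]. *)
- move=> j jN; rewrite wnorm_linear 2!normcM !normc_real (nu1 j jN) mulr1.
  have h1 : normc (1 - nu j ^+ 2) <= 2.
    apply: (le_trans (le_normcB _ _)); rewrite normcX normc1 (nu1 j jN) expr1n.
    by lra.
  have h2 := c_le j jN.
  rewrite [`|2^-1|]ger0_norm ?invr_ge0//; nra.
(* At 0 the value of X is c nu with nu of modulus 1; comparing moduli shows that separated distances
   to [w] suffice, whatever the directions of the lines. *)
- move=> i j ijN; have /andP[ij jN] := ijN; have iN : (i <= N)%N by rewrite (leq_trans _ jN)// ltnW.
  rewrite !hornerE.
  have := hsep i j ijN; rewrite -!/(D _) -!cE// => h.
  rewrite normcB_sym.
  have : normc ((c j)%:C%C * nu j) <= normc ((c j)%:C%C * nu j - (c i)%:C%C * nu i) +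
      normc ((c i)%:C%C * nu i).
    by apply: le_trans (le_normcD _ _); rewrite subrK.
  rewrite !(normcM _ (nu _)) !nu1// !mulr1 !normc_real; lra.
- move=> j jN; have [sub hD _ _] := hPQ j jN; split.
  + apply: (@measurableI _ (@hausdorff_plane R)).
      apply: measurable_segment; apply/eqP => PQ.
      by have := D0 j jN; rewrite /D PQ /edist !subrr expr0n addr0 sqrtr0 ltxx.
    apply: (@measurable_halfplane _ (fun z => edist z w)); exact: edist_lipschitz.
  + by move=> z [/sub].
  + move=> z [zPQ zw]; rewrite normc_bargmann_varB; split; first exact: zw.
    have hc := cseg j z jN zPQ; have hu := u1 j jN.
    rewrite -polyC1 hornerC mul1r !hornerE -hc /nu /bargmann_var /cross.
    move: (z - w) (u j) hu => [x y] [a b] /= hu.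
    apply/eqP; rewrite eq_complex /=; apply/andP; split; apply/eqP.
      by transitivity (2^-1 * x * (1 + (a ^+ 2 + b ^+ 2))); [rewrite hu|]; field.
    by transitivity (2^-1 * y * (a ^+ 2 + b ^+ 2 - 1)); [rewrite hu|]; field.
- move=> j jN; split; first exact: u1.
  move=> s hs; have [_ hD t01 hr] := hPQ j jN; have Dp := D0 j jN.
  set e := dot (u j) _ in hs.
  have Dn : D j != 0 by rewrite gt_eqF.
  pose t := t0 j + (s - e) / D j.
  have dE : dot (u j) (affine_comb (P j) (Q j) t) = s.
    have uD : dot (u j) (Q j - P j) = D j.
      transitivity (D j * ((u j).1 ^+ 2 + (u j).2 ^+ 2)); last by rewrite u1// mulr1.
      by rewrite /dot /u /=; field.
    transitivity (e + (t - t0 j) * dot (u j) (Q j - P j)).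
      by rewrite /e /dot !affine_combE /=; ring.
    by rewrite uD /t [t0 j + _]addrC addrK divfK// addrC subrK.
  have lD : l / D j <= 1 / 2 by rewrite ler_pdivrMr//; have := hD; rewrite -/(D j); lra.
  have se : `|s - e| <= l by rewrite ler_norml; move: hs; case: ifP => _; lra.
  have sD : `|(s - e) / D j| <= l / D j.
    by rewrite normrM [`|(D j)^-1|]ger0_norm ?invr_ge0 ?(ltW Dp)// ler_wpM2r ?invr_ge0// ltW.
  exists (affine_comb (P j) (Q j) t) => //; split.
    exists t => //=; rewrite /t; move: sD; rewrite ler_norml => /andP[s1 s2].
    move: hs; case: ifP => ht /andP[h1 h2].
      have : 0 <= (s - e) / D j by rewrite divr_ge0 ?(ltW Dp)//; lra.
      by move: t01; lra.
    have : (s - e) / D j <= 0 by rewrite ler_pdivrMr// mul0r; lra.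
    by move: t01 ht => /andP[_ t1] /negbT; rewrite -ltNge; lra.
  rewrite /=; apply: (le_trans (edist_triangle (affine_comb (P j) (Q j) (t0 j)) _ _)).
  rewrite edist_affine /t [t0 j + _]addrC addrK.
  have : `|(s - e) / D j| * D j <= l.
    by rewrite normrM [`|(D j)^-1|]ger0_norm ?invr_ge0 ?(ltW Dp)// divfK.
  by move: hr; rewrite -/(D j); lra.
Qed.

End straight_arcs.

(** * Trajectories and local finiteness of length *)

Section trajectories.
Context {R : realType}.
Implicit Types (z w a b P Q : R * R) (Gamma : set (R * R)).

Lemma lipschitz_trajectory (gamma : R -> R * R) (L : R) :
  (forall s t, edist (gamma s) (gamma t) <= L * `|s - t|) -> trajectory (range gamma).
Proof.
move=> lip; exists gamma; split => //.
  have comp (h : R * R -> R) : (forall z w, `|h z - h w| <= edist z w) ->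
      continuous (fun t => h (gamma t)).
    move=> hl t; apply/cvgrPdist_le => e e0.
    have L1 : 0 < `|L| + 1 by rewrite ltr_wpDl.
    near=> s; apply: (le_trans (hl _ _)); apply: (le_trans (lip _ _)).
    apply: (@le_trans _ _ ((`|L| + 1) * `|t - s|)).
      by apply: ler_wpM2r => //; rewrite (le_trans (ler_norm L))// lerDl.
    rewrite -ler_pdivlMl// mulrC.
    near: s; apply: cvgr_dist_le; [exact: cvg_id|exact: divr_gt0].
  move=> t; have -> : gamma = fun t => ((gamma t).1, (gamma t).2).
    by apply/funext => s; rewrite -surjective_pairing.
  have h1 := comp fst (@le_fst_edist R) t; have h2 := comp snd (@le_snd_edist R) t.
  exact: (cvg_pair h1 h2).
move=> a b ab; exists (L * (b - a)) => s [ps /eqP <-].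
elim: s a ps {ab} => [|x s IH] a /=; first by rewrite big_nil subrr mulr0.
move=> /andP[ax ps]; rewrite big_cons /=.
have := IH x ps; have := lip a x; rewrite distrC gtr0_norm ?subr_gt0//; lra.
Unshelve. all: by end_near. Qed.

Lemma segment_trajectory P Q : trajectory (segment P Q).
Proof.
pose clamp (t : R) := Num.max 0 (Num.min t 1).
have clamp01 t : 0 <= clamp t <= 1.
  by rewrite /clamp le_max lexx /= ge_max ler01 ge_min lexx orbT.
have clampK t : 0 <= t <= 1 -> clamp t = t.
  by move=> /andP[t0 t1]; rewrite /clamp (min_l t1) (max_r t0).
have clamp_lip s t : `|clamp s - clamp t| <= `|s - t|.
  rewrite /clamp; case: (leP s 1) => ?; case: (leP t 1) => ?; rewrite ?(max_r (@ler01 R));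
    case: (leP 0 s) => ?; case: (leP 0 t) => ?; rewrite ler_norml; apply/andP; split;
    have := ler_norm (s - t); have := ler_norm (- (s - t)); rewrite normrN; lra.
have -> : segment P Q = range (fun t => affine_comb P Q (clamp t)).
  apply/seteqP; split => z [t]; first by move=> t01 <-; exists t => //; rewrite clampK.
  by move=> _ <-; exists (clamp t) => //; exact: clamp01.
apply: (@lipschitz_trajectory _ (edist P Q)) => s t.
by rewrite edist_affine mulrC ler_wpM2l ?edist_ge0.
Qed.

Lemma trajectory_set_bigcup n (G : nat -> nat -> set (R * R)) :
  (forall i m, trajectory (G i m)) ->
  trajectory_set (\bigcup_(i in `I_n) \bigcup_m G i m).
Proof.
(* The pair (i, m) is coded by [m * n + i]; for [n = 0] the index set is empty. *)
move=> tG; exists [set k | (0 < n)%N], (fun k => G (k %% n)%N (k %/ n)%N); split => //.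
apply/seteqP; split => z.
  move=> [i /= ni [m _ Gz]]; exists (m * n + i)%N; first by rewrite /= (leq_ltn_trans _ ni).
  by rewrite modnMDl modn_small// divnMDl ?(leq_ltn_trans _ ni)// divn_small// addn0.
by move=> [k /= n0 Gz]; exists (k %% n)%N; [rewrite /= ltn_mod|exists (k %/ n)%N].
Qed.

(** On a unit square [s] stays within [V] of its value at the corner, while [G k] lives at levels
    between [k] and [k + 1]; so at most [M] consecutive indices [k] concern one square. *)
Lemma locally_finite_length_level (G : nat -> set (R * R)) (s : R * R -> R) (V c : R) :
  0 <= V -> 0 <= c ->
  (forall k z, G k z -> k%:R <= s z <= k%:R + 1) ->
  (forall i j z, square i j z -> `|s z - s (i%:~R, j%:~R)| <= V) ->
  (forall i j k, (hausdorff1 (G k `&` square i j) <= c%:E)%E) ->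
  locally_finite_length (\bigcup_k G k).
Proof.
move=> V0 c0 Gs sV Gc; pose M := (Num.truncn (2 * V)).+3.
exists (M%:R * c); first exact: mulr_ge0.
move=> i j.
pose s0 := s (i%:~R, j%:~R); pose k0 := Num.truncn (s0 - V - 1).
apply: (@le_trans _ _ (hausdorff1 (\bigcup_(m in `I_M) (G (k0 + m)%N `&` square i j)))).
  apply: le_hausdorff1 => z [[k _ Gz] sqz].
  have := sV i j z sqz; rewrite -/s0 ler_norml => /andP[h1 h2].
  have /andP[h3 h4] := Gs k z Gz.
  have k0k : (k0 <= k)%N.
    by rewrite /k0 truncn_le_nat -natr1; lra.
  have kM : (k < k0 + M)%N.
    have h5 := truncnS_gt (s0 - V - 1); have h6 := truncnS_gt (2 * V).
    rewrite -(ltr_nat R) natrD /M -/k0 in h5 h6 *.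
    by move: h5 h6; rewrite -!natr1 => h5 h6; lra.
  exists (k - k0)%N; first by rewrite /= ltn_subLR.
  by rewrite subnKC.
elim: M => [|M IH]; first by rewrite mul0r II0 bigcup_set0 hausdorff1_0.
rewrite (_ : \bigcup_(m in `I_M.+1) _ = (\bigcup_(m in `I_M) (G (k0 + m)%N `&` square i j)) `|`
   (G (k0 + M)%N `&` square i j)).
  apply: le_trans (outer_measureU2 hausdorff1 _ _) _.
  by rewrite -natr1 mulrDl mul1r EFinD; exact: (leeD IH (Gc _ _ _)).
apply/seteqP; split => z.
  move=> [m /= mM h]; move: mM; rewrite ltnS leq_eqVlt => /orP[/eqP mM|mM].
    by right; rewrite -mM.
  by left; exists m.
by move=> [[m /= mM h]|h]; [exists m => //=; rewrite ltnS ltnW|exists M => /=].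
Qed.

Lemma locally_finite_length_bigcup n (G : nat -> set (R * R)) :
  (forall i, (i < n)%N -> locally_finite_length (G i)) ->
  locally_finite_length (\bigcup_(i in `I_n) G i).
Proof.
elim: n => [|n IH] h.
  by exists 0 => // i j; rewrite II0 bigcup_set0 set0I hausdorff1_0.
have [H1 H10 h1] := IH (fun i ni => h i (leqW ni)).
have [H2 H20 h2] := h n (ltnSn n).
exists (H1 + H2); first exact: addr_ge0.
move=> i j; apply: (@le_trans _ _ (hausdorff1 ((\bigcup_(i in `I_n) G i `&` square i j) `|`
    (G n `&` square i j)))).
  apply: le_hausdorff1 => z [[m /= mn Gz] sz].
  move: mn; rewrite ltnS leq_eqVlt => /orP[/eqP mn|mn].
    by right; rewrite -mn.
  by left; split => //; exists m.
apply: le_trans (outer_measureU2 hausdorff1 _ _) _.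
by rewrite EFinD; exact: (leeD (h1 _ _) (h2 _ _)).
Qed.

Lemma square_coord i j z : square i j z ->
  (i%:~R <= z.1 <= i%:~R + 1) /\ (j%:~R <= z.2 <= j%:~R + 1).
Proof.
move=> [<- <-]; have /andP[-> /ltW] := floor_itv z.1.
by have /andP[-> /ltW] := floor_itv z.2; rewrite !rmorphD /=.
Qed.

Lemma square_coord_dist i j z : square i j z ->
  `|z.1 - i%:~R| <= 1 /\ `|z.2 - j%:~R| <= 1.
Proof. by move=> /square_coord[h1 h2]; rewrite !ler_norml; lra. Qed.

(** One coordinate controls distances with constant 2 and has range 1 on the square, so
    [hausdorff1_le] gives 2 * 2 * 1. *)
Lemma hausdorff1_graph_square (G : set (R * R)) i j :
  (forall z w, G z -> G w -> `|z.2 - w.2| <= `|z.1 - w.1|) \/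
  (forall z w, G z -> G w -> `|z.1 - w.1| <= `|z.2 - w.2|) ->
  (hausdorff1 (G `&` square i j) <= 4%:E)%E.
Proof.
have e4 (x : R) : 4 = 2 * 2 * (x + 1 - x) by ring.
move=> [h|h].
  rewrite (e4 i%:~R); apply: (@hausdorff1_le _ fst) => //; first by rewrite lerDl.
    by move=> z [_ /square_coord[]].
  move=> z w [Gz _] [Gw _]; apply: (le_trans (edist_le _ _)).
  by have := h z w Gz Gw; lra.
rewrite (e4 j%:~R); apply: (@hausdorff1_le _ snd) => //; first by rewrite lerDl.
  by move=> z [_ /square_coord[]].
move=> z w [Gz _] [Gw _]; apply: (le_trans (edist_le _ _)).
by have := h z w Gz Gw; lra.
Qed.

Lemma hausdorff1_segment_square P Q i j :
  (hausdorff1 (segment P Q `&` square i j) <= 4%:E)%E.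
Proof.
apply: hausdorff1_graph_square.
have d1 t t' : (affine_comb P Q t).1 - (affine_comb P Q t').1 = (t - t') * (Q.1 - P.1).
  by rewrite !affine_combE /=; ring.
have d2 t t' : (affine_comb P Q t).2 - (affine_comb P Q t').2 = (t - t') * (Q.2 - P.2).
  by rewrite !affine_combE /=; ring.
have [h|/ltW h] := leP `|Q.2 - P.2| `|Q.1 - P.1|; [left|right];
  by move=> z w [t _ <-] [t' _ <-]; rewrite d1 d2 !normrM ler_wpM2l.
Qed.

End trajectories.

(** * Segments joining the two sides of a wedge *)

Section wedges.
Context {R : realType}.
Implicit Types (z w a b : R * R) (Gamma : set (R * R)).

Lemma scale_pairE (c : R) z : c *: z = (c * z.1, c * z.2).
Proof. by []. Qed.

Lemma edist_enorm z w : edist z w = enorm (z - w).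
Proof. by rewrite /enorm /edist /= !subr0. Qed.

Lemma enorm_sqr z : enorm z ^+ 2 = z.1 ^+ 2 + z.2 ^+ 2.
Proof. by rewrite /enorm edist_sqr /= !subr0. Qed.

Lemma enorm_ge0 z : 0 <= enorm z.
Proof. exact: edist_ge0. Qed.

Lemma enormZ (c : R) z : enorm (c *: z) = `|c| * enorm z.
Proof.
apply/eqP; rewrite -(@eqrXn2 _ 2)// ?enorm_ge0 ?mulr_ge0 ?enorm_ge0//.
rewrite exprMn !enorm_sqr real_normK ?num_real// scale_pairE /=.
by apply/eqP; ring.
Qed.

Lemma enormD z w : enorm (z + w) <= enorm z + enorm w.
Proof.
have -> : enorm (z + w) = edist z (- w) by rewrite edist_enorm opprK.
apply: (le_trans (edist_triangle 0 _ _)); rewrite lerD2l.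
by rewrite edist_enorm sub0r opprK.
Qed.

Lemma cross_le z w : `|cross z w| <= enorm z * enorm w.
Proof.
rewrite -ler_sqr ?nnegrE ?mulr_ge0 ?enorm_ge0// exprMn !enorm_sqr.
rewrite real_normK ?num_real// /cross.
by have := sqr_ge0 (z.1 * w.1 + z.2 * w.2); nra.
Qed.

(** For [sg = true] the segments are not parallel, so their distances to [w] are only enclosed: a
    segment starting at about T levels above [w], levels being values of [al + be], has its line at
    distance between ka T / Dm and na (T + 2). A sparse sequence [T j] makes these enclosures
    disjoint with gaps of at least 1, independently of [w]. *)
Lemma wedge_arcs a b (sg : bool) (N : nat) : cross a b != 0 ->
  exists r0 dl0 l0 : R, [/\ 0 < r0, 0 < dl0 & 0 < l0] /\
  forall Gamma r dl l, r0 <= r -> 0 < dl <= dl0 -> 0 < l <= l0 ->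
    (forall m : nat, segment (m.+1%:R *: a) ((m.+1 + sg)%:R *: b) `<=` Gamma) ->
    forall w (al be : R), 0 <= al -> 0 <= be -> w = al *: a + be *: b ->
    analytic_arcs Gamma N r (10 * r + 1) dl l w.
Proof.
move=> ab0; set ka : R := `|cross a b|.
have ka0 : 0 < ka by rewrite normr_gt0.
set na := enorm a; set nb := enorm b.
have nb0 : 0 <= nb := enorm_ge0 b.
have na0 : 0 < na.
  rewrite lt_neqAle enorm_ge0 andbT eq_sym; apply/eqP => na0.
  by have := cross_le a b; rewrite -/na na0 mul0r leNgt normr_gt0 ab0.
(* The distance from [b] to the line through 0 and [a]; the segments are at least this long, which
   allows [l0 = e1 / 2]. *)
pose e1 := ka / na; have e10 : 0 < e1 by rewrite divr_gt0.
pose Dm := na + 2 * nb; have Dm0 : 0 < Dm by rewrite ltr_pwDl// mulr_ge0.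
(* Each term is so large that the lower bound for its distance exceeds the upper bound for the
   previous one by 1. *)
pose T j := iter j (fun t => (Num.truncn ((na * (t%:R + 2) + 1) * Dm / ka)).+1) 0%N.
have TS j : na * ((T j)%:R + 2) + 1 <= ka * (T j.+1)%:R / Dm.
  rewrite ler_pdivlMr// -ler_pdivrMl// mulrC; apply: ltW; exact: truncnS_gt.
have [Tm Tm0 hTm] := mxcoef_bound (fun j => (T j)%:R : R) N.+1.
exists ((Tm + 2) * (na + nb) + e1 / 2), 1, (e1 / 2); split.
  split => //; last by rewrite divr_gt0.
  by rewrite ltr_wpDl ?divr_gt0// mulr_ge0 ?addr_ge0// ltW.
move=> Gamma r dl l hr /andP[dl0 dl1] /andP[l0 l1] hG w al be al0 be0 wE.
pose s := al + be; have s0 : 0 <= s by rewrite addr_ge0.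
pose k0 := Num.truncn s.
have /andP[k0s sk0] := truncn_itv s0.
pose m j := (k0 + T j)%N.
have mE j : (m j).+1%:R = (Num.truncn s).+1%:R + (T j)%:R :> R by rewrite -natrD addSn.
have ms j : (T j)%:R <= (m j).+1%:R - s <= (T j)%:R + 1.
  by rewrite mE -natr1; move: k0s sk0; rewrite -natr1; lra.
pose P j := (m j).+1%:R *: a; pose Q j := ((m j).+1 + sg)%:R *: b.
have sg01 : 0 <= (sg%:R : R) <= 1 by case: sg {hG Q}; rewrite ?lexx ler01.
have DL j : e1 * (m j).+1%:R <= edist (P j) (Q j).
  rewrite edist_enorm /e1 mulrAC ler_pdivrMr//.
  apply: le_trans (cross_le _ _).
  have -> : cross (P j - Q j) a = ((m j).+1%:R + sg%:R) * cross a b.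
    by rewrite /cross /P /Q natrD !scale_pairE /=; ring.
  have /andP[g0 _] := sg01; rewrite normrM -/ka mulrC; apply: ler_wpM2r; first exact: ltW.
  by rewrite ger0_norm ?addr_ge0// lerDl.
have DU j : edist (P j) (Q j) <= Dm * (m j).+1%:R.
  rewrite edist_enorm; apply: (le_trans (enormD _ _)); rewrite -scaleNr !enormZ.
  rewrite normrN !ger0_norm// natrD -/na -/nb /Dm.
  have m1 : 1 <= (m j).+1%:R :> R by rewrite ler1n.
  by move: (m j).+1%:R m1 => x m1; nra.
have D0 j : 0 < edist (P j) (Q j).
  by apply: lt_le_trans (DL j); rewrite mulr_gt0// ltr0n.
have cE j : `|cross (Q j - P j) (P j - w)| =
    ka * ((m j).+1%:R * ((m j).+1%:R - s) + sg%:R * ((m j).+1%:R - al)).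
  have /andP[h1 _] := ms j; have T0 : 0 <= (T j)%:R :> R := ler0n _ _.
  have -> : cross (Q j - P j) (P j - w) = - (cross a b *
      ((m j).+1%:R * ((m j).+1%:R - s) + sg%:R * ((m j).+1%:R - al))).
    by rewrite wE /cross /P /Q /s natrD !scale_pairE /=; ring.
  rewrite normrN normrM; congr (_ * _); rewrite ger0_norm//.
  have /andP[g0 _] := sg01.
  by rewrite addr_ge0// mulr_ge0//; move: h1; rewrite /s; lra.
have clo j : ka * (T j)%:R / Dm <= `|cross (Q j - P j) (P j - w)| / edist (P j) (Q j).
  have /andP[h1 _] := ms j; have T0 : 0 <= (T j)%:R :> R := ler0n _ _.
  rewrite cE ler_pdivlMr// mulrAC ler_pdivrMr//.
  rewrite -!mulrA ler_wpM2l ?(ltW ka0)//.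
  apply: (@le_trans _ _ ((T j)%:R * (Dm * (m j).+1%:R))).
    by rewrite ler_wpM2l.
  have /andP[g0 g1] := sg01; have M0 : 0 <= (m j).+1%:R :> R := ler0n _ _.
  rewrite mulrCA [leRHS]mulrC ler_wpM2l ?(ltW Dm0)// mulrC.
  have h2 : (m j).+1%:R * (T j)%:R <= (m j).+1%:R * ((m j).+1%:R - s) by rewrite ler_wpM2l.
  have h3 : 0 <= sg%:R * ((m j).+1%:R - al).
    by rewrite mulr_ge0//; move: h1; rewrite /s; lra.
  lra.
have chi j : `|cross (Q j - P j) (P j - w)| / edist (P j) (Q j) <= na * ((T j)%:R + 2).
  have /andP[h1 h2] := ms j; have T0 : 0 <= (T j)%:R :> R := ler0n _ _.
  rewrite cE ler_pdivrMr//.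
  apply: (@le_trans _ _ (na * ((T j)%:R + 2) * (e1 * (m j).+1%:R))); last first.
    by rewrite ler_wpM2l// mulr_ge0 ?addr_ge0// ltW.
  have -> : na * ((T j)%:R + 2) * (e1 * (m j).+1%:R) = ka * ((m j).+1%:R * ((T j)%:R + 2)).
    by rewrite /e1; field; rewrite gt_eqF.
  rewrite ler_wpM2l ?(ltW ka0)//.
  have /andP[g0 g1] := sg01; have M0 : 0 <= (m j).+1%:R :> R := ler0n _ _.
  have h3 : (m j).+1%:R * ((m j).+1%:R - s) <= (m j).+1%:R * ((T j)%:R + 1) by rewrite ler_wpM2l.
  have h4 : sg%:R * ((m j).+1%:R - al) <= 1 * (m j).+1%:R.
    by apply: ler_pM => //; move: h1; rewrite /s; lra.
  lra.
have chain i j : (i < j)%N -> na * ((T i)%:R + 2) + 1 <= ka * (T j)%:R / Dm.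
  elim: j => [//|j IH]; rewrite ltnS leq_eqVlt => /orP[/eqP ->|/IH h]; first exact: TS.
  apply: (le_trans h); apply: (le_trans (clo j)); apply: (le_trans (chi j)).
  by apply: le_trans (TS j); rewrite lerDl.
(* The barycentric weight of [b] at [w]: for [sg = false] the chosen point lies on the ray through
   [w]. At [s = 0], where [w = 0], any weight would do. *)
pose t0 := if s == 0 then 0 else be / s.
have t01 : 0 <= t0 <= 1.
  rewrite /t0; case: eqP => [_|/eqP sn]; first by rewrite lexx ler01.
  have sp : 0 < s by rewrite lt_neqAle eq_sym sn.
  by rewrite divr_ge0//= ler_pdivrMr// mul1r lerDr.
have beE : be = s * t0.
  rewrite /t0; case: eqP => [sz|/eqP sn]; last by rewrite mulrC divfK.
  by rewrite mulr0; move: sz al0 be0; rewrite /s; lra.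
have alE : al = s * (1 - t0) by rewrite mulrBr mulr1 -beE /s addrK.
apply: (@line_arcs _ Gamma N w r dl l P Q (fun=> t0)) => //.
- apply: lt_le_trans hr; rewrite ltr_wpDl ?divr_gt0// mulr_ge0 ?addr_ge0//.
  exact: ltW.
- move=> j jN; split => //; first exact: hG.
  + apply: le_trans (DL j); have : 1 <= (m j).+1%:R :> R by rewrite ler1n.
    by move: (m j).+1%:R => x x1; nra.
  + have zw : affine_comb (P j) (Q j) t0 - w =
        (((m j).+1%:R - s) * (1 - t0)) *: a + (t0 * ((m j).+1%:R - s + sg%:R)) *: b.
      rewrite wE {1}alE {1}beE /affine_comb /P /Q natrD !scale_pairE.
      apply/eqP; rewrite xpair_eqE /=; apply/andP; split; apply/eqP; ring.
    rewrite edist_enorm zw.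
    have /andP[h1 h2] := ms j; have T0 : 0 <= (T j)%:R :> R := ler0n _ _.
    have /andP[g0 g1] := sg01; have /andP[u0 u1] := t01.
    have TTm : (T j)%:R <= Tm.
      by have := hTm j; rewrite ltnS => /(_ jN); rewrite ger0_norm.
    have h3 : enorm ((((m j).+1%:R - s) * (1 - t0)) *: a +
        (t0 * ((m j).+1%:R - s + sg%:R)) *: b) <= (Tm + 2) * na + (Tm + 2) * nb.
      apply: (le_trans (enormD _ _)); rewrite !enormZ -/na -/nb.
      move: ((m j).+1%:R - s) h1 h2 => x h1 h2.
      apply: lerD; (apply: ler_wpM2r; first by rewrite ?(ltW na0)).
        by rewrite ger0_norm ?mulr_ge0//; nra.
      by rewrite ger0_norm ?mulr_ge0//; nra.
    lra.
- move=> i j /andP[ij jN].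
  have := chain i j ij; have := clo j; have := chi i; lra.
Qed.

End wedges.

(** * Concentric circles *)

Section circles.
Context {R : realType}.
Implicit Types (z w : R * R) (rho eta : R).

Local Notation zeta := bargmann_var.

Definition circle rho : set (R * R) := [set z | enorm z = rho].

Lemma enorm_lipschitz z w : `|enorm z - enorm w| <= edist z w.
Proof. exact: edist_lipschitz. Qed.

Lemma measurable_circle rho : hausdorff1.-caratheodory (circle rho).
Proof.
have -> : circle rho = [set z | enorm z <= rho] `&` [set z | - enorm z <= - rho].
  apply/seteqP; split => z /=; first by move=> ->.
  by rewrite lerN2 => -[h1 h2]; apply/eqP; rewrite eq_le h1.
apply: (@measurableI _ (@hausdorff_plane R)); apply: measurable_halfplane => z w.
  exact: enorm_lipschitz.
by rewrite opprK addrC distrC; exact: enorm_lipschitz.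
Qed.

Lemma lipschitz_derive_le1 (h h' : R -> R) : (forall x : R, is_derive x 1 h (h' x)) ->
  (forall x, `|h' x| <= 1) -> forall s t, `|h s - h t| <= `|s - t|.
Proof.
move=> dh h1; suff H s t : s < t -> `|h s - h t| <= `|s - t|.
  move=> s t; have [/H//|/H|->] := ltgtP s t; first by rewrite distrC [leRHS]distrC.
  by rewrite !subrr normr0.
move=> st; have [|x _ e] := @MVT _ h h' s t st (fun x _ => dh x).
  by apply: derivable_within_continuous => x _.
by rewrite distrC e normrM (distrC s) ler_piMl.
Qed.

Lemma polar_angle z : exists2 theta, 0 <= theta <= pi *+ 2 &
  z = (enorm z * cos theta, enorm z * sin theta).
Proof.
have [z0|z0] := eqVneq (enorm z) 0.
  have := enorm_sqr z; rewrite z0 expr0n /= => /esym/eqP.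
  rewrite paddr_eq0 ?sqr_ge0// !sqrf_eq0 => /andP[/eqP h1 /eqP h2].
  exists 0; first by rewrite lexx mulrn_wge0// pi_ge0.
  by rewrite !mul0r (surjective_pairing z) h1 h2.
have zp : 0 < enorm z by rewrite lt_neqAle eq_sym z0 enorm_ge0.
pose x := z.1 / enorm z; pose y := z.2 / enorm z.
have xy : x ^+ 2 + y ^+ 2 = 1.
  by rewrite /x /y !expr_div_n -mulrDl -enorm_sqr mulfV// expf_neq0.
have x1 : -1 <= x <= 1.
  rewrite -ler_norml -(@ler_pXn2r _ 2)// ?nnegrE// expr1n real_normK ?num_real//.
  by rewrite -xy lerDl sqr_ge0.
have ey : Num.sqrt (1 - x ^+ 2) = `|y| by rewrite -xy addrC addKr sqrtr_sqr.
have zE : z = (enorm z * x, enorm z * y).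
  by rewrite /x /y ![enorm z * _]mulrC !divfK// -surjective_pairing.
have cx : cos (acos x) = x by rewrite acosK// in_itv.
have a0 := acos_ge0 x1; have api := acos_lepi x1.
have [y0|y0] := leP 0 y.
  exists (acos x); last by rewrite cx sin_acos// ey ger0_norm.
  by rewrite a0 mulr2n (le_trans api)// lerDl pi_ge0.
exists (pi *+ 2 - acos x); first by rewrite lerBlDr lerDl a0 subr_ge0 mulr2n (le_trans api)// lerDl pi_ge0.
by rewrite cosB sinB cos2pi sin2pi cx sin_acos// ey ltr0_norm// !mul0r mul1r addr0 sub0r mul1r opprK.
Qed.

Lemma circle_trajectory rho : 0 <= rho -> trajectory (circle rho).
Proof.
move=> r0; have -> : circle rho = range (fun t => (rho * cos t, rho * sin t)).
  apply/seteqP; split => z.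
    by move=> <-; have [t _ zE] := polar_angle z; exists t.
  move=> [t _ <-]; apply/eqP; rewrite -(@eqrXn2 _ 2)// ?enorm_ge0// enorm_sqr /=.
  by rewrite !exprMn -mulrDr cos2Dsin2 mulr1.
apply: (@lipschitz_trajectory _ _ (2 * rho)) => s t.
apply: (le_trans (edist_le _ _)); rewrite /= -!mulrBr !normrM (ger0_norm r0).
have h1 : `|cos s - cos t| <= `|s - t|.
  by apply: (@lipschitz_derive_le1 cos (fun x => - sin x)) => x; rewrite normrN sin_max.
have h2 : `|sin s - sin t| <= `|s - t|.
  by apply: (@lipschitz_derive_le1 sin cos) => x; rewrite ?cos_max.
by nra.
Qed.

(** Since (b - d)(b + d) = - (a - c)(a + c) and |a + c| <= b + d, a quarter of a circle centred on a
    half axis is a 1-Lipschitz graph. *)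
Lemma quarter_circle (a b c d : R) : a ^+ 2 + b ^+ 2 = c ^+ 2 + d ^+ 2 ->
  `|a| <= b -> `|c| <= d -> `|b - d| <= `|a - c|.
Proof.
move=> e ab cd.
have b0 := le_trans (normr_ge0 _) ab; have d0 := le_trans (normr_ge0 _) cd.
have [bd|bd] := eqVneq (b + d) 0.
  have -> : b = 0 by lra.
  by rewrite (_ : d = 0) ?subrr ?normr0//; lra.
have bd0 : 0 < b + d by rewrite lt_neqAle eq_sym bd addr_ge0.
rewrite -(ler_pM2r bd0) -[X in _ * X <= _](ger0_norm (ltW bd0)) -normrM.
have -> : (b - d) * (b + d) = - ((a - c) * (a + c)).
  by apply/eqP; rewrite -subr_eq0; apply/eqP; move: e => /eqP; rewrite -subr_eq0 => /eqP <-; ring.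
by rewrite normrN normrM ler_wpM2l// (le_trans (ler_normD _ _))// lerD.
Qed.

Lemma hausdorff1_circle_square rho i j : (hausdorff1 (circle rho `&` square i j) <= 16%:E)%E.
Proof.
pose G1 (e : bool) := [set z | enorm z = rho /\ `|z.1| <= (-1) ^+ e * z.2].
pose G2 (e : bool) := [set z | enorm z = rho /\ `|z.2| <= (-1) ^+ e * z.1].
have n1 (e : bool) (x : R) : `|(-1) ^+ e * x| = `|x| by rewrite normrMsign.
have H1 e : (hausdorff1 (G1 e `&` square i j) <= 4%:E)%E.
  apply: hausdorff1_graph_square; left => z w [zr h1] [wr h2].
  rewrite -(n1 e) mulrBr; apply: quarter_circle => //.
  by rewrite !exprMn sqrr_sign !mul1r -!enorm_sqr zr wr.
have H2 e : (hausdorff1 (G2 e `&` square i j) <= 4%:E)%E.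
  apply: hausdorff1_graph_square; right => z w [zr h1] [wr h2].
  rewrite -(n1 e) mulrBr; apply: quarter_circle => //.
  by rewrite !exprMn sqrr_sign !mul1r ![_.2 ^+ 2 + _]addrC -!enorm_sqr zr wr.
have -> : 16 = 4 + 4 + (4 + 4) :> R by ring.
apply: (@le_trans _ _ (hausdorff1 (((G1 false `&` square i j) `|` (G1 true `&` square i j)) `|`
   ((G2 false `&` square i j) `|` (G2 true `&` square i j))))).
  apply: le_hausdorff1 => z [zr sz].
  have [h|/ltW h] := leP `|z.1| `|z.2|; [left|right].
    have [h0|/ltW h0] := leP 0 z.2; [left|right]; split => //; split => //.
      by rewrite expr0 mul1r -[leRHS]ger0_norm.
    by rewrite expr1 mulN1r -[leRHS]ler0_norm.
  have [h0|/ltW h0] := leP 0 z.1; [left|right]; split => //; split => //.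
    by rewrite expr0 mul1r -[leRHS]ger0_norm.
  by rewrite expr1 mulN1r -[leRHS]ler0_norm.
rewrite !EFinD; apply: (le_trans (outer_measureU2 hausdorff1 _ _)).
apply: leeD; apply: (le_trans (outer_measureU2 hausdorff1 _ _)).
  exact: (leeD (H1 _) (H1 _)).
exact: (leeD (H2 _) (H2 _)).
Qed.

Lemma concentric_circlesE eta : 0 < eta ->
  concentric_circles eta = \bigcup_k circle (eta * k.+1%:R).
Proof.
move=> e0; apply/seteqP; split => z.
  move=> [k [k0 h]]; case: k k0 h => // k _ h; exists k => //; apply/eqP.
  rewrite -(@eqrXn2 _ 2)// ?enorm_ge0 ?mulr_ge0 ?(ltW e0)// enorm_sqr h exprMn.
  exact/eqP.
by move=> [k _ zk]; exists k.+1; split => //; rewrite -enorm_sqr zk exprMn.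
Qed.

Lemma circles_locally_finite eta : 0 < eta ->
  locally_finite_length (\bigcup_k circle (eta * k.+1%:R)).
Proof.
move=> e0; apply: (@locally_finite_length_level _ _ (fun z => enorm z / eta - 1) (2 / eta) 16).
- by rewrite divr_ge0// ltW.
- by [].
- by move=> k z ->; rewrite mulrAC divff ?gt_eqF// mul1r -natr1; lra.
- move=> i j z sz; rewrite opprB addrA subrK -mulrBl normrM.
  rewrite [`|eta^-1|]ger0_norm ?invr_ge0 ?(ltW e0)// ler_wpM2r ?invr_ge0 ?(ltW e0)//.
  apply: (le_trans (enorm_lipschitz _ _)); apply: (le_trans (edist_le _ _)).
  by have [] := square_coord_dist sz; rewrite /=; lra.
- by move=> i j k; exact: hausdorff1_circle_square.
Qed.

(* On |z| = rho, put Z = zeta (z - w) and W = zeta w: then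
   (W + Z) (conj W + 2 x - Z) = rho^2 is linear in x = Re Z. *)
Lemma circle_equation (la : R) z w : la != 0 ->
  (la^-1)%:C%C * (zeta (z - w) + zeta w) * (z - w).1%:C%C =
  ((2 * la)^-1)%:C%C * ((zeta (z - w) - ((zeta w)^*%C - zeta w)) * zeta (z - w) +
    (z.1 ^+ 2 + z.2 ^+ 2 - (w.1 ^+ 2 + w.2 ^+ 2))%:C%C).
Proof.
move=> la0; rewrite /bargmann_var; case: z w => [x y] [u v] /=.
by apply/eqP; rewrite eq_complex /=; apply/andP; split; apply/eqP; field.
Qed.

(** The coefficients of the equation of a circle near [w] grow with |w|; division by [la = 1 + nw]
    keeps them bounded. The values at 0 stay separated because [rho j ^+ 2 - rho i ^+ 2 >= eta * (nw
    + eta)] grows as fast as [la], the quotient being at least [eta * Num.min 1 eta]. *)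
Lemma circle_arcs eta (N : nat) w : 0 < eta ->
  let r := (N%:R + 3) * eta in
  let k := 1 + 9 * r + (9 * r) ^+ 2 + ((N%:R + 2) * eta) + ((N%:R + 2) * eta) ^+ 2 in
  analytic_arcs (\bigcup_k circle (eta * k.+1%:R)) N r k
    (eta * Num.min 1 eta / 2) (eta / 2) w.
Proof.
move=> e0 r k; pose W := zeta w; pose nw := enorm w; have nw0 : 0 <= nw := enorm_ge0 w.
pose la := 1 + nw; have la0 : 0 < la by rewrite ltr_pwDl.
(* Thus [rho 0] is the first radius of the family that exceeds |w|. *)
pose k0 := Num.truncn (nw / eta).
pose rho i : R := eta * (k0 + i).+1%:R.
pose q := (N%:R + 2) * eta; have q0 : 0 < q by rewrite mulr_gt0// ltr_wpDl.
have nwd : 0 <= nw / eta by rewrite divr_ge0// ltW.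
have rho_nw i : (i <= N)%N -> 0 <= rho i - nw <= q.
  move=> iN; have /andP[h1 h2] := truncn_itv nwd; rewrite -/k0 in h1 h2.
  have h1' : k0%:R * eta <= nw by rewrite -ler_pdivlMr.
  have h2' : nw <= k0.+1%:R * eta by rewrite -ler_pdivrMr// ltW.
  have i0 : 0 <= i%:R :> R := ler0n _ _; have iN' : i%:R <= N%:R :> R by rewrite ler_nat.
  rewrite /rho -addSn natrD /q; rewrite -natr1 in h2' *; nra.
have rho_eta i : eta <= rho i by rewrite ler_peMr ?(ltW e0)// ler1n.
have W2 : normc W ^+ 2 = nw ^+ 2 by rewrite normc_sqr /W /nw enorm_sqr /= sqrrN.
have WE : normc W = nw.
  by apply/eqP; rewrite -(@eqrXn2 _ 2)// ?normc_ge0//; apply/eqP.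
have r9 : 0 <= 9 * r by rewrite mulr_ge0// mulr_ge0 ?(ltW e0)// addr_ge0.
have [c cdef] : exists c : nat -> R, forall i, c i = rho i ^+ 2 - nw ^+ 2.
  by exists (fun i => rho i ^+ 2 - nw ^+ 2).
have cq i : (i <= N)%N -> `|c i| <= q * (2 * nw + q).
  move=> iN; have /andP[h1 h2] := rho_nw i iN.
  have -> : c i = (rho i - nw) * (2 * nw + (rho i - nw)) by rewrite cdef; ring.
  by move: (rho i - nw) h1 h2 => x h1 h2; rewrite ger0_norm; nra.
pose mu : R := (2 * la)^-1; have mu0 : 0 < mu by rewrite invr_gt0 mulr_gt0.
exists ((la^-1)%:C%C%:P * ('X + W%:P)),
  (fun i => (mu%:C%C)%:P * (('X + (- (W^*%C - W))%:P) * 'X + (c i)%:C%C%:P)),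
  (fun i => circle (rho i) `&` [set z | edist z w <= r]),
  (fun=> if nw == 0 then (0, 1) else (- w.2 / nw, w.1 / nw)), (fun=> 0).
split.
- rewrite wnormZ normc_real ger0_norm ?invr_ge0 ?(ltW la0)//.
  apply: (@le_trans _ _ (la^-1 * (9 * r + nw))).
    rewrite ler_wpM2l ?invr_ge0 ?(ltW la0)// (le_trans (le_wnormD _ _ r9))//.
    by rewrite wnormX wnormC WE.
  rewrite mulrC ler_pdivrMr// /k -/q /la.
  have := sqr_ge0 (9 * r); have := sqr_ge0 q; move: (9 * r) r9 => x x0 s1 s2.
  rewrite mulrDr mulr1; have : 0 <= (x + x ^+ 2 + q + q ^+ 2) * nw.
    by rewrite mulr_ge0// !addr_ge0// ltW.
  by nra.
- move=> i iN; rewrite wnormZ wnorm_cons normc_real (ger0_norm (ltW mu0)) normc_real.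
  have h1 : wnorm (9 * r) ('X + (- (W^*%C - W))%:P) <= 9 * r + 2 * nw.
    rewrite (le_trans (le_wnormD _ _ r9))// wnormX wnormC normcN lerD2l.
    by rewrite (le_trans (le_normcB _ _))// normc_conj WE; lra.
  have h2 := cq i iN; rewrite /mu mulrC ler_pdivrMr ?mulr_gt0//.
  apply: (@le_trans _ _ (q * (2 * nw + q) + 9 * r * (9 * r + 2 * nw))).
    by apply: lerD => //; exact: ler_wpM2l.
  rewrite /k -/q /la; move: (9 * r) r9 => x x0.
  have := sqr_ge0 x; have := sqr_ge0 q => s1 s2.
  have := mulr_ge0 (ltW q0) nw0; have := mulr_ge0 x0 nw0.
  have := mulr_ge0 s1 nw0; have := mulr_ge0 s2 nw0; have := ltW q0; lra.
- move=> i j /andP[ij jN]; rewrite [X in normc X](_ : _ = (mu * (c i - c j))%:C%C); last first.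
    by rewrite rmorphM rmorphB !hornerE -mulrBr.
  rewrite normc_real normrM (ger0_norm (ltW mu0)) distrC.
  have rij : eta <= rho j - rho i.
    rewrite /rho -mulrBr ler_peMr ?(ltW e0)// -natrB ?ler1n ?ltnS ?leq_add2l ?(ltnW ij)//.
    by rewrite subn_gt0 ltnS ltn_add2l.
  have m1 : Num.min 1 eta <= 1 by rewrite ge_min lexx.
  have me : Num.min 1 eta <= eta by rewrite ge_min lexx orbT.
  have m0 : 0 <= Num.min 1 eta by rewrite le_min ler01 ltW.
  have /andP[h1 _] := rho_nw j jN; have h2 := rho_eta i.
  have -> : c j - c i = (rho j - rho i) * (rho j + rho i) by rewrite !cdef; ring.
  rewrite ger0_norm; last by apply: mulr_ge0; lra.
  apply: (@le_trans _ _ (mu * (eta * (Num.min 1 eta * la)))).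
    rewrite /mu invfM [X in _ <= X](_ : _ = eta * Num.min 1 eta / 2)//.
    by field; rewrite gt_eqF.
  rewrite ler_wpM2l ?(ltW mu0)//; apply: ler_pM => //; rewrite ?(ltW e0) ?mulr_ge0 ?(ltW la0)//.
  have : Num.min 1 eta * nw <= nw by rewrite ler_piMl.
  by rewrite /la mulrDr mulr1; lra.
- move=> i iN; split.
  + apply: (@measurableI _ (@hausdorff_plane R)); first exact: measurable_circle.
    apply: (@measurable_halfplane _ (fun z => edist z w)); exact: edist_lipschitz.
  + by move=> z [zr _]; exists (k0 + i)%N.
  + move=> z [zr zw]; rewrite normc_bargmann_varB; split => //.
    have cE : c i = z.1 ^+ 2 + z.2 ^+ 2 - (w.1 ^+ 2 + w.2 ^+ 2).
      by rewrite cdef -zr !enorm_sqr.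
    rewrite !hornerE cE /mu /W.
    by apply: circle_equation; rewrite gt_eqF.
(* [a] is the tangential and [e] the radial direction at [w], an arbitrary frame when [w = 0]. The
   arc is traced by s a + h e, with [h] fixed by the radius. *)
- move=> i iN; set a := (if _ then _ else _); pose e : R * R := (a.2, - a.1).
  have a1 : a.1 ^+ 2 + a.2 ^+ 2 = 1.
    rewrite /a; case: eqVneq => [_|n0] /=; first by rewrite expr0n add0r expr1n.
    by rewrite !expr_div_n sqrrN -mulrDl addrC -enorm_sqr -/nw mulfV// expf_neq0.
  have we : w = (nw * e.1, nw * e.2).
    rewrite /e /a; case: eqVneq => [n0|n0] /=; last first.
      by rewrite !mulNr opprK ![nw * _]mulrC !divfK// -surjective_pairing.
    have := enorm_sqr w; rewrite -/nw n0 expr0n /= => /esym/eqP.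
    rewrite paddr_eq0 ?sqr_ge0// !sqrf_eq0 => /andP[/eqP h1 /eqP h2].
    by rewrite !mul0r (surjective_pairing w) h1 h2.
  split => // s; rewrite add0r => /andP[s0 s1].
  have /andP[h1 h2] := rho_nw i iN; have h3 := rho_eta i.
  pose h := Num.sqrt (rho i ^+ 2 - s ^+ 2).
  have h0 : 0 <= h := sqrtr_ge0 _.
  have hE : h ^+ 2 = rho i ^+ 2 - s ^+ 2.
    by rewrite sqr_sqrtr// subr_ge0 ler_sqr ?nnegrE//; lra.
  have hr : rho i - s <= h <= rho i by apply/andP; split; nra.
  exists (s * a.1 + h * e.1, s * a.2 + h * e.2); last first.
    by rewrite /dot /e /=; transitivity (s * (a.1 ^+ 2 + a.2 ^+ 2)); [ring|rewrite a1 mulr1].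
  split.
    apply/eqP; rewrite -(@eqrXn2 _ 2)// ?enorm_ge0//; last by lra.
    rewrite enorm_sqr /e /=; apply/eqP.
    transitivity ((s ^+ 2 + h ^+ 2) * (a.1 ^+ 2 + a.2 ^+ 2)); first by ring.
    by rewrite a1 mulr1 hE; ring.
  have hd : `|h - nw| <= r - s by rewrite ler_norml /r; move: h2; rewrite /q; lra.
  rewrite /= -(@ler_pXn2r _ 2)// ?nnegrE ?edist_ge0//; last by rewrite /r mulr_ge0 ?(ltW e0)// addr_ge0.
  rewrite edist_sqr we /= /e /=.
  apply: (@le_trans _ _ ((s ^+ 2 + (h - nw) ^+ 2) * (a.1 ^+ 2 + a.2 ^+ 2))).
    by rewrite le_eqVlt; apply/orP; left; apply/eqP; ring.
  rewrite a1 mulr1 -(real_normK (num_real (h - nw))).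
  by have := normr_ge0 (h - nw); move: (`|h - nw|) hd => x; nra.
Qed.

Theorem concentric_circles_sampling (g : R -> R[i]) (p eta : R) :
  hermite_span g -> g <> (fun=> 0) -> 0 < p -> 0 < eta ->
  gabor_sampling_trajectory g p (concentric_circles eta).
Proof.
move=> hg g0 p0 e0; rewrite concentric_circlesE//.
apply: rich_gabor_sampling_trajectory => //.
- exists setT, (fun k => circle (eta * k.+1%:R)); split => // i _.
  by apply: circle_trajectory; rewrite mulr_ge0// ltW.
- apply: (@bigcup_measurable _ (@hausdorff_plane R)) => k _; exact: measurable_circle.
- exact: circles_locally_finite.
move=> N; exists ((N%:R + 3) * eta).
eexists; exists (eta * Num.min 1 eta / 2), (eta / 2); split; last by move=> w; exact: circle_arcs.
have r0 (x : R) : 0 < x -> 0 < (N%:R + x) * eta by move=> x0; rewrite mulr_gt0// ltr_wpDl.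
split; [exact: r0| |by rewrite !mulr_gt0// lt_min ltr01|exact: divr_gt0].
by rewrite !addr_ge0 ?sqr_ge0 ?ler01 ?mulr_ge0// ltW// r0.
Qed.

End circles.

(** * Polygons and spirals *)

Section fans.
Context {R : realType}.
Implicit Types (z w a b : R * R) (Gamma : set (R * R)) (y : nat -> R * R).

Definition fan (n : nat) y : Prop :=
  (forall i, (i < n)%N -> cross (y i) (y i.+1) != 0) /\
  forall w, exists i al be, [/\ (i < n)%N, 0 <= al, 0 <= be &
    w = al *: y i + be *: y i.+1].

(** The bit [sg i] tells whether the [i]-th segment ends on the next dilate: never for polygons, and
    at the last vertex of each turn for spirals. *)
Definition wedges (n : nat) y (sg : nat -> bool) : set (R * R) :=
  \bigcup_(i in `I_n) \bigcup_m segment (m.+1%:R *: y i) ((m.+1 + sg i)%:R *: y i.+1).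

Lemma crossZ (c d : R) a b : cross (c *: a) (d *: b) = c * d * cross a b.
Proof. by rewrite /cross !scale_pairE /=; ring. Qed.

Lemma fanZ n y (eta : R) : 0 < eta -> fan n y -> fan n (fun i => eta *: y i).
Proof.
move=> e0 [h1 h2]; split=> [i ni|w]; first by rewrite crossZ mulf_neq0 ?h1// mulf_neq0// gt_eqF.
have [i [al [be [ni al0 be0 ->]]]] := h2 w.
exists i, (al / eta), (be / eta); split; rewrite ?divr_ge0 ?(ltW e0)//.
by rewrite !scalerA !divfK ?gt_eqF.
Qed.

Lemma measurable_wedges n y sg : (forall i, (i < n)%N -> cross (y i) (y i.+1) != 0) ->
  hausdorff1.-caratheodory (wedges n y sg).
Proof.
move=> yn; apply: (@bigcup_measurable _ (@hausdorff_plane R)) => i ni.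
apply: (@bigcup_measurable _ (@hausdorff_plane R)) => m _.
apply: measurable_segment; apply/eqP => e.
have : cross (m.+1%:R *: y i) ((m.+1 + sg i)%:R *: y i.+1) != 0.
  by rewrite crossZ !mulf_neq0 ?yn// pnatr_eq0// addSn.
by rewrite e /cross subr_eq0 mulrC eqxx.
Qed.

(** By Cramer's rule the level [s] is al + be - 1 in the basis (a, b); it runs from [m] to [m + sg]
    along the [m]-th segment. *)
Lemma wedge_locally_finite a b (sg : bool) : cross a b != 0 ->
  locally_finite_length (\bigcup_m segment (m.+1%:R *: a) ((m.+1 + sg)%:R *: b)).
Proof.
move=> ab; pose s z := (cross z b + cross a z) / cross a b - 1.
apply: (@locally_finite_length_level _ _ s (2 * (enorm a + enorm b) / `|cross a b|) 4) => //.
- by rewrite divr_ge0// mulr_ge0// addr_ge0 ?enorm_ge0.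
- move=> m z [t /andP[t0 t1] <-].
  have -> : s (affine_comb (m.+1%:R *: a) ((m.+1 + sg)%:R *: b) t) = m%:R + t * sg%:R.
    rewrite /s affine_combE /cross !scale_pairE natrD /= -natr1.
    by move: ab; rewrite /cross => ab; field.
  by case: sg => /=; rewrite ?mulr1 ?mulr0; lra.
- move=> i j z sz; set z0 := (_, _).
  have -> : s z - s z0 = (cross (z - z0) b + cross a (z - z0)) / cross a b.
    by rewrite /s opprB addrA subrK -mulrBl; congr (_ / _); rewrite /cross /=; ring.
  rewrite normrM normfV ler_wpM2r ?invr_ge0//.
  apply: (le_trans (ler_normD _ _)); have h1 := cross_le (z - z0) b; have h2 := cross_le a (z - z0).
  have : enorm (z - z0) <= 2.
    rewrite -edist_enorm (le_trans (edist_le _ _))//.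
    by have [] := square_coord_dist sz; rewrite /=; lra.
  by have := enorm_ge0 a; have := enorm_ge0 b; nra.
- by move=> i j k; exact: hausdorff1_segment_square.
Qed.

Lemma fan_arcs Gamma n y sg (N : nat) : (forall i, (i < n)%N -> cross (y i) (y i.+1) != 0) ->
  wedges n y sg `<=` Gamma ->
  exists r0 dl0 l0 : R, [/\ 0 < r0, 0 < dl0 & 0 < l0] /\
  forall r dl l, r0 <= r -> 0 < dl <= dl0 -> 0 < l <= l0 ->
  forall i w (al be : R), (i < n)%N -> 0 <= al -> 0 <= be ->
  w = al *: y i + be *: y i.+1 -> analytic_arcs Gamma N r (10 * r + 1) dl l w.
Proof.
elim: n => [|n IH] yn sub; first by exists 1, 1, 1.
have sub' : wedges n y sg `<=` Gamma.
  by apply: subset_trans sub => z [i /= ni h]; exists i => //=; rewrite ltnS ltnW.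
have [r1 [d1 [l1 [[r10 d10 l10] h1]]]] := IH (fun i ni => yn i (leqW ni)) sub'.
have [r2 [d2 [l2 [[r20 d20 l20] h2]]]] := wedge_arcs (sg n) N (yn n (ltnSn n)).
exists (Num.max r1 r2), (Num.min d1 d2), (Num.min l1 l2); split.
  by rewrite lt_max r10 !lt_min d10 l10.
move=> r dl l; rewrite ge_max !le_min.
move=> /andP[rr1 rr2] /and3P[dl0 dd1 dd2] /and3P[l0 ll1 ll2] i w al be.
rewrite ltnS leq_eqVlt => /orP[/eqP ->|ni]; last first.
  by apply: h1 => //; apply/andP.
apply: h2 => //; [exact/andP|exact/andP|].
by move=> m z hz; apply: sub; exists n => //=; exists m.
Qed.

Theorem fan_sampling (g : R -> R[i]) (p : R) n y sg :
  hermite_span g -> g <> (fun=> 0) -> 0 < p -> fan n y ->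
  gabor_sampling_trajectory g p (wedges n y sg).
Proof.
move=> hg g0 p0 [yn cov]; apply: rich_gabor_sampling_trajectory => //.
- by apply: trajectory_set_bigcup => i m; exact: segment_trajectory.
- exact: measurable_wedges.
- by apply: locally_finite_length_bigcup => i ni; apply: wedge_locally_finite; exact: yn.
move=> N; have [r [dl [l [[r0 dl0 l0] h]]]] := @fan_arcs _ n y sg N yn (@subset_refl _ _).
exists r, (10 * r + 1), dl, l; split.
  by split => //; rewrite addr_ge0// mulr_ge0// ltW.
move=> w; have [i [al [be [ni al0 be0 wE]]]] := cov w.
by apply: (h r dl l _ _ _ i w al be) => //; rewrite lexx andbT.
Qed.

End fans.

(** * Star-shaped polygons *)

Section polygons.
Context {R : realType}.
Implicit Types (z w a b : R * R) (v : seq (R * R)).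

Lemma cross_neq0 a b : a != b -> (forall t : R, affine_comb a b t <> 0) -> cross a b != 0.
Proof.
move=> ab h; apply/eqP => c0.
pose D : R := (b.1 - a.1) ^+ 2 + (b.2 - a.2) ^+ 2.
have D0 : D != 0.
  apply: contra ab; rewrite paddr_eq0 ?sqr_ge0// !sqrf_eq0 !subr_eq0 => /andP[/eqP h1 /eqP h2].
  by apply/eqP; rewrite (surjective_pairing a) (surjective_pairing b) h1 h2.
(* The parameter of the orthogonal projection of 0 to the line; if the cross product vanishes, this
   projection is 0 itself. *)
apply: (h (- (a.1 * (b.1 - a.1) + a.2 * (b.2 - a.2)) / D)).
rewrite affine_combE; move: c0 D0; rewrite /cross /D => c0 D0.
congr (_, _); apply: (mulIf D0); rewrite mul0r.
  transitivity ((b.2 - a.2) * (a.1 * b.2 - a.2 * b.1)); first by field.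
  by rewrite c0 mulr0.
transitivity (- (b.1 - a.1) * (a.1 * b.2 - a.2 * b.1)); first by field.
by rewrite c0 mulr0.
Qed.

(* A ray from 0 missing A would be an unbounded connected part of the
   component of 0. *)
Lemma ray_meets_bounding_set (A : set (R * R)) w : ~ A 0 -> bounded_region A 0 -> w != 0 ->
  exists2 s : R, 0 < s & A (s *: w).
Proof.
move=> A0 [//|[_ bnd]] w0; apply: contrapT => /forall2NP hA.
pose B := (fun s : R => s *: w) @` [set s | 0 <= s].
have BA : B `<=` ~` A.
  move=> _ [s s0 <-] As; have [s00|] := hA s; last by [].
  apply: s00; rewrite lt_neqAle [0 <= s]s0 andbT eq_sym; apply/eqP => s00.
  by apply: A0; rewrite s00 scale0r in As.
have B0 : B 0 by exists 0; rewrite /= ?lexx// scale0r.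
have Bc : connected B.
  apply: connected_continuous_connected.
    apply/connected_intervalP => x y x0 y0 t /andP[xt _]; exact: le_trans xt.
  by apply: continuous_subspaceT; exact: scalel_continuous.
have [M [_ hM]] := bnd; have /hM hM1 : M < `|M| + 1 by rewrite (le_lt_trans (ler_norm M))// ltrDl.
have nw : 0 < `|w| by rewrite normr_gt0.
have sw : 0 <= (`|M| + 2) / `|w| by rewrite divr_ge0// addr_ge0.
have Bs : B (((`|M| + 2) / `|w|) *: w) by exists ((`|M| + 2) / `|w|).
have := hM1 _ (connected_component_max B0 BA Bc Bs).
by rewrite /= normrZ ger0_norm// divfK ?gt_eqF// lerD2l; lra.
Qed.

(** 0 lies in a bounded component of the complement of the polygon, so every ray from 0 meets an
    edge, and rescaling the meeting point puts [w] in the cone over that edge. *)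
Lemma polygon_fan v : simple_polygon v -> star_kernel (polygon v) 0 ->
  edge_lines_avoid_origin v -> fan (size v) (cyc v).
Proof.
move=> [v3 vinj] [br0 _] avoid; split=> [i iv|w].
  apply: cross_neq0; last by move=> t; exact: avoid.
  (* A degenerate edge would pass through one point at the parameters 0 and 1/2. *)
  apply/eqP => e; have [] := vinj i i 0 (1 / 2) iv iv.
  - by rewrite lexx ltr01.
  - by apply/andP; split; lra.
  - by rewrite !affine_combE -e; congr (_, _); ring.
  - by move=> _ /eqP; rewrite eq_sym mulf_eq0 oner_eq0 invr_eq0 pnatr_eq0.
have p0 : ~ polygon v 0 by move=> [i /= iv [t _ h]]; exact: (avoid i t iv).
have [->|w0] := eqVneq w 0.
  by exists 0%N, 0, 0; split; rewrite ?scale0r ?addr0// (leq_trans _ v3).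
have [s s0 [i /= iv [t /andP[t0 t1] h]]] := ray_meets_bounding_set p0 br0 w0.
exists i, ((1 - t) / s), (t / s); split => //; rewrite ?divr_ge0 ?(ltW s0) ?subr_ge0//.
apply: (@scalerI _ _ s); first by rewrite gt_eqF.
by rewrite -h scalerDr !scalerA ![s * _]mulrC !divfK// gt_eqF.
Qed.

Lemma concentric_dilatesE (eta : R) v : concentric_dilates eta (polygon v) =
  wedges (size v) (fun i => eta *: cyc v i) (fun=> false).
Proof.
have segZ (c : R) a b t : c *: affine_comb a b t = affine_comb (c *: a) (c *: b) t.
  by rewrite /affine_comb scalerDr !scalerA ![c * _]mulrC.
apply/seteqP; split => z.
  move=> [k [k0 [_ [i iv [t t01 <-]] ->]]]; case: k k0 => // k _.
  exists i => //; exists k => //; exists t => //.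
  by rewrite addn0 !scalerA segZ [eta * _]mulrC.
move=> [i iv [k _ [t t01 <-]]]; exists k.+1; split => //.
exists (affine_comb (cyc v i) (cyc v i.+1) t); first by exists i => //; exists t.
by rewrite addn0 !scalerA segZ [eta * _]mulrC.
Qed.

End polygons.

(** * Spirals *)

Section spirals.
Context {R : realType}.
Implicit Types (z w a b : R * R) (y : nat -> R * R) (theta : nat -> R).

Lemma cos_eq1_ge2pi (d : R) : 0 < d -> cos d = 1 -> pi *+ 2 <= d.
Proof.
move=> d0 d1; rewrite leNgt; apply/negP => d2.
have : 0 < sin (d / 2).
  by apply: sin_gt0_pi; rewrite divr_gt0//= ltr_pdivrMr// mulr_natr.
have := cos_mulr2n (d / 2); rewrite -[d / 2 *+ 2]mulr_natr divfK// d1 cos2sin2.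
by move: (sin _) => x; rewrite mulr2n => h1 h2; nra.
Qed.

Lemma angle_bracket n theta (tau : R) : theta 0%N <= tau <= theta n ->
  (0 < n)%N -> exists2 i, (i < n)%N & theta i <= tau <= theta i.+1.
Proof.
elim: n => // n IH /andP[h1 h2] _.
have [h|/ltW h] := leP (theta n) tau; first by exists n; rewrite ?h.
case: n IH h h2 => [_ h h2|n IH h _]; first by exists 0%N; rewrite ?h1.
have [|//|i ni hi] := IH; first by rewrite h1.
by exists i => //; exact: leqW.
Qed.

(** As [y n = y 0], the total turn is a positive multiple of 2 pi, hence at least 2 pi. Every
    direction then falls between two consecutive [theta i], which are less than pi apart, and the
    law of sines gives nonnegative coordinates. *)
Lemma turning_fan n y theta : (0 < n)%N -> y n = y 0%N ->
  (forall i, (i <= n)%N -> is_arg (y i) (theta i)) ->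
  (forall i, (i < n)%N -> 0 < theta i.+1 - theta i < pi) -> fan n y.
Proof.
move=> n0 yn0 arg turn.
have yE i : (i <= n)%N -> y i = enorm (y i) *: (cos (theta i), sin (theta i)) :> (R * R).
  by move=> /arg[_ {1}->].
have y0 i : (i <= n)%N -> 0 < enorm (y i).
  move=> ni; rewrite lt_neqAle enorm_ge0 andbT eq_sym; apply/eqP => h.
  by have [yi _] := arg i ni; apply: yi; rewrite (yE i ni) h scale0r.
have sin0 i : (i < n)%N -> 0 < sin (theta i.+1 - theta i).
  by move=> ni; apply: sin_gt0_pi; exact: turn.
split=> [i ni|w].
  rewrite (yE i (ltnW ni)) (yE i.+1 ni) crossZ.
  apply: mulf_neq0; first by rewrite mulf_neq0// gt_eqF// y0// ltnW.
  rewrite (_ : cross _ _ = sin (theta i.+1 - theta i)); first by rewrite gt_eqF// sin0.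
  by rewrite sinB /cross /=; ring.
have range2pi : pi *+ 2 <= theta n - theta 0%N.
  apply: cos_eq1_ge2pi.
    have /andP[h _] := turn 0%N n0.
    have h1 i : (0 < i)%N -> (i <= n)%N -> theta 0%N < theta i.
      case: i => // i _; elim: i => [_|i IH ni]; first by rewrite -subr_gt0.
      by have /andP[h' _] := turn i.+1 ni; have := IH (ltnW ni); lra.
    by rewrite subr_gt0 h1.
  have e := yE n (leqnn n); have e0 := yE 0%N (leq0n n).
  rewrite yn0 {1}e0 in e; have r0 := y0 0%N (leq0n n).
  have [h1 h2] : cos (theta 0%N) = cos (theta n) /\ sin (theta 0%N) = sin (theta n).
    by case: e => /(mulfI (negbT (gt_eqF r0))) -> /(mulfI (negbT (gt_eqF r0))) ->.
  by rewrite cosB h1 h2 -!expr2 cos2Dsin2.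
pose c := theta 0%N.
(* [w] is rotated by [- c], so that its polar angle is counted from [theta 0], where the bracketing
   starts. *)
have [t t2pi tE] := polar_angle (w.1 * cos c + w.2 * sin c, w.2 * cos c - w.1 * sin c).
set rw := enorm _ in tE.
have wE : w = rw *: (cos (c + t), sin (c + t)) :> R * R.
  case: tE => e1 e2; have cs := cos2Dsin2 c.
  rewrite scale_pairE /= cosD sinD; rewrite {1}(surjective_pairing w); congr (_, _).
    transitivity (cos c * (rw * cos t) - sin c * (rw * sin t)); last by ring.
    rewrite -e1 -e2; transitivity (w.1 * (cos c ^+ 2 + sin c ^+ 2)); last by ring.
    by rewrite cs mulr1.
  transitivity (sin c * (rw * cos t) + cos c * (rw * sin t)); last by ring.
  rewrite -e1 -e2; transitivity (w.2 * (cos c ^+ 2 + sin c ^+ 2)); last by ring.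
  by rewrite cs mulr1.
have [|i ni] := @angle_bracket n theta (c + t) _ n0.
  by move: t2pi range2pi; rewrite /c; move: (pi *+ 2) => x; lra.
set tau := c + t in wE *; move=> /andP[h1 h2]; have /andP[_ hpi] := turn i ni.
have rw0 : 0 <= rw := enorm_ge0 _.
have s0 := sin0 i ni; have yi := y0 i (ltnW ni); have yi1 := y0 i.+1 ni.
have sa : 0 <= sin (theta i.+1 - tau) by apply: sin_ge0_pi; apply/andP; split; lra.
have sb : 0 <= sin (tau - theta i) by apply: sin_ge0_pi; apply/andP; split; lra.
set S := sin (theta i.+1 - theta i) in s0.
exists i, (rw * sin (theta i.+1 - tau) / S / enorm (y i)),
  (rw * sin (tau - theta i) / S / enorm (y i.+1)).
split => //; try by rewrite !divr_ge0 ?mulr_ge0// ltW.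
have nrm j (x : R) : (j <= n)%N -> (x / enorm (y j)) *: y j = x *: (cos (theta j), sin (theta j)) :> R * R.
  by move=> nj; rewrite {2}(yE j nj) scalerA divfK// gt_eqF// y0.
rewrite nrm ?(ltnW ni)// nrm// wE !scale_pairE; have Sn : S != 0 by rewrite gt_eqF.
congr (_, _) => /=; apply: (mulIf Sn).
  transitivity (rw * (sin (theta i.+1 - tau) * cos (theta i) + sin (tau - theta i) * cos (theta i.+1))).
    by rewrite /S !sinB; ring.
  by field.
transitivity (rw * (sin (theta i.+1 - tau) * sin (theta i) + sin (tau - theta i) * sin (theta i.+1))).
  by rewrite /S !sinB; ring.
by field.
Qed.

(** Reflection in the first axis negates arguments, which reduces decreasing arguments to increasing
    ones. *)
Lemma mirror_fan n y : fan n (fun i => ((y i).1, - (y i).2)) -> fan n y.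
Proof.
move=> [h1 h2]; split=> [i ni|w].
  apply: contra (h1 i ni) => /eqP h; rewrite -oppr_eq0; apply/eqP.
  by rewrite -h /cross /=; ring.
have [i [al [be [ni al0 be0]]]] := h2 (w.1, - w.2).
rewrite !scale_pairE => -[e1 e2]; exists i, al, be; split => //.
rewrite !scale_pairE (surjective_pairing w); congr (_, _) => /=; first exact: e1.
by apply: oppr_inj; rewrite e2; ring.
Qed.

Lemma spiral_fan (s : seq (R * R)) : (0 < size s)%N ->
  arg_increasing s \/ arg_decreasing s -> fan (size s) (cyc s).
Proof.
move=> s0; have e : cyc s (size s) = cyc s 0 by rewrite /cyc modnn mod0n.
move=> [[theta [h1 h2]]|[theta [h1 h2]]]; first exact: (turning_fan s0 e h1 h2).
apply: mirror_fan; apply: (@turning_fan _ _ (fun i => - theta i)) => //.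
- by rewrite e.
- move=> i /h1[ci ciE]; split.
    by move=> [c1 /eqP]; rewrite oppr_eq0 => /eqP c2; apply: ci; rewrite (surjective_pairing (cyc s i)) c1 c2.
  rewrite cosN sinN (_ : enorm _ = enorm (cyc s i)).
    by rewrite {1 2}ciE /= mulrN.
  by apply/eqP; rewrite -(@eqrXn2 _ 2)// ?enorm_ge0// !enorm_sqr /= sqrrN.
- by move=> i /h2; rewrite opprK addrC.
Qed.

(** Entry [m * size s + i] is the [i]-th vertex of turn [m]; its successor belongs to the next turn
    exactly when [i] is the last index. *)
Lemma spiral_pathE (eta : R) (s : seq (R * R)) : (0 < size s)%N -> spiral_path eta s =
  wedges (size s) (fun i => eta *: cyc s i) (fun i => i.+1 == size s).
Proof.
move=> s0.
have edge i m : (i < size s)%N ->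
  segment (spiral_vertex eta s (m * size s + i)) (spiral_vertex eta s (m * size s + i).+1) =
  segment (m.+1%:R *: (eta *: cyc s i)) ((m.+1 + (i.+1 == size s))%:R *: (eta *: cyc s i.+1)).
  move=> si; rewrite /spiral_vertex !scalerA -addnS /cyc !modnMDl !divnMDl// divn_small// addn0.
  congr segment; congr (_ *: _).
  case: (eqVneq i.+1 (size s)) => [->|h]; first by rewrite divnn s0 addSn.
  by rewrite divn_small// ltn_neqAle h.
apply/seteqP; split => z.
  move=> [j _ h]; exists (j %% size s)%N; first by rewrite /= ltn_mod.
  exists (j %/ size s)%N => //; rewrite -edge ?ltn_mod//.
  by rewrite -divn_eq.
by move=> [i /= si [m _]]; rewrite -edge// => h; exists (m * size s + i)%N.
Qed.

End spirals.

Theorem theorem1 (R : realType) (g : R -> R[i]) (p eta : R)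
    (v : seq (R * R)) (n : nat) (z : n.-tuple (R * R)) :
  hermite_span g -> g <> (fun=> 0) ->
  1 <= p -> 0 < eta ->
  simple_polygon v ->
  star_shaped (polygon v) ->
  star_kernel (polygon v) 0 ->
  edge_lines_avoid_origin v ->
  (3 <= n)%N ->
  arg_increasing z \/ arg_decreasing z ->
  [/\ gabor_sampling_trajectory g p (concentric_circles eta),
      gabor_sampling_trajectory g p (concentric_dilates eta (polygon v)) &
      gabor_sampling_trajectory g p (spiral_path eta z)].
Proof.
move=> hg g0 p1 e0 simple _ ker avoid n3 arg.
have p0 : 0 < p := lt_le_trans ltr01 p1.
have z0 : (0 < size z)%N by rewrite size_tuple (leq_trans _ n3).
split.
- exact: concentric_circles_sampling.
- by rewrite concentric_dilatesE; apply: fan_sampling => //; apply: fanZ => //; exact: polygon_fan.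
- by rewrite spiral_pathE//; apply: fan_sampling => //; apply: fanZ => //; exact: spiral_fan.
Qed.
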